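(* There exist universal positive constants $c_0,c_1$, and a constant $c(s)>0$ depending only on $s\in[0,2)$, such that the following holds. Let $T\in\{\mathbb Z,\mathbb R\}$ and let $f$ be a GSP over $T$ whose spectral measure $\rho$ satisfies $\rho(T^* )=1$, has $m_\delta(\rho)<\infty$ for some $\delta>0$, and has a nontrivial absolutely continuous component $\rho_{ac}$. Let $\nu>0$ and let $E\subseteq T^*$ be a bounded set of positive Lebesgue measure $|E|$ on which $d\rho_{ac}\ge\nu\,dx$. Let $q>0$ be such that $\frac1qE\subseteq[-\pi,\pi]$. Let $\gamma\ge0$ be such that $m_{-\gamma}(\rho)<\infty$, let $k\in\mathbb N\cup\{0\}$ and $0\le s<2$ be such that $\gamma=2k+s$, and put $r=\max\{k,s/2\}$. Set $$\alpha=c_0|E|,\qquad \beta=\begin{cases}(c_1k)^{-k}\sqrt{\dfrac{\nu|E|}{m_{-2k}(\rho)}}, & k>0,\\[2mm] c(s)\sqrt{\dfrac{\nu|E|}{m_{-s}(\rho)}}, & k=0,\end{cases}\qquad \theta=\begin{cases}\sqrt{\dfrac{m_{-2k+2}(\rho)}{4m_{-2k}(\rho)}}, & k>0,\\ 1, & k=0.\end{cases}$$ Then there exists $N_0(E)>0$ such that for every $N>\max\{N_0(E),2k\}$ and with $$\ell_0(N)=2N^{-r}\max\{\sqrt{\log(\theta N)},1\},$$ the following holds for all $\ell>\ell_0(N)$: $$P_f(N)\le 2\,\mathbb P\big(N^{-r}Z>\ell\big)+2qN\,\mathbb P\big(\beta|Z|<\ell\big)^{\alpha N}.$$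
   Context: Let $T\in\{\mathbb Z,\mathbb R\}$; put $T^*=\mathbb R$ if $T=\mathbb R$ and $T^*=[-\pi,\pi]$ if $T=\mathbb Z$. A GSP (Gaussian stationary process) over $T$ is a random function $f:T\to\mathbb R$ whose finite-dimensional marginals are centered multivariate Gaussian and whose distribution is invariant under translations by elements of $T$; throughout, $f$ is assumed almost surely continuous with continuous covariance kernel $r(t)=\mathbb E[f(0)f(t)]$ (this function $r(\cdot)$ is unrelated to the number $r=\max\{k,s/2\}$ of the claim). Its spectral measure is the finite, symmetric, non-negative measure $\rho$ on $T^*$ such that $\mathbb E[f(0)f(t)]=\int_{T^*}e^{-i\lambda t}\,d\rho(\lambda)$ for $t\in T$. The persistence probability is $P_f(N)=\mathbb P\big(f(t)>0\ \ \forall t\in(0,N]\cap T\big)$. For $\delta\in\mathbb R$ put $m_\delta(\rho)=\int_{T^*}|\lambda|^\delta\,d\rho(\lambda)$. $Z$ denotes a standard Gaussian random variable, $Z\sim\mathcal N(0,1)$. When $0<\theta N<1$, so that $\log(\theta N)<0$, the expression $\max\{\sqrt{\log(\theta N)},1\}$ is understood as $1$. *)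

(* Defs.v *)
From HB Require Import structures.
From mathcomp Require Import all_boot all_order all_algebra.
From mathcomp Require Import all_classical all_reals all_analysis.

Set Implicit Arguments.
Unset Strict Implicit.
Unset Printing Implicit Defensive.

Import Order.TTheory GRing.Theory Num.Theory.
Import numFieldNormedType.Exports.

Local Open Scope classical_set_scope.
Local Open Scope ring_scope.

Inductive time := TimeZ | TimeR.

Definition time_domain (R : realType) (T : time) : zmodType :=
  match T with TimeZ => int | TimeR => R end.

Definition to_real (R : realType) (T : time) : time_domain R T -> R :=
  match T with TimeZ => fun n : int => n%:~R | TimeR => fun x : R => x end.

(* The frequency domain T^*. *)
Definition freq_domain (R : realType) (T : time) : set R :=
  match T with TimeZ => `[- pi, pi] | TimeR => [set: R] end.
Arguments freq_domain : clear implicits.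

(* T carries the topology induced by R, which is discrete for T = Z. *)
Definition continuous_on_time (R : realType) (T : time)
    (g : time_domain R T -> R) :=
  continuous (g : initial_topology (@to_real R T) -> R).

(* normal_prob 0 0 is not the Dirac mass at 0 in the library, so the
   degenerate Gaussian law is treated separately. *)
Definition centered_gaussian_law (R : realType) (sigma : R) (A : set R) :
    \bar R :=
  if sigma == 0 then \d_(0 : R) A else normal_prob 0 sigma A.

(* A vector is centered Gaussian (possibly degenerate) when all linear
   combinations of its coordinates are centered Gaussian variables. *)
Definition centered_gaussian_vector (R : realType) (d : measure_display)
    (Om : measurableType d) (P : probability Om R) (n : nat)
    (X : 'I_n -> {RV P >-> R}) :=
  forall a : 'I_n -> R, exists2 sigma : R, 0 <= sigma &
    forall A : set R, measurable A ->
      P [set w | A (\sum_(i < n) a i * X i w)] = centered_gaussian_law sigma A.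

(* The sigma-algebra on R^T generated by the coordinate maps, on which the
   distribution of a process lives. *)
Definition cylinder_sigma_algebra (R : realType) (T : time) :
    set (set (time_domain R T -> R)) :=
  <<s [set B | exists t : time_domain R T, exists2 A : set R,
         measurable A & B = [set g | A (g t)]] >>.

Definition stationary (R : realType) (T : time) (d : measure_display)
    (Om : measurableType d) (P : probability Om R)
    (f : time_domain R T -> {RV P >-> R}) :=
  forall (u : time_domain R T) (B : set (time_domain R T -> R)),
    cylinder_sigma_algebra B ->
    P [set w | B (fun t => f (t + u) w)] = P [set w | B (fun t => f t w)].

Definition covariance_kernel (R : realType) (T : time) (d : measure_display)
    (Om : measurableType d) (P : probability Om R)
    (f : time_domain R T -> {RV P >-> R}) (t : time_domain R T) : \bar R :=
  ('E_P[fun w => (f 0 w * f t w)%R])%E.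

Definition is_GSP (R : realType) (T : time) (d : measure_display)
    (Om : measurableType d) (P : probability Om R)
    (f : time_domain R T -> {RV P >-> R}) :=
  [/\ forall (n : nat) (t : 'I_n -> time_domain R T),
        centered_gaussian_vector (fun i => f (t i)),
      stationary f,
      {ae P, forall w, continuous_on_time (fun t => f t w)} &
      continuous_on_time (fun t => fine (covariance_kernel f t))].

(* A measure on T^* is a measure on R carried by freq_domain R T.  The identity
   E[f(0) f(t)] = \int e^{-i lambda t} drho(lambda) is split into its real and
   imaginary parts. *)
Definition is_spectral_measure (R : realType) (T : time) (d : measure_display)
    (Om : measurableType d) (P : probability Om R)
    (f : time_domain R T -> {RV P >-> R})
    (rho : {finite_measure set (measurableTypeR R) -> \bar R}) :=
  [/\ rho (~` freq_domain R T) = 0%E,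
      forall A : set R, measurable A -> rho [set - x | x in A] = rho A,
      forall t : time_domain R T, covariance_kernel f t =
        (\int[rho]_(x in freq_domain R T) (cos (x * to_real t))%:E)%E &
      forall t : time_domain R T,
        (\int[rho]_(x in freq_domain R T) (- sin (x * to_real t))%:E)%E = 0%E].

(* For N real.  P is extended to all subsets by its outer measure: for T = R the
   event is an uncountable intersection, which is measurable only up to a null
   set since paths are only almost surely continuous. *)
Definition persistence (R : realType) (T : time) (d : measure_display)
    (Om : measurableType d) (P : probability Om R)
    (f : time_domain R T -> {RV P >-> R}) (N : R) : \bar R :=
  mu_ext P
    [set w | forall t : time_domain R T, 0 < to_real t <= N -> 0 < f t w].

(* |x|^delta, with value +oo at x = 0 for delta < 0 (the library has
   0 `^ delta = 0 there). *)
Definition abs_pow (R : realType) (delta x : R) : \bar R :=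
  if (x == 0) && (delta < 0) then +oo%E else (`|x| `^ delta)%:E.

Definition moment (R : realType) (T : time)
    (rho : {finite_measure set (measurableTypeR R) -> \bar R}) (delta : R) :
    \bar R :=
  (\int[rho]_(x in freq_domain R T) abs_pow delta x)%E.

Definition lebesgue_decomposition (R : realType)
    (rho rho_ac rho_s : {finite_measure set (measurableTypeR R) -> \bar R}) :=
  [/\ forall A : set R, measurable A -> rho A = (rho_ac A + rho_s A)%E,
      rho_ac `<< (@lebesgue_measure R) &
      exists2 B : set R, measurable B &
        lebesgue_measure B = 0%E /\ rho_s (~` B) = 0%E].

(* completed_lebesgue_measure is Lebesgue outer measure on arbitrary sets. *)
Definition lebesgue_measurable (R : realType) (E : set R) :=
  caratheodory_measurable (@completed_lebesgue_measure R) E.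

Definition leb (R : realType) (E : set R) : R :=
  fine (completed_lebesgue_measure E).

Definition beta_param (R : realType) (c1 : R) (c : R -> R) (T : time)
    (rho : {finite_measure set (measurableTypeR R) -> \bar R}) (nu : R)
    (E : set R) (k : nat) (s : R) : R :=
  if (0 < k)%N then
    (c1 * k%:R) ^- k *
      Num.sqrt (nu * leb E / fine (moment T rho (- (2 * k%:R))))
  else c s * Num.sqrt (nu * leb E / fine (moment T rho (- s))).

Definition theta_param (R : realType) (T : time)
    (rho : {finite_measure set (measurableTypeR R) -> \bar R}) (k : nat) : R :=
  if (0 < k)%N then
    Num.sqrt (fine (moment T rho (- (2 * k%:R) + 2)) /
              (4 * fine (moment T rho (- (2 * k%:R)))))
  else 1.

Definition r_param (R : realType) (k : nat) (s : R) : R :=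
  Num.max k%:R (s / 2).

(* Num.sqrt is 0 on negative numbers, so the maximum is 1 when theta * N < 1. *)
Definition ell0 (R : realType) (r theta N : R) : R :=
  2 * N `^ (- r) * Num.max (Num.sqrt (ln (theta * N))) 1.

(* Main.v *)
(* Average f over a k-fold sumset of an arithmetic progression spanning about
   half of (0, N], shifted by a set J of n ~ |E| N lattice points.  The spectral
   weight of this average is the k-th power of a Fejer-type kernel, bounded by
   (C k / (N |x|))^(2k), so its standard deviation is of order
   N^(-r) sqrt (m_(-2r)).  Hence the average is O(l) outside an event of
   probability P(N^(-r) Z > l); by Markov's inequality at least half of the
   translates of J then see an average at most twice as large.

   It remains to bound, for one translate of J, the probability that f is
   positive on it with a small average.  J is chosen greedily: exponentials are
   orthogonal on [-pi q, pi q], so Bessel's inequality leaves room for n points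
   such that each f(j) has variance at least nu |E| / 2 given the earlier ones.
   Up to a factor exponential in n, the indicator of the event is at most a
   product of two-level functions of the f(j), each with conditional expectation
   bounded by an anti-concentration estimate.  The successive conditioning is
   performed on trigonometric polynomials, through characteristic functions, and
   passes to two-level functions by bounded convergence. *)

Require Import Defs.
From HB Require Import structures.
From mathcomp Require Import all_boot all_order all_algebra.
From mathcomp Require Import all_classical all_reals all_analysis.
From mathcomp Require Import measurable_realfun.
From mathcomp Require Import ring lra.

Set Implicit Arguments.
Unset Strict Implicit.
Unset Printing Implicit Defensive.

Import Order.TTheory GRing.Theory Num.Theory.
Import numFieldNormedType.Exports.

Local Open Scope classical_set_scope.
Local Open Scope ring_scope.

(** * Gaussian measures on the line *)

(** For large l the small-ball probability p is close to 1, and an absolute constant lost at each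
    point of J would ruin the bound. So the test function takes the value p itself beyond its
    threshold: Markov's inequality then costs p^(-n/64), each conditional expectation is at most
    p^(1/32), and p^(n/64) remains in every regime.

    Characteristic functions stand in for conditional densities because the definition of a Gaussian
    vector speaks of laws of linear combinations. These give expectations of cosines directly, and
    no joint density is ever formed.

    The points of J are selected for Lebesgue measure on a Borel part of E, where Bessel's
    inequality is available; distances to spans can only grow when nu dx is replaced by the larger
    rho.

    The lattice spacing is chosen inside the proof, so that the lattice lies in T, and it cancels
    from the exponent. The q of the statement returns at the end: N > 2 pi / |E| and |E| <= 2 pi q
    give q N > 1, which turns the factor 2 into 2 q N. *)

Section GaussianMeasure.
Variable R : realType.
Local Notation leb_mu := (@lebesgue_measure R).
Local Notation pdf := (normal_pdf (0 : R) 1).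

Import HBNNSimple.

Lemma ge0_integral_normal_prob (f : measurableTypeR R -> \bar R) :
  measurable_fun setT f -> (forall x, (0 <= f x)%E) ->
  (\int[normal_prob (0 : R) 1]_x f x = \int[leb_mu]_x (f x * (pdf x)%:E))%E.
Proof.
move=> mf f0.
have mpdf : measurable_fun setT (fun x : measurableTypeR R => (pdf x)%:E).
  by apply/measurable_EFinP; exact: measurable_normal_pdf.
have pdf0 x : (0 <= (pdf x)%:E)%E by rewrite lee_fin normal_pdf_ge0.
pose f_ := nnsfun_approx measurableT mf.
have f_cvg x : (EFin \o f_^~ x) @ \oo --> f x by exact: cvg_nnsfun_approx.
have f_nd x m n : (m <= n)%N -> ((f_ m x)%:E <= (f_ n x)%:E)%E.
  by move=> mn; rewrite lee_fin; exact/lefP/nd_nnsfun_approx.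
transitivity (limn (fun n => \int[normal_prob (0 : R) 1]_x (f_ n x)%:E))%E.
  rewrite -monotone_convergence//=.
  - by apply: eq_integral => y _; apply/esym/cvg_lim => //; exact: f_cvg.
  - by move=> n; apply/measurable_EFinP; exact: (measurable_funPT (f_ n)).
  - by move=> n y _; rewrite lee_fin.
  - by move=> y _ m n mn; exact: f_nd.
transitivity (limn (fun n => \int[leb_mu]_x ((f_ n x)%:E * (pdf x)%:E)))%E; last first.
  rewrite -monotone_convergence//=.
  - apply: eq_integral => y _; apply/cvg_lim => //.
    by apply: cvgeZr => //; exact: f_cvg.
  - move=> n; apply: emeasurable_funM => //.
    by apply/measurable_EFinP; exact: (measurable_funPT (f_ n)).
  - by move=> n y _; rewrite mule_ge0// lee_fin.
  - by move=> y _ m n mn; rewrite lee_wpmul2r// f_nd.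
congr (limn _); apply/funext => n.
under [LHS]eq_integral do rewrite fimfunE -fsumEFin//.
rewrite [LHS]ge0_integral_fsum//; last 2 first.
  - by move=> r; exact/measurable_EFinP/measurableT_comp.
  - by move=> r x _; rewrite EFinM nnfun_muleindic_ge0.
under [RHS]eq_integral.
  move=> x _.
  rewrite fimfunE -fsumEFin// ge0_mule_fsuml; last first.
    by move=> r; rewrite EFinM nnfun_muleindic_ge0.
  over.
rewrite [RHS]ge0_integral_fsum//; last 2 first.
  - move=> r; apply: emeasurable_funM => //.
    by apply/measurable_EFinP; do 2 apply/measurableT_comp => //.
  - by move=> r x _; rewrite mule_ge0// EFinM nnfun_muleindic_ge0.
apply: eq_fsbigr => r rn.
have r0 : 0 <= r by move: rn; rewrite inE/= => -[x _ <-].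
under [LHS]eq_integral do rewrite EFinM.
under [RHS]eq_integral do rewrite EFinM -muleA.
rewrite ge0_integralZl//; last exact/measurable_EFinP/measurable_indic.
rewrite ge0_integralZl//; last 2 first.
  - by apply: emeasurable_funM => //; exact/measurable_EFinP/measurable_indic.
  - by move=> x _; rewrite mule_ge0// lee_fin.
congr (_ * _)%E.
rewrite integral_indic// setIT /normal_prob [LHS]integral_mkcond.
apply: eq_integral => x _; rewrite patchE indicE.
by case: ifPn => _; rewrite ?mul1e ?mul0e.
Qed.

(** By uniqueness of Lebesgue measure, half-open intervals suffice. For s < 0 the preimage is closed
    at the other end, which leaves its length unchanged. *)
Lemma lebesgue_measure_scale (s : R) (A : set (measurableTypeR R)) : s != 0 ->
  measurable A ->
  leb_mu A = (`|s|%:E * leb_mu [set z | A (s * z)%R])%E.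
Proof.
move=> s0 mA.
have ms : measurable_fun setT (fun z : measurableTypeR R => s * z : measurableTypeR R).
  exact: mulrl_measurable.
have s_ge0 : 0 <= `|s| by [].
pose m : {measure set _ -> \bar R} := mscale (NngNum s_ge0)
  (pushforward leb_mu (fun z : measurableTypeR R => s * z : measurableTypeR R)).
have -> : (`|s|%:E * leb_mu [set z | A (s * z)%R])%E = m ms A by [].
apply: lebesgue_measure_unique => // X /ocitvP[->|[[a b] /= ab ->]].
  by rewrite !measure0.
rewrite /m /mscale /= /pushforward /=.
have [s_gt0|s_lt0|/eqP] := ltrgt0P s; last by rewrite (negbTE s0).
- rewrite (_ : _ @^-1` _ = `]a / s, b / s]%classic); last first.
    apply/seteqP; split=> z /=; rewrite !in_itv/= ltr_pdivrMr// ler_pdivlMr//;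
    by rewrite (mulrC z).
  rewrite !lebesgue_measure_itv/= !lte_fin ab ltr_pM2r ?invr_gt0// ab.
  by rewrite -!EFinD -EFinM; congr EFin; field.
- rewrite (_ : _ @^-1` _ = `[b / s, a / s[%classic); last first.
    apply/seteqP; split=> z /=; rewrite !in_itv/= ltr_ndivlMr// ler_ndivrMr//;
    by rewrite (mulrC z) andbC.
  rewrite !lebesgue_measure_itv/= !lte_fin ab ltr_nM2r ?invr_lt0// ab.
  by rewrite -!EFinD -EFinM; congr EFin; field.
Qed.

(** Negative [s] is allowed on purpose: s = -1 yields the reflection symmetry of the Gaussian
    measure. *)
Lemma normal_prob_scale (s : R) (A : set (measurableTypeR R)) : s != 0 ->
  measurable A -> normal_prob 0 s A = normal_prob 0 1 [set z | A (s * z)].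
Proof.
move=> s0 mA.
have ms : measurable_fun setT (fun z : measurableTypeR R => s * z : measurableTypeR R).
  exact: mulrl_measurable.
have s_ge0 : 0 <= `|s| by [].
pose m : {measure set _ -> \bar R} := mscale (NngNum s_ge0)
  (pushforward leb_mu (fun z : measurableTypeR R => s * z : measurableTypeR R)).
have mpdf t : measurable_fun setT (fun x : measurableTypeR R => (normal_pdf (0 : R) t x)%:E).
  by apply/measurable_EFinP; exact: measurable_normal_pdf.
have pdf0 t x : (0 <= (normal_pdf (0 : R) t x)%:E)%E by rewrite lee_fin normal_pdf_ge0.
rewrite /normal_prob.
transitivity (\int[m ms]_(x in A) (normal_pdf 0 s x)%:E)%E.
  apply: eq_measure_integral => X mX _; exact: lebesgue_measure_scale.
rewrite ge0_integral_mscale//=; last exact: measurable_funTS.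
rewrite ge0_integral_pushforward//=; last exact: measurable_funTS.
rewrite -ge0_integralZl//=; last 2 first.
  - by rewrite -[X in measurable X]setTI; exact: ms.
  - by apply: measurable_funTS; apply: (measurableT_comp (mpdf s)).
apply: eq_integral => z _; rewrite -EFinM; congr EFin.
rewrite !normal_pdfE ?oner_neq0// /normal_peak /normal_fun !subr0.
rewrite expr1n exprMn mul1r mulrA; congr (_ * expR _).
  rewrite -mulrnAr sqrtrM ?sqr_ge0// sqrtr_sqr.
  have p0 : Num.sqrt (pi *+ 2) != 0 :> R.
    by rewrite gt_eqF// sqrtr_gt0 mulrn_wgt0// pi_gt0.
  by field; rewrite p0 normr_eq0 s0.
by field.
Qed.

(** Integration by parts over the whole line: on symmetric intervals the integral is a difference of
    boundary values of [H], which decay like 1/|x|, and dominated convergence does the rest. It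
    serves both the second moment and the characteristic function. *)
Lemma integral_derive_eq0 (H h : R -> R) (C : R) :
  (forall x : R, is_derive x 1 H (h x)) -> continuous h ->
  leb_mu.-integrable setT (EFin \o h) ->
  (forall x, 1 <= `|x| -> `|H x| <= C / `|x|) ->
  \int[leb_mu]_x h x = 0.
Proof.
move=> dH ch ih bH.
pose I n : set R := `[- n.+1%:R, n.+1%:R]%classic.
have FTC n : \int[leb_mu]_(x in I n) h x = H n.+1%:R - H (- n.+1%:R).
  rewrite /Rintegral (@continuous_FTC2 _ h H)//.
  - by rewrite (@lt_trans _ _ 0)// oppr_lt0 ltr0n.
  - exact: continuous_subspaceT.
  - have cH : continuous H.
      by move=> x; apply/differentiable_continuous/derivable1_diffP; exact: (@ex_derive _ _ _ _ _ _ _ (dH x)).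
    split.
    + by move=> x _; exact: (@ex_derive _ _ _ _ _ _ _ (dH x)).
    + by apply: cvg_at_right_filter; exact: cH.
    + by apply: cvg_at_left_filter; exact: cH.
  - by move=> x _; rewrite derive1E; exact: (@derive_val _ _ _ _ _ _ _ (dH x)).
have mh : measurable_fun setT h by exact: continuous_measurable_fun.
have mI n : measurable_fun setT (fun x : measurableTypeR R => ((h \_ (I n)) x)%:E).
  apply/measurable_EFinP; apply/(measurable_restrictT _ _).1 => //.
    exact: measurable_itv.
  exact: measurable_funTS.
have mhE : measurable_fun setT (EFin \o h : measurableTypeR R -> \bar R).
  exact/measurable_EFinP.
have cvgI x : ((h \_ (I n)) x)%:E @[n --> \oo] --> (h x)%:E.
  apply: cvg_near_cst; near=> n; congr EFin; rewrite patchE ifT// inE /I /= in_itv /=.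
  rewrite -ler_norml; apply: ltW; apply: lt_trans (truncnS_gt _) _.
  by rewrite ltr_nat ltnS; near: n; exact: nbhs_infty_gt.
have domI x n : (`|((h \_ (I n)) x)%:E| <= (`|h x|)%:E)%E.
  by rewrite lee_fin patchE; case: ifP => // _; rewrite normr0.
have cvgA : {ae leb_mu, forall x, setT x ->
    (fun n => ((h \_ (I n)) x)%:E) @ \oo --> (EFin \o h) x}.
  by apply: aeW => x _; exact: cvgI.
have domA : {ae leb_mu, forall x n, setT x ->
    (`|((h \_ (I n)) x)%:E| <= (`|h x|)%:E)%E}.
  by apply: aeW => x n _; exact: domI.
have [_ _ dct] := @dominated_convergence _ _ _ leb_mu setT measurableT
  (fun n x => ((h \_ (I n)) x)%:E) (EFin \o h) (fun x => (`|h x|)%:E)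
  mI mhE cvgA (integrable_norm ih) domA.
have lim0 : (fun n => \int[leb_mu]_(x in I n) h x) @ \oo --> (0 : R).
  apply/norm_cvg0P.
  apply: (@squeeze_cvgr _ _ _ _ (cst 0) (fun n => (2 * C) * n.+1%:R^-1)).
  - near=> n; rewrite normr_ge0/= FTC (le_trans (ler_normB _ _))//.
    have n1 : 1 <= `|n.+1%:R : R| by rewrite normr_nat ler1n.
    have := bH _ n1; have := bH (- n.+1%:R); rewrite normrN => /(_ n1).
    rewrite normr_nat => b1 b2.
    have -> : 2 * C * n.+1%:R^-1 = C / n.+1%:R + C / n.+1%:R by ring.
    exact: lerD.
  - exact: cvg_cst.
  - rewrite -[X in _ --> X](mulr0 (2 * C)); apply: cvgMr => //.
    by apply: cvg_harmonic.
have e : (fun n => (\int[leb_mu]_(x in I n) h x)%:E) =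
   (fun n => \int[leb_mu]_x ((h \_ (I n)) x)%:E)%E.
  apply/funext => n; rewrite /Rintegral fineK.
    by rewrite [LHS]integral_mkcond; apply: eq_integral => x _; rewrite !patchE; case: ifP.
  have mIn : measurable (I n : set (measurableTypeR R)) by exact: measurable_itv.
  by apply: integrable_fin_num => //; exact: (integrableS measurableT mIn (@subsetT _ _) ih).
apply: (@EFin_inj R); rewrite /Rintegral fineK; last exact: integrable_fin_num.
rewrite -[LHS](cvg_lim (@ereal_hausdorff R) dct) /= -e.
apply/cvg_lim; first exact: ereal_hausdorff.
by apply: cvg_EFin => //; exact: nearW.
Unshelve. all: by end_near. Qed.

Local Notation peak := (normal_peak (1 : R)).

Lemma std_normal_pdfE x : pdf x = peak * expR (- (x ^+ 2) / 2).
Proof.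
rewrite normal_pdfE ?oner_neq0// /normal_fun subr0 expr1n.
by congr (_ * expR (_ / _)).
Qed.

Lemma is_derive_std_normal_pdf (x : R) : is_derive x 1 pdf (- x * pdf x).
Proof.
rewrite (_ : pdf = (fun x => peak * expR (- (x ^+ 2) / 2))); last first.
  by apply/funext => y; rewrite std_normal_pdfE.
apply: is_derive_eq.
by rewrite /GRing.scale /=; field.
Qed.

Lemma continuous_std_normal_pdf : continuous pdf.
Proof. by apply: continuous_normal_pdf; exact: oner_neq0. Qed.

(** Half of the exponent absorbs x^2, since y <= e^y. What is left is a multiple of the density of
    variance 2, hence an integrable majorant for integrands of quadratic growth. *)
Lemma sqr_std_normal_pdf_le (x : R) : x ^+ 2 * pdf x <= 4 * peak * expR (- (x ^+ 2) / 4).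
Proof.
rewrite std_normal_pdfE.
have -> : - x ^+ 2 / 2 = - (x ^+ 2) / 4 + - (x ^+ 2 / 4) by field.
rewrite expRD expRN.
have h : x ^+ 2 / 4 <= expR (x ^+ 2 / 4).
  by apply: le_trans (expR_ge1Dx _); rewrite lerDr.
have e0 := expR_gt0 (x ^+ 2 / 4).
have : x ^+ 2 / expR (x ^+ 2 / 4) <= 4 by rewrite ler_pdivrMr//; lra.
have := expR_gt0 (- x ^+ 2 / 4); set a := expR (- x ^+ 2 / 4) => a0.
have := normal_peak_gt0 (oner_neq0 R) => p0 hh.
have -> : x ^+ 2 * (peak * (a / expR (x ^+ 2 / 4))) =
  peak * a * (x ^+ 2 / expR (x ^+ 2 / 4)) by ring.
rewrite (_ : 4 * peak * a = peak * a * 4); last by ring.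
by rewrite ler_pM2l// mulr_gt0.
Qed.

Lemma integrable_std_normal_pdfM (f : R -> R) : continuous f ->
  (forall x, `|f x| <= 1 + x ^+ 2) ->
  leb_mu.-integrable setT (fun x => (f x * pdf x)%:E).
Proof.
move=> cf bf.
pose C := 4 * peak / normal_peak (Num.sqrt (2 : R)).
have s2 : Num.sqrt (2 : R) != 0 by rewrite gt_eqF// sqrtr_gt0.
apply: (@le_integrable _ _ _ _ _ measurableT _
  (fun x : measurableTypeR R => (pdf x)%:E + C%:E * (normal_pdf (0 : R) (Num.sqrt 2) x)%:E)%E).
- apply/measurable_EFinP; apply: measurable_funM.
    exact: continuous_measurable_fun.
  exact: measurable_normal_pdf.
- move=> x _ /=; rewrite lee_fin normrM (ger0_norm (normal_pdf_ge0 _ _ _)).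
  have C0 : 0 <= C by rewrite divr_ge0 ?normal_peak_ge0// mulr_ge0 ?normal_peak_ge0.
  rewrite [leRHS]ger0_norm; last first.
    by apply: addr_ge0; [|apply: mulr_ge0 => //]; exact: normal_pdf_ge0.
  apply: (@le_trans _ _ ((1 + x ^+ 2) * pdf x)).
    by rewrite ler_wpM2r ?normal_pdf_ge0.
  rewrite mulrDl mul1r lerD2l (le_trans (sqr_std_normal_pdf_le x))//.
  rewrite normal_pdfE// /normal_fun subr0 sqr_sqrtr// /C.
  rewrite mulrA divfK ?gt_eqF ?normal_peak_gt0//.
  by rewrite (_ : 2 *+ 2 = 4 :> R)//; ring.
- apply: integrableD => //; first exact: integrable_normal_pdf.
  by apply: integrableZl => //; exact: integrable_normal_pdf.
Qed.

Lemma std_normal_pdf_decay (f : R -> R) x : (forall y, 1 <= `|y| -> `|f y| <= `|y|) ->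
  1 <= `|x| -> `|f x * pdf x| <= 4 * peak / `|x|.
Proof.
move=> bf x1; have x0 : 0 < `|x| by lra.
rewrite ler_pdivlMr// normrM (ger0_norm (normal_pdf_ge0 _ _ _)).
have := sqr_std_normal_pdf_le x.
have e1 : expR (- x ^+ 2 / 4) <= 1.
  by rewrite -expR0 ler_expR mulNr oppr_le0 divr_ge0// sqr_ge0.
have p0 := normal_peak_gt0 (oner_neq0 R) => h.
apply: (@le_trans _ _ (4 * peak * expR (- x ^+ 2 / 4))); last by nra.
apply: le_trans h; rewrite mulrAC ler_wpM2r ?normal_pdf_ge0//.
by rewrite -(real_normK (num_real x)) expr2 ler_wpM2r// bf.
Qed.

Lemma std_normal_second_moment :
  (\int[normal_prob (0 : R) 1]_x (x ^+ 2)%:E = 1)%E.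
Proof.
rewrite ge0_integral_normal_prob; last 2 first.
- by apply/measurable_EFinP; exact: measurable_funX.
- by move=> x; rewrite lee_fin sqr_ge0.
pose h x := - 1 * pdf x + - x * (- x * pdf x).
have h0 : \int[leb_mu]_x h x = 0.
  apply: (@integral_derive_eq0 (fun x => - x * pdf x) h (4 * peak)).
  - move=> x; have := is_derive_std_normal_pdf x => ?.
    by apply: is_derive_eq; rewrite /h /GRing.scale /=; ring.
  - move=> x; apply: cvgD; apply: cvgM.
    + exact: cvg_cst.
    + exact: continuous_std_normal_pdf.
    + by apply: cvgN; exact: cvg_id.
    + apply: cvgM; last exact: continuous_std_normal_pdf.
      by apply: cvgN; exact: cvg_id.
  - rewrite (_ : EFin \o h = (fun x => ((x ^+ 2 - 1) * pdf x)%:E)); last first.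
      by apply/funext => x /=; congr EFin; rewrite /h; ring.
    apply: integrable_std_normal_pdfM.
    + move=> x; apply: cvgB; last exact: cvg_cst.
      exact: exprn_continuous.
    + by move=> x; rewrite (le_trans (ler_normB _ _))// normr1 ger0_norm ?sqr_ge0// addrC.
  - move=> x; apply: (@std_normal_pdf_decay (fun x => - x)) => y _.
    by rewrite normrN.
have i2 : leb_mu.-integrable setT (fun x : R => (x ^+ 2 * pdf x)%:E).
  apply: integrable_std_normal_pdfM; first exact: exprn_continuous.
  by move=> x; rewrite ger0_norm ?sqr_ge0// lerDr.
have e : \int[leb_mu]_x (x ^+ 2 * pdf x - pdf x) = 0.
  by rewrite -[RHS]h0; apply: eq_Rintegral => x _; rewrite /h; ring.
rewrite RintegralB// in e; last exact: integrable_normal_pdf.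
have : \int[leb_mu]_x (x ^+ 2 * pdf x) = 1.
  move/eqP: e; rewrite subr_eq0 => /eqP ->.
  by rewrite /Rintegral integral_normal_pdf.
move=> e1; transitivity (\int[leb_mu]_x (x ^+ 2 * pdf x)%:E)%E.
  by apply: eq_integral => x _; rewrite EFinM.
rewrite -[LHS]fineK; last exact: integrable_fin_num.
by rewrite -[fine _]/(\int[leb_mu]_x (x ^+ 2 * pdf x)) e1.
Qed.

Lemma integrable_cos_pdf (u th : R) :
  leb_mu.-integrable setT (fun x => (cos (u * x + th) * pdf x)%:E).
Proof.
apply: integrable_std_normal_pdfM.
  move=> x; apply: continuous_comp; last exact: continuous_cos.
  by apply: cvgD; [apply: cvgM; [exact: cvg_cst|exact: cvg_id]|exact: cvg_cst].
move=> x; have := sqr_ge0 x.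
have : `|cos (u * x + th)| <= 1 by rewrite ler_norml cos_le1 cos_geN1.
by lra.
Qed.

(** As a function of the frequency v, the integral satisfies chi' = - v chi: differentiate under the
    integral sign, then integrate by parts. Hence chi(v) exp(v^2 / 2) is constant. The phase [th]
    treats cosines and sines at once. *)
Lemma Rintegral_cos_std_normal_pdf (u th : R) :
  \int[leb_mu]_x (cos (u * x + th) * pdf x) = cos th * expR (- (u ^+ 2) / 2).
Proof.
have linc (v : R) : continuous (fun x : R => v * x + th).
  by move=> x; apply: cvgD; [apply: cvgM; [exact: cvg_cst|exact: cvg_id]|exact: cvg_cst].
pose chi v := \int[leb_mu]_x (cos (v * x + th) * pdf x).
have is_sin v : leb_mu.-integrable setT (fun x : R => (x * sin (v * x + th) * pdf x)%:E).
  apply: integrable_std_normal_pdfM.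
    move=> x; apply: cvgM; first exact: cvg_id.
    by apply: continuous_comp; [exact: linc|exact: continuous_sin].
  move=> x; rewrite normrM.
  have : `|sin (v * x + th)| <= 1 by rewrite ler_norml sin_le1 sin_geN1.
  have := normr_ge0 x; have := real_normK (num_real x).
  set y := `|x|; set t := `|_|; move=> <- y0 t1.
  apply: (@le_trans _ _ y); last by nra.
  by rewrite ler_piMr.
have ibp v : \int[leb_mu]_x (x * sin (v * x + th) * pdf x) = v * chi v.
  pose h x := sin (v * x + th) * (- x * pdf x) + v * (cos (v * x + th) * pdf x).
  have h0 : \int[leb_mu]_x h x = 0.
    apply: (@integral_derive_eq0 (fun x => sin (v * x + th) * pdf x) h (4 * peak)).
    - move=> x; have := is_derive_std_normal_pdf x => ?.
      by apply: is_derive_eq; rewrite /h /GRing.scale /=; ring.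
    - have cs : continuous (fun x => sin (v * x + th)).
        by move=> x; apply: continuous_comp; [exact: linc|exact: continuous_sin].
      have cc : continuous (fun x => cos (v * x + th)).
        by move=> x; apply: continuous_comp; [exact: linc|exact: continuous_cos].
      move=> x; apply: cvgD; apply: cvgM.
      + exact: cs.
      + apply: cvgM; last exact: continuous_std_normal_pdf.
        by apply: cvgN; exact: cvg_id.
      + exact: cvg_cst.
      + by apply: cvgM; [exact: cc|exact: continuous_std_normal_pdf].
    - rewrite (_ : EFin \o h = (fun x => (v%:E * (cos (v * x + th) * pdf x)%:E -
          (x * sin (v * x + th) * pdf x)%:E)%E)); last first.
        by apply/funext => x /=; rewrite -EFinM -EFinB; congr EFin; rewrite /h; ring.
      apply: integrableB => //.
      by apply: integrableZl => //; exact: integrable_cos_pdf.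
    - move=> x; apply: (@std_normal_pdf_decay (fun x => sin (v * x + th))) => y y1.
      by apply: le_trans y1; rewrite ler_norml sin_le1 sin_geN1.
  have e : \int[leb_mu]_x (v * (cos (v * x + th) * pdf x) - x * sin (v * x + th) * pdf x) = 0.
    by rewrite -[RHS]h0; apply: eq_Rintegral => x _; rewrite /h; ring.
  have iZ : leb_mu.-integrable setT (EFin \o (fun x => v * (cos (v * x + th) * pdf x))).
    rewrite (_ : EFin \o _ = (fun x : measurableTypeR R =>
      v%:E * (cos (v * x + th) * pdf x)%:E)%E); last by apply/funext.
    by apply: integrableZl => //; exact: integrable_cos_pdf.
  have is_v := is_sin v.
  rewrite RintegralB// in e.
  rewrite RintegralZl// in e; last exact: integrable_cos_pdf.
  by move/eqP: e; rewrite subr_eq0 => /eqP <-.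
have pd v x : (partial1of2 (fun v x => cos (v * x + th) * pdf x)) v x =
    - (x * sin (v * x + th) * pdf x).
  rewrite partial1of2E.
  have : is_derive v (1 : R) (fun v => cos (v * x + th) * pdf x) (- (x * sin (v * x + th) * pdf x)).
    by apply: is_derive_eq; rewrite /GRing.scale /=; ring.
  by move=> H; exact: derive_val.
have dchi (v : R) : is_derive v 1 chi (- v * chi v).
  have nI : `](v - 1), (v + 1)[%classic v by rewrite /= in_itv/=; apply/andP; split; lra.
  have H := @derivable_under_integral R _ _ leb_mu (fun v x => cos (v * x + th) * pdf x)
    setT measurableT v (v - 1) (v + 1) nI.
  have H2 := @differentiation_under_integral R _ _ leb_mu (fun v x => cos (v * x + th) * pdf x)
    setT measurableT v (v - 1) (v + 1) nI.
  have h1 (x : R) : `](v - 1), (v + 1)[%classic x ->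
      leb_mu.-integrable setT (EFin \o (fun y => cos (x * y + th) * pdf y)).
    by move=> _; exact: integrable_cos_pdf.
  have h2 (x y : R) : `](v - 1), (v + 1)[%classic x -> setT y ->
      derivable (fun x0 : R => cos (x0 * y + th) * pdf y) x 1.
    by move=> _ _; apply: ex_derive.
  have h3 : leb_mu.-integrable setT (EFin \o (fun y => `|y| * pdf y)).
    apply: integrable_std_normal_pdfM; first exact: norm_continuous.
    move=> x; rewrite normr_id; have := real_normK (num_real x).
    by set y := `|x|; move=> <-; nra.
  have h4 (x y : R) : `](v - 1), (v + 1)[%classic x -> setT y ->
      `|partial1of2 (fun v x => cos (v * x + th) * pdf x) x y| <= `|y| * pdf y.
    move=> _ _; rewrite pd normrN !normrM (ger0_norm (normal_pdf_ge0 _ _ _)).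
    rewrite ler_wpM2r ?normal_pdf_ge0// ler_piMr//.
    by rewrite ler_norml sin_le1 sin_geN1.
  have h5 (y : R) : 0 <= `|y| * pdf y by rewrite mulr_ge0 ?normal_pdf_ge0.
  apply: DeriveDef; first exact: (H h1 h2 (fun y => `|y| * pdf y) h5 h3 h4).
  rewrite -derive1E (H2 h1 h2 (fun y => `|y| * pdf y) h5 h3 h4).
  rewrite mulNr -ibp -mulN1r -RintegralZl//; last exact: is_sin.
  by apply: eq_Rintegral => x _; rewrite pd mulN1r.
have dE (v : R) : is_derive v 1 (fun v => chi v * expR (v ^+ 2 / 2)) 0.
  have := dchi v => ?.
  by apply: is_derive_eq; rewrite /GRing.scale /=; field.
have := is_derive_0_is_cst u 0 dE.
rewrite /= expr0n/= mul0r expR0 mulr1 => E.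
have chi0 : chi 0 = cos th.
  rewrite /chi; under eq_Rintegral do rewrite mul0r add0r.
  rewrite RintegralZl//; last exact: integrable_normal_pdf.
  by rewrite /Rintegral integral_normal_pdf mulr1.
rewrite -chi0 -E -mulrA -expRD -/(chi u).
by rewrite mulNr subrr expR0 mulr1.
Qed.

End GaussianMeasure.

Section GaussianLaw.
Variable R : realType.
Local Notation gamma := (normal_prob (0 : R) 1).

Lemma bounded_integrable d (T : measurableType d) (mu : probability T R)
    (f : T -> R) (M : R) :
  measurable_fun setT f -> (forall x, `|f x| <= M) ->
  mu.-integrable setT (EFin \o f).
Proof.
move=> mf bf; apply: measurable_bounded_integrable => //.
  by rewrite -ge0_fin_numE// fin_num_measure.
exists M; split; first exact: num_real.
by move=> y My x _ /=; apply: le_trans (bf x) (ltW My).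
Qed.

(** Adding 1 makes a cosine nonnegative, so that identities proved for nonnegative integrands
    transfer to it. *)
Lemma Rintegral_1D d (T : measurableType d) (mu : probability T R) (f : T -> R) :
  mu.-integrable setT (EFin \o f) -> \int[mu]_x (1 + f x) = 1 + \int[mu]_x f x.
Proof.
move=> fi; rewrite RintegralD//; last exact: finite_measure_integrable_cst.
rewrite Rintegral_cst//; congr (_ + _).
by rewrite mul1r; apply: (@EFin_inj R); rewrite fineK ?fin_num_measure//; exact: probability_setT.
Qed.

Lemma measurable_cos_lin d (T : measurableType d) (f : T -> R) (th : R) :
  measurable_fun setT f -> measurable_fun setT (fun x => cos (f x + th)).
Proof.
move=> mf; apply: measurableT_comp; last exact: measurable_funD.
exact: (continuous_measurable_fun (@continuous_cos R)).
Qed.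

Lemma cos_normr_le1 (x : R) : `|cos x| <= 1.
Proof. by rewrite ler_norml cos_le1 cos_geN1. Qed.

Lemma Rintegral_cos_std_normal (u th : R) :
  \int[gamma]_x cos (u * x + th) = cos th * expR (- (u ^+ 2) / 2).
Proof.
have mc : measurable_fun setT (fun x : measurableTypeR R => cos (u * x + th)).
  by apply: measurable_cos_lin; exact: mulrl_measurable.
have ic : gamma.-integrable setT (EFin \o (fun x => cos (u * x + th))).
  by apply: (@bounded_integrable _ _ _ _ 1) => // x; exact: cos_normr_le1.
have e : (\int[gamma]_x (1 + cos (u * x + th))%:E =
    \int[@lebesgue_measure R]_x ((1 + cos (u * x + th)) * normal_pdf 0 1 x)%:E)%E.
  rewrite ge0_integral_normal_prob.
  - by apply: eq_integral => x _; rewrite EFinM.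
  - by apply/measurable_EFinP; exact: measurable_funD.
  - by move=> x; rewrite lee_fin; have := cos_geN1 (u * x + th); lra.
have e1 : \int[gamma]_x (1 + cos (u * x + th)) = 1 + \int[gamma]_x cos (u * x + th).
  by rewrite Rintegral_1D.
have e2 : \int[@lebesgue_measure R]_x ((1 + cos (u * x + th)) * normal_pdf 0 1 x) =
   1 + \int[@lebesgue_measure R]_x (cos (u * x + th) * normal_pdf 0 1 x).
  under eq_Rintegral do rewrite mulrDl mul1r.
  rewrite RintegralD//; [|exact: integrable_normal_pdf|exact: integrable_cos_pdf].
  by congr (_ + _); rewrite /Rintegral integral_normal_pdf.
apply: (@addrI _ 1); rewrite -e1 -Rintegral_cos_std_normal_pdf -e2.
by rewrite /Rintegral e.
Qed.

(** As an image of the standard law under scaling, the degenerate case s = 0 has the same form as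
    the others; all later statements about laws use this form. *)
Lemma centered_gaussian_lawE (s : R) (A : set (measurableTypeR R)) : measurable A ->
  centered_gaussian_law s A = gamma [set z | A (s * z)].
Proof.
move=> mA; rewrite /centered_gaussian_law; case: eqVneq => [->|s0]; last exact: normal_prob_scale.
have [A0|A0] := pselect (A 0).
  rewrite diracE mem_set// (_ : [set z | _] = setT) ?probability_setT//.
  by apply/seteqP; split=> z //= _; rewrite mul0r.
rewrite diracE memNset// (_ : [set z | _] = set0) ?measure0//.
by apply/seteqP; split=> z //=; rewrite mul0r.
Qed.

Section Transfer.
Variables (d : measure_display) (Om : measurableType d) (P : probability Om R).
Variables (X : Om -> R) (s : R).
Hypothesis mX : measurable_fun setT (X : Om -> measurableTypeR R).
Hypothesis lawX : forall A : set (measurableTypeR R), measurable A ->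
  P (X @^-1` A) = gamma [set z | A (s * z)].

Lemma ge0_integral_gaussian (h : measurableTypeR R -> \bar R) :
  measurable_fun setT h -> (forall x, (0 <= h x)%E) ->
  (\int[P]_w h (X w) = \int[gamma]_z h (s * z)%R)%E.
Proof.
move=> mh h0.
have ms : measurable_fun setT (fun z : measurableTypeR R => s * z : measurableTypeR R).
  exact: mulrl_measurable.
pose m1 : {measure set _ -> \bar R} := pushforward P (X : Om -> measurableTypeR R).
pose m2 : {measure set _ -> \bar R} := pushforward gamma (fun z : measurableTypeR R => s * z : measurableTypeR R).
transitivity (\int[m1 mX]_y h y)%E.
  by rewrite ge0_integral_pushforward.
transitivity (\int[m2 ms]_y h y)%E; last by rewrite ge0_integral_pushforward.
by apply: eq_measure_integral => A mA _; exact: lawX.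
Qed.

Lemma gaussian_second_moment : (\int[P]_w (X w ^+ 2)%:E = (s ^+ 2)%:E)%E.
Proof.
rewrite (@ge0_integral_gaussian (fun x => (x ^+ 2)%:E)); last 2 first.
- by apply/measurable_EFinP; exact: measurable_funX.
- by move=> x; rewrite lee_fin sqr_ge0.
under eq_integral do rewrite exprMn EFinM.
rewrite ge0_integralZl//.
- by rewrite std_normal_second_moment mule1.
- by apply/measurable_EFinP; exact: measurable_funX.
- by move=> x _; rewrite lee_fin sqr_ge0.
- by rewrite lee_fin sqr_ge0.
Qed.

Lemma gaussian_cos (th : R) : \int[P]_w cos (X w + th) = cos th * expR (- (s ^+ 2) / 2).
Proof.
rewrite -Rintegral_cos_std_normal.
have ic : P.-integrable setT (EFin \o (fun w => cos (X w + th))).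
  apply: (@bounded_integrable _ _ _ _ 1); first exact: measurable_cos_lin.
  by move=> x; exact: cos_normr_le1.
have ic2 : gamma.-integrable setT (EFin \o (fun z => cos (s * z + th))).
  apply: (@bounded_integrable _ _ _ _ 1).
    by apply: measurable_cos_lin; exact: mulrl_measurable.
  by move=> x; exact: cos_normr_le1.
apply: (@addrI _ 1).
have -> : 1 + \int[P]_w cos (X w + th) = \int[P]_w (1 + cos (X w + th)).
  by rewrite Rintegral_1D.
have -> : 1 + \int[gamma]_z cos (s * z + th) = \int[gamma]_z (1 + cos (s * z + th)).
  by rewrite Rintegral_1D.
rewrite /Rintegral (@ge0_integral_gaussian (fun x => (1 + cos (x + th))%:E))//.
  apply/measurable_EFinP; apply: measurable_funD => //.
  exact: measurable_cos_lin.
Qed.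

End Transfer.
End GaussianLaw.

(** * Gaussian decoupling by characteristic functions *)

Section TrigPoly.
Variable R : realType.

(** The phase in each term provides sines and constants, and closes the class under products by the
    product-to-sum formulas. *)
Definition trigpoly (T : R -> R) := exists s : seq (R * R * R),
  forall x, T x = \sum_(t <- s) t.1.1 * cos (t.1.2 * x + t.2).

Lemma trigpoly_cos (c w th : R) : trigpoly (fun x => c * cos (w * x + th)).
Proof. by exists [:: (c, w, th)] => x; rewrite big_seq1. Qed.

Lemma trigpolyD (T U : R -> R) : trigpoly T -> trigpoly U -> trigpoly (fun x => T x + U x).
Proof. by move=> [s Ts] [t Ut]; exists (s ++ t) => x; rewrite big_cat -Ts -Ut. Qed.

Lemma trigpoly_cst (c : R) : trigpoly (fun=> c).
Proof. by exists [:: (c, 0, 0)] => x; rewrite big_seq1 /= mul0r addr0 cos0 mulr1. Qed.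

Lemma trigpolyM (T U : R -> R) : trigpoly T -> trigpoly U -> trigpoly (fun x => T x * U x).
Proof.
move=> [s Ts] [t Ut].
exists (flatten [seq [:: (p.1.1 * q.1.1 / 2, p.1.2 + q.1.2, p.2 + q.2);
  (p.1.1 * q.1.1 / 2, p.1.2 - q.1.2, p.2 - q.2)] | p <- s, q <- t]) => x.
rewrite Ts Ut big_flatten big_allpairs_dep mulr_suml; apply: eq_bigr => p _.
rewrite mulr_sumr; apply: eq_bigr => q _.
rewrite big_cons big_seq1 /=.
have -> : (p.1.2 + q.1.2) * x + (p.2 + q.2) = (p.1.2 * x + p.2) + (q.1.2 * x + q.2) by ring.
have -> : (p.1.2 - q.1.2) * x + (p.2 - q.2) = (p.1.2 * x + p.2) - (q.1.2 * x + q.2) by ring.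
set a := p.1.2 * x + p.2; set b := q.1.2 * x + q.2.
by rewrite (cosD a b) (cosB a b); field.
Qed.

Lemma trigpolyX (T : R -> R) m : trigpoly T -> trigpoly (fun x => T x ^+ m).
Proof.
move=> tT; elim: m => [|m IH]; first exact: trigpoly_cst.
have [s E] := trigpolyM tT IH.
by exists s => x; rewrite exprS E.
Qed.

Lemma trigpoly_measurable (T : R -> R) : trigpoly T -> measurable_fun setT T.
Proof.
move=> [s E]; rewrite (_ : T = fun x => \sum_(t <- s) t.1.1 * cos (t.1.2 * x + t.2)).
  apply: measurable_sum => t; apply: measurable_funM => //.
  by apply: measurable_cos_lin; exact: mulrl_measurable.
by apply/funext => x; rewrite E.
Qed.

(* Bounded pointwise limits of trigonometric polynomials: the class of test
   functions to which Gaussian characteristic functions give direct access. *)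
Definition trig_limit (M : R) (F : R -> R) := exists T : nat -> R -> R,
  [/\ forall k, trigpoly (T k), forall k x, `|T k x| <= M &
      forall x, T ^~ x @ \oo --> F x].

Lemma trig_limit_le M F x : trig_limit M F -> `|F x| <= M.
Proof.
move=> [T [_ bT cT]].
have : (fun k => `|T k x|) @ \oo --> `|F x| by apply: cvg_norm; exact: cT.
by move=> /cvg_lim <- //; apply: limr_le; [apply/cvg_ex; exists `|F x|; apply: cvg_norm; exact: cT|exact: nearW].
Qed.

Lemma trig_limit_measurable M F : trig_limit M F -> measurable_fun setT F.
Proof.
move=> [T [pT _ cT]]; apply: (measurable_fun_cvg (h := T)) => //.
by move=> k; exact: trigpoly_measurable.
Qed.

End TrigPoly.

Section BoundedConvergence.
Variables (R : realType) (d : measure_display) (Om : measurableType d) (P : probability Om R).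

Lemma bounded_convergence (f : nat -> Om -> R) (g : Om -> R) (M : R) :
  (forall k, measurable_fun setT (f k)) -> measurable_fun setT g ->
  (forall k w, `|f k w| <= M) -> (forall w, f ^~ w @ \oo --> g w) ->
  (fun k => \int[P]_w f k w) @ \oo --> \int[P]_w g w.
Proof.
move=> mf mg bf cf.
have mfE k : measurable_fun setT (EFin \o f k) by exact/measurable_EFinP.
have mgE : measurable_fun setT (EFin \o g) by exact/measurable_EFinP.
have cA : {ae P, forall w, setT w -> (fun k => (EFin \o f k) w) @ \oo --> (EFin \o g) w}.
  by apply: aeW => w _; apply: cvg_EFin; [exact: nearW|exact: cf].
have dA : {ae P, forall w k, setT w -> (`|(EFin \o f k) w| <= (cst M%:E) w)%E}.
  by apply: aeW => w k _; rewrite /= lee_fin.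
have iM : P.-integrable setT (cst M%:E) by exact: finite_measure_integrable_cst.
have [ig _ dct] := @dominated_convergence _ _ _ P setT measurableT
  (fun k => EFin \o f k) (EFin \o g) (cst M%:E) mfE mgE cA iM dA.
apply: fine_cvg; rewrite -[X in _ --> X]/(EFin (fine _)) fineK//.
exact: integrable_fin_num.
Qed.

End BoundedConvergence.

Lemma Rintegral_sum_cos (R : realType) (s : seq (R * R * R)) (y rho : R) :
  \int[normal_prob (0 : R) 1]_z (\sum_(t <- s) t.1.1 * cos (t.1.2 * (y + rho * z) + t.2)) =
  \sum_(t <- s) t.1.1 * \int[normal_prob (0 : R) 1]_z cos (t.1.2 * (y + rho * z) + t.2).
Proof.
have mc (t : R * R * R) : measurable_fun setT (fun z : measurableTypeR R =>
    cos (t.1.2 * (y + rho * z) + t.2)).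
  apply: measurable_cos_lin; apply: measurable_funM => //.
  by apply: measurable_funD => //; exact: mulrl_measurable.
have ic (t : R * R * R) : (normal_prob (0 : R) 1).-integrable setT
    (EFin \o (fun z => cos (t.1.2 * (y + rho * z) + t.2))).
  by apply: (@bounded_integrable _ _ _ _ _ 1) => // z; exact: cos_normr_le1.
have ick (t : R * R * R) : (normal_prob (0 : R) 1).-integrable setT
    (EFin \o (fun z => t.1.1 * cos (t.1.2 * (y + rho * z) + t.2))).
  rewrite (_ : _ \o _ = (fun z : measurableTypeR R =>
    t.1.1%:E * (cos (t.1.2 * (y + rho * z) + t.2))%:E)%E)//.
  by apply: integrableZl => //; exact: ic.
elim: s => [|t s IH].
  under eq_Rintegral do rewrite big_nil.
  by rewrite big_nil Rintegral_cst// mul0r.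
under eq_Rintegral do rewrite big_cons.
rewrite RintegralD//=; last first.
  rewrite (_ : _ \o _ = (fun z : measurableTypeR R =>
    \sum_(t <- s) (t.1.1 * cos (t.1.2 * (y + rho * z) + t.2))%:E)%E).
    by apply: integrable_sum => // u _; exact: ick.
  by apply/funext => w /=; rewrite sumEFin.
by rewrite big_cons RintegralZl// IH.
Qed.

Lemma trig_limit_average (R : realType) (rho M : R) (T : nat -> R -> R) (F : R -> R) :
  (forall k, trigpoly (T k)) -> (forall k x, `|T k x| <= M) ->
  (forall x, T ^~ x @ \oo --> F x) ->
  let A f y := \int[normal_prob (0 : R) 1]_z f (y + rho * z) in
  [/\ forall k, measurable_fun setT (A (T k)), forall k y, `|A (T k) y| <= M &
    forall y, (fun k => A (T k) y) @ \oo --> A F y].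
Proof.
move=> pT bT cT A.
have lF : trig_limit M F by exists T.
have mF := trig_limit_measurable lF.
have mlin (y : R) (f : R -> R) : measurable_fun setT f ->
    measurable_fun setT (fun z : measurableTypeR R => f (y + rho * z)).
  move=> mf; apply: (measurableT_comp mf).
  by apply: measurable_funD => //; exact: mulrl_measurable.
have bI (f : R -> R) y : measurable_fun setT f -> (forall x, `|f x| <= M) ->
    `|\int[normal_prob (0 : R) 1]_z f (y + rho * z)| <= M.
  move=> mf bf.
  have fi : (normal_prob (0 : R) 1).-integrable setT (EFin \o (fun z => f (y + rho * z))).
    by apply: (@bounded_integrable _ _ _ _ _ M) => //; exact: mlin.
  apply: (le_trans (le_normr_Rintegral _ fi)) => //.
  rewrite -[leRHS](_ : \int[normal_prob (0 : R) 1]_z (cst M z) = M); last first.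
    rewrite Rintegral_cst//= probability_setT mulr1//.
  apply: le_Rintegral => //.
  - exact: (integrable_norm fi).
  - exact: finite_measure_integrable_cst.
have cI y : (fun k => \int[normal_prob (0 : R) 1]_z T k (y + rho * z)) @ \oo --> \int[normal_prob (0 : R) 1]_z F (y + rho * z).
  apply: (@bounded_convergence _ _ _ _ _ _ M) => //.
  - by move=> k; apply: mlin; exact: trigpoly_measurable.
  - exact: mlin.
split => //; last by move=> k y; apply: bI => //; exact: trigpoly_measurable.
move=> k; have [s E] := pT k.
(* Gaussian averaging multiplies each frequency by a constant. The average is thus again an explicit
   trigonometric sum in y, and measurable without any appeal to Fubini's theorem. *)
rewrite (_ : A _ = (fun y => \sum_(t <- s) t.1.1 *
   (cos (t.1.2 * y + t.2) * expR (- (t.1.2 * rho) ^+ 2 / 2)))); last first.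
  apply/funext => w; rewrite /A; under eq_Rintegral do rewrite E.
  rewrite Rintegral_sum_cos; apply: eq_bigr => t _.
  under eq_Rintegral do rewrite mulrDr mulrA (addrAC _ _ t.2) [_ + _ * _]addrC.
  by rewrite Rintegral_cos_std_normal.
apply: measurable_sum => t; apply: measurable_funM => //; apply: measurable_funM => //.
by apply: measurable_cos_lin; exact: mulrl_measurable.
Qed.

Lemma trig_limit_average_lim (R : realType) (rho M : R) (F : R -> R) : trig_limit M F ->
  let A y := \int[normal_prob (0 : R) 1]_z F (y + rho * z) in
  measurable_fun setT A /\ forall y, `|A y| <= M.
Proof.
move=> [T [pT bT cT]] A; have [mA bA cA] := trig_limit_average rho pT bT cT.
split.
  exact: (measurable_fun_cvg mA (fun y _ => cA y)).
move=> y; have : (fun k => `|\int[normal_prob (0 : R) 1]_z T k (y + rho * z)|) @ \oo --> `|A y|.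
  by apply: cvg_norm; exact: cA.
move=> h; rewrite -(cvg_lim _ h)//; apply: limr_le; last exact: nearW.
by apply/cvg_ex; exists `|A y|.
Qed.

Section GaussianProduct.
Variables (R : realType) (d : measure_display) (Om : measurableType d) (P : probability Om R).
Variables (n : nat) (X : nat -> Om -> R) (S : 'M[R]_n).
Local Notation gamma := (normal_prob (0 : R) 1).

Definition comb (a : 'rV[R]_n) (w : Om) := \sum_(j < n) a 0 j * X j w.
Definition cov (a b : 'rV[R]_n) : R := (a *m S *m b^T) 0 0.

Hypothesis mX : forall j, measurable_fun setT (X j).
Hypothesis S_sym : S^T = S.
Hypothesis cov_ge0 : forall a, 0 <= cov a a.
Hypothesis law_comb : forall a (A : set (measurableTypeR R)), measurable A ->
  P (comb a @^-1` A) = gamma [set z | A (Num.sqrt (cov a a) * z)].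

Lemma combD a b w : comb (a + b) w = comb a w + comb b w.
Proof. by rewrite /comb -big_split; apply: eq_bigr => j _; rewrite mxE mulrDl. Qed.

Lemma combZ c a w : comb (c *: a) w = c * comb a w.
Proof. by rewrite /comb mulr_sumr; apply: eq_bigr => j _; rewrite mxE mulrA. Qed.

Lemma combN a w : comb (- a) w = - comb a w.
Proof. by rewrite -scaleN1r combZ mulN1r. Qed.

Lemma measurable_comb a : measurable_fun setT (comb a).
Proof. by apply: measurable_sum => j; apply: measurable_funM. Qed.

Lemma covDl a b c : cov (a + b) c = cov a c + cov b c.
Proof. by rewrite /cov !mulmxDl mxE. Qed.

Lemma covC a b : cov a b = cov b a.
Proof.
rewrite /cov (_ : (a *m S *m b^T) 0 0 = ((a *m S *m b^T)^T) 0 0); last by rewrite [RHS]mxE.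
by rewrite !trmx_mul trmxK S_sym mulmxA.
Qed.

Lemma covDr a b c : cov a (b + c) = cov a b + cov a c.
Proof. by rewrite covC covDl !(covC _ a). Qed.

Lemma covZl x a b : cov (x *: a) b = x * cov a b.
Proof. by rewrite /cov -!scalemxAl mxE. Qed.

Lemma covZr x a b : cov a (x *: b) = x * cov a b.
Proof. by rewrite covC covZl covC. Qed.

Lemma comb_cos a th :
  \int[P]_w cos (comb a w + th) = cos th * expR (- cov a a / 2).
Proof.
rewrite (@gaussian_cos _ _ _ _ _ (Num.sqrt (cov a a))) ?sqr_sqrtr//.
  exact: measurable_comb.
exact: law_comb.
Qed.

Definition below (i : nat) (a : 'rV[R]_n) := forall j : 'I_n, (i <= j)%N -> a 0 j = 0.

Definition orth (i : nat) (r : 'rV[R]_n) :=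
  forall j : 'I_n, (j < i)%N -> cov r (delta_mx 0 j) = 0.

Lemma orth_cov i r a : orth i r -> below i a -> cov r a = 0.
Proof.
move=> ro ab; rewrite [a]row_sum_delta covC.
elim/big_ind: _ => [|x y hx hy|j _].
- by rewrite /cov !mul0mx mxE.
- by rewrite covDl hx hy addr0.
- rewrite covZl covC; have [ji|ij] := ltnP j i; first by rewrite ro// mulr0.
  by rewrite ab// mul0r.
Qed.

Lemma belowD i a b : below i a -> below i b -> below i (a + b).
Proof. by move=> ha hb j ij; rewrite mxE ha// hb// addr0. Qed.

Lemma belowZ i c a : below i a -> below i (c *: a).
Proof. by move=> ha j ij; rewrite mxE ha// mulr0. Qed.

Lemma belowN i a : below i a -> below i (- a).
Proof. by rewrite -scaleN1r; exact: belowZ. Qed.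

Lemma orthZ i c r : orth i r -> orth i (c *: r).
Proof. by move=> h j ji; rewrite covZl h// mulr0. Qed.

(* [G] behaves as if it were independent of every residual [comb r] orthogonal
   to the variables of index below [i]. *)
Definition decoupled (i : nat) (G : Om -> R) :=
  [/\ measurable_fun setT G, exists M : R, forall w, `|G w| <= M &
   forall a r th, below i a -> orth i r ->
    \int[P]_w (G w * cos (comb (a + r) w + th)) =
    expR (- cov r r / 2) * \int[P]_w (G w * cos (comb a w + th))].

(** The covariance of a + r splits because r is orthogonal to a, and the Gaussian characteristic
    function turns this sum into a product. *)
Lemma decoupled1 i : decoupled i (cst 1).
Proof.
split => //; first by exists 1 => w; rewrite normr1.
move=> a r th ab ro.
under eq_Rintegral do rewrite mul1r.
under [in RHS]eq_Rintegral do rewrite mul1r.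
rewrite !comb_cos covDl !covDr (covC a r) (orth_cov ro ab) !add0r addr0.
by rewrite mulrCA -expRD; congr (_ * expR _); field.
Qed.

Lemma mul_cos_integrable (G : Om -> R) a th : measurable_fun setT G ->
  (exists M : R, forall w, `|G w| <= M) ->
  P.-integrable setT (EFin \o (fun w => G w * cos (comb a w + th))).
Proof.
move=> mG [M bM]; apply: (@bounded_integrable _ _ _ _ _ M).
  by apply: measurable_funM => //; apply: measurable_cos_lin; exact: measurable_comb.
move=> w; rewrite normrM -[leRHS]mulr1 ler_pM//; exact: cos_normr_le1.
Qed.

(** Product-to-sum formulas turn the extra cosine into shifts of [a] by plus or minus [w0 *: b].
    These shifts stay below index [i], so the residual [r] is not affected. *)
Lemma decoupled_cos i G b w0 ps : decoupled i G -> below i b ->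
  decoupled i (fun w => G w * cos (w0 * comb b w + ps)).
Proof.
move=> [mG bG dG] bb; split.
- apply: measurable_funM => //; apply: measurable_cos_lin.
  by apply: measurable_funM => //; exact: measurable_comb.
- have [M bM] := bG; exists M => w.
  by rewrite normrM -[leRHS]mulr1 ler_pM//; exact: cos_normr_le1.
move=> a r th ab ro.
have split_cos c : \int[P]_w (G w * cos (w0 * comb b w + ps) * cos (comb c w + th)) =
   2^-1 * \int[P]_w (G w * cos (comb (w0 *: b + c) w + (ps + th))) +
   2^-1 * \int[P]_w (G w * cos (comb (- (w0 *: b) + c) w + (th - ps))).
  rewrite -!RintegralZl//; try exact: mul_cos_integrable.
  rewrite -RintegralD//; last 2 first.
  - rewrite (_ : _ \o _ = (fun w => (2^-1)%:E * (G w * cos (comb (w0 *: b + c) w + (ps + th)))%:E)%E)//.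
    by apply: integrableZl => //; exact: mul_cos_integrable.
  - rewrite (_ : _ \o _ = (fun w => (2^-1)%:E * (G w * cos (comb (- (w0 *: b) + c) w + (th - ps)))%:E)%E)//.
    by apply: integrableZl => //; exact: mul_cos_integrable.
  apply: eq_Rintegral => w _; rewrite !combD combN combZ.
  set u := comb c w + th; set v := w0 * comb b w + ps.
  have -> : w0 * comb b w + comb c w + (ps + th) = v + u by rewrite /u /v; ring.
  have -> : - (w0 * comb b w) + comb c w + (th - ps) = u - v by rewrite /u /v; ring.
  by rewrite (cosD v u) (cosB u v); field.
have b1 : below i (w0 *: b + a) by apply: belowD => //; exact: belowZ.
have b2 : below i (- (w0 *: b) + a).
  by apply: belowD => //; apply: belowN; exact: belowZ.
rewrite !split_cos !addrA (dG _ _ _ b1 ro) (dG _ _ _ b2 ro).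
by ring.
Qed.

Lemma decoupled_lin i (I : Type) (s : seq I) (c : I -> R) (G : I -> Om -> R) :
  (forall t, decoupled i (G t)) -> decoupled i (fun w => \sum_(t <- s) c t * G t w).
Proof.
move=> dG; elim: s => [|t s IH].
  rewrite (_ : (fun _ => _) = cst 0); last by apply/funext => w; rewrite big_nil.
  split => //; first by exists 0 => w; rewrite normr0.
  move=> a r th _ _.
  by under eq_Rintegral do rewrite mul0r; under [in RHS]eq_Rintegral do rewrite mul0r;
    rewrite Rintegral_cst// mul0r mulr0.
rewrite (_ : (fun _ => _) = (fun w => c t * G t w + \sum_(u <- s) c u * G u w)); last first.
  by apply/funext => w; rewrite big_cons.
move: IH; set H := (fun w => \sum_(u <- s) c u * G u w) => -[mH bH dH].
have [mT bT dT] := dG t.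
split.
- by apply: measurable_funD => //; apply: measurable_funM.
- have [M1 b1] := bT; have [M2 b2] := bH; exists (`|c t| * M1 + M2) => w.
  apply: (le_trans (ler_normD _ _)); apply: lerD; last exact: b2.
  by rewrite normrM ler_wpM2l.
- move=> a r th ab ro.
  have e b : \int[P]_w ((c t * G t w + H w) * cos (comb b w + th)) =
     c t * \int[P]_w (G t w * cos (comb b w + th)) + \int[P]_w (H w * cos (comb b w + th)).
    rewrite -RintegralZl//; last exact: mul_cos_integrable.
    rewrite -RintegralD//; last 2 first.
    - rewrite (_ : _ \o _ = (fun w => (c t)%:E * (G t w * cos (comb b w + th))%:E)%E)//.
      by apply: integrableZl => //; exact: mul_cos_integrable.
    - exact: mul_cos_integrable.
    by apply: eq_Rintegral => w _; rewrite mulrDl mulrA.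
  by rewrite !e dT// dH//; ring.
Qed.

Lemma decoupled_trigpoly i G b T : decoupled i G -> below i b -> trigpoly T ->
  decoupled i (fun w => G w * T (comb b w)).
Proof.
move=> dG bb [s E].
rewrite (_ : (fun _ => _) = (fun w => \sum_(t <- s) t.1.1 *
    (G w * cos (t.1.2 * comb b w + t.2)))); last first.
  apply/funext => w; rewrite E mulr_sumr; apply: eq_bigr => t _; ring.
by apply: decoupled_lin => t; exact: decoupled_cos.
Qed.

Lemma decoupled_limit i G b M F : decoupled i G -> below i b -> trig_limit M F ->
  decoupled i (fun w => G w * F (comb b w)).
Proof.
move=> dG bb lF; have [mG [M1 bG] _] := dG.
have mF := trig_limit_measurable lF.
have bF x := trig_limit_le x lF.
have mGF : measurable_fun setT (fun w => G w * F (comb b w)).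
  by apply: measurable_funM => //; apply: measurableT_comp => //; exact: measurable_comb.
split => //.
  by exists (M1 * M) => w; rewrite normrM ler_pM.
move=> a r th ab ro; have [T [pT bT cT]] := lF.
have dT k := decoupled_trigpoly dG bb (pT k).
have lim c : (fun k => \int[P]_w (G w * T k (comb b w) * cos (comb c w + th))) @ \oo -->
    \int[P]_w (G w * F (comb b w) * cos (comb c w + th)).
  apply: (@bounded_convergence _ _ _ _ _ _ (M1 * M)).
  - move=> k; apply: measurable_funM; first by have [] := dT k.
    by apply: measurable_cos_lin; exact: measurable_comb.
  - apply: measurable_funM => //.
    by apply: measurable_cos_lin; exact: measurable_comb.
  - move=> k w; rewrite !normrM -[leRHS]mulr1 ler_pM//; last exact: cos_normr_le1.
    by rewrite ler_pM.
  - move=> w; apply: cvgMl; apply: cvgMr; exact: cT.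
have e k : \int[P]_w (G w * T k (comb b w) * cos (comb (a + r) w + th)) =
    expR (- cov r r / 2) * \int[P]_w (G w * T k (comb b w) * cos (comb a w + th)).
  by have [_ _ ->] := dT k.
have lim1 := lim (a + r); rewrite (funext e) in lim1.
by apply: (cvg_unique _ lim1) => //; apply: cvgMr; exact: lim.
Qed.

(** Conditioning on the past: [comb r] may be replaced by an independent centred normal variable of
    the same variance. The two sides agree frequency by frequency, since the factor supplied by
    [decoupled] is the characteristic function of that variable. *)
Lemma integral_residual_trigpoly i G a r T : decoupled i G -> below i a -> orth i r ->
  trigpoly T ->
  \int[P]_w (G w * T (comb (a + r) w)) =
  \int[P]_w (G w * \int[gamma]_z T (comb a w + Num.sqrt (cov r r) * z)).
Proof.
move=> [mG bG dG] ab ro [s E].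
set rho := Num.sqrt (cov r r).
have rho2 : rho ^+ 2 = cov r r by rewrite sqr_sqrtr.
have inner y : \int[gamma]_z T (y + rho * z) =
    \sum_(t <- s) t.1.1 * expR (- (t.1.2 ^+ 2 * cov r r) / 2) * cos (t.1.2 * y + t.2).
  under eq_Rintegral do rewrite E.
  rewrite Rintegral_sum_cos; apply: eq_bigr => t _.
  under eq_Rintegral do rewrite mulrDr mulrA (addrAC _ _ t.2) [_ + _ * _]addrC.
  by rewrite Rintegral_cos_std_normal exprMn rho2; ring.
under [in RHS]eq_Rintegral do rewrite inner mulr_sumr.
under eq_Rintegral do rewrite E mulr_sumr.
have iG c th (k : R) : P.-integrable setT (EFin \o (fun w => k * (G w * cos (comb c w + th)))).
  rewrite (_ : _ \o _ = (fun w => k%:E * (G w * cos (comb c w + th))%:E)%E)//.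
  by apply: integrableZl => //; exact: mul_cos_integrable.
have RZ c th (k : R) : \int[P]_w (k * (G w * cos (comb c w + th))) =
    k * \int[P]_w (G w * cos (comb c w + th)).
  by rewrite RintegralZl//; exact: mul_cos_integrable.
have Rsum (I : Type) (u : seq I) (k : I -> R) (c : I -> 'rV[R]_n) (th : I -> R) :
   \int[P]_w (\sum_(t <- u) k t * (G w * cos (comb (c t) w + th t))) =
   \sum_(t <- u) k t * \int[P]_w (G w * cos (comb (c t) w + th t)).
  elim: u => [|t u IH].
    under eq_Rintegral do rewrite big_nil.
    by rewrite big_nil Rintegral_cst// mul0r.
  under eq_Rintegral do rewrite big_cons.
  rewrite RintegralD//=; last first.
    rewrite (_ : _ \o _ = (fun w => \sum_(t <- u) (k t * (G w * cos (comb (c t) w + th t)))%:E)%E).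
      by apply: integrable_sum => // v _; exact: iG.
    by apply/funext => w /=; rewrite sumEFin.
  by rewrite big_cons RZ IH.
under eq_Rintegral => w _.
  under eq_bigr => t _ do rewrite mulrCA -combZ scalerDr.
  over.
under [in RHS]eq_Rintegral => w _.
  under eq_bigr => t _ do rewrite mulrCA -combZ.
  over.
rewrite !Rsum; apply: eq_bigr => t _.
rewrite dG; [|exact: belowZ|exact: orthZ].
by rewrite covZl covZr [in RHS]expr2 !mulrA.
Qed.

Lemma integral_residual_limit i G a r M F : decoupled i G -> below i a -> orth i r ->
  trig_limit M F ->
  \int[P]_w (G w * F (comb (a + r) w)) =
  \int[P]_w (G w * \int[gamma]_z F (comb a w + Num.sqrt (cov r r) * z)).
Proof.
move=> dG ab ro lF; have [mG [M1 bG] _] := dG.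
have mF := trig_limit_measurable lF.
have bF x := trig_limit_le x lF.
have [T [pT bT cT]] := lF.
set rho := Num.sqrt (cov r r).
have mlin (f : R -> R) : measurable_fun setT f -> measurable_fun setT (fun w => f (comb a w)).
  by move=> mf; apply: (measurableT_comp mf); exact: measurable_comb.
have [mI bI cI] := trig_limit_average rho pT bT cT.
have [mIF bIF] := trig_limit_average_lim rho lF.
have lim1 : (fun k => \int[P]_w (G w * T k (comb (a + r) w))) @ \oo -->
    \int[P]_w (G w * F (comb (a + r) w)).
  apply: (@bounded_convergence _ _ _ _ _ _ (M1 * M)).
  - move=> k; apply: measurable_funM => //; apply: measurableT_comp.
      exact: trigpoly_measurable.
    exact: measurable_comb.
  - by apply: measurable_funM => //; apply: measurableT_comp => //; exact: measurable_comb.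
  - by move=> k w; rewrite normrM ler_pM.
  - by move=> w; apply: cvgMr; exact: cT.
have lim2 : (fun k => \int[P]_w (G w * \int[gamma]_z T k (comb a w + rho * z))) @ \oo -->
    \int[P]_w (G w * \int[gamma]_z F (comb a w + rho * z)).
  apply: (@bounded_convergence _ _ _ _ _ _ (M1 * M)).
  - by move=> k; apply: measurable_funM => //; exact: (mlin _ (mI k)).
  - by apply: measurable_funM => //; exact: (mlin _ mIF).
  - by move=> k w; rewrite normrM ler_pM// bI.
  - by move=> w; apply: cvgMr; exact: cI.
have e k : \int[P]_w (G w * T k (comb (a + r) w)) =
    \int[P]_w (G w * \int[gamma]_z T k (comb a w + rho * z)).
  exact: (integral_residual_trigpoly dG).
rewrite (funext e) in lim1.
exact: (cvg_unique _ lim1).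
Qed.

Lemma comb_delta (j : 'I_n) w : comb (delta_mx 0 j) w = X j w.
Proof.
rewrite /comb (bigD1 j)//= mxE !eqxx mul1r big1 ?addr0// => l lj.
by rewrite mxE (negbTE lj) andbF mul0r.
Qed.

Lemma below_delta i (j : 'I_n) : (j < i)%N -> below i (delta_mx 0 j).
Proof.
move=> ji l il; rewrite mxE (_ : (l == j) = false) ?andbF//.
by apply/negbTE; rewrite -(inj_eq val_inj) neq_ltn (leq_trans ji il) orbT.
Qed.

(** Integrates out the coordinates from the last to the first. Each is a combination of earlier ones
    plus an orthogonal residual, and averaging over the residual costs at most [Phi], whatever the
    past is. *)
Lemma expectation_prod_le M F Phi : trig_limit M F -> (forall x, 0 <= F x) ->
  (forall i : 'I_n, exists r : 'rV[R]_n, [/\ below i (delta_mx 0 i - r), orth i r &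
     forall y, \int[gamma]_z F (y + Num.sqrt (cov r r) * z) <= Phi]) ->
  \int[P]_w (\prod_(l < n) F (X l w)) <= Phi ^+ n.
Proof.
move=> lF F0 hR; have bF x := trig_limit_le x lF.
have mF := trig_limit_measurable lF.
pose G i w := \prod_(l < i) F (X l w).
have G0 i w : 0 <= G i w by apply: prodr_ge0.
(* The level [i'] stays free because coordinate i is only available as a factor at levels above i,
   so the next product needs the present one decoupled at those higher levels. *)
have dG i : (i <= n)%N -> forall i', (i <= i')%N -> decoupled i' (G i).
  elim: i => [|i IH] ni i' ii'.
    rewrite (_ : G 0%N = cst 1); first exact: decoupled1.
    by apply/funext => w; rewrite /G big_ord0.
  rewrite (_ : G i.+1 = (fun w => G i w * F (comb (delta_mx 0 (Ordinal ni)) w))); last first.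
    by apply/funext => w; rewrite comb_delta /G big_ord_recr.
  apply: (decoupled_limit _ _ lF); first by apply: IH; apply: ltnW.
  exact: below_delta.
have step i : (i < n)%N -> \int[P]_w G i.+1 w <= Phi * \int[P]_w G i w.
  move=> ni; have [r [br ro hr]] := hR (Ordinal ni).
  have := dG i (ltnW ni) i (leqnn i) => dGi; have [mG [M1 bG] _] := dGi.
  rewrite (_ : \int[P]_w G i.+1 w =
     \int[P]_w (G i w * F (comb (delta_mx 0 (Ordinal ni) - r + r) w))); last first.
    by apply: eq_Rintegral => w _; rewrite subrK comb_delta /G big_ord_recr.
  rewrite (integral_residual_limit dGi br ro lF).
  rewrite -RintegralZl//; last exact: (@bounded_integrable _ _ _ _ _ M1).
  have [mA bA] := trig_limit_average_lim (Num.sqrt (cov r r)) lF.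
  apply: le_Rintegral => //.
  - apply: (@bounded_integrable _ _ _ _ _ (M1 * M)).
      apply: measurable_funM => //; apply: (measurableT_comp mA).
      exact: measurable_comb.
    by move=> w; rewrite normrM ler_pM.
  - rewrite (_ : _ \o _ = (fun w => Phi%:E * (G i w)%:E)%E)//.
    by apply: integrableZl => //; exact: (@bounded_integrable _ _ _ _ _ M1).
  - by move=> w _; rewrite mulrC ler_wpM2r.
have all i : (i <= n)%N -> \int[P]_w G i w <= Phi ^+ i.
  elim: i => [|i IH] ni.
    rewrite /G; under eq_Rintegral do rewrite big_ord0.
    by rewrite Rintegral_cst//= probability_setT mulr1.
  apply: (le_trans (step _ ni)); rewrite exprS ler_wpM2l ?IH// 1?ltnW//.
  have [r [_ _ hr]] := hR (Ordinal ni).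
  by apply: le_trans (hr 0); apply: Rintegral_ge0.
exact: all.
Qed.

End GaussianProduct.

(** * Step functions as bounded limits of trigonometric polynomials *)

Section StepLimit.
Variable R : realType.

Lemma bernoulli_ineq (t : R) m : 0 <= 1 + t -> 1 + m%:R * t <= (1 + t) ^+ m.
Proof.
move=> t1; elim: m => [|m IH]; first by rewrite mul0r addr0 expr0.
rewrite exprS; apply: (@le_trans _ _ ((1 + t) * (1 + m%:R * t))); last by rewrite ler_wpM2l.
rewrite -natr1; have := sqr_ge0 t; have : 0 <= (m%:R : R) by []; nra.
Qed.

Lemma pow_1B_le (y : R) m : 0 <= y <= 1 -> (1 - y) ^+ m <= (1 + m%:R * y)^-1.
Proof.
move=> /andP[y0 y1]; have my : 0 <= m%:R * y by rewrite mulr_ge0.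
rewrite -[leRHS]mul1r ler_pdivlMr; last by lra.
apply: (@le_trans _ _ ((1 - y) ^+ m * (1 + y) ^+ m)).
  by rewrite ler_wpM2l ?exprn_ge0 ?bernoulli_ineq//; lra.
by rewrite -exprMn exprn_ile1//; nra.
Qed.

(** The polynomials of Brosowski and Deutsch's proof of the Stone-Weierstrass theorem. By
    Bernoulli's inequality they tend to 1 for u < 1/2, where (2u)^m tends to 0, and to 0 for 1/2 < u
    <= 1, where (2u)^m tends to infinity. *)
Definition step_poly (m : nat) (u : R) : R := (1 - u ^+ m) ^+ (2 ^ m).

Lemma step_poly_itv m u : 0 <= u <= 1 -> 0 <= step_poly m u <= 1.
Proof.
move=> /andP[u0 u1]; have um : 0 <= u ^+ m <= 1 by rewrite exprn_ge0//= exprn_ile1.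
by rewrite /step_poly exprn_ge0/= ?exprn_ile1//; lra.
Qed.

Lemma step_poly_ge m u y : 0 <= u -> 0 <= y <= 1 -> 2 * u <= 1 - y ->
  1 - (1 + m%:R * y)^-1 <= step_poly m u.
Proof.
move=> u0 y01 uy; have /andP[y0 y1] := y01.
apply: (@le_trans _ _ (1 - (2 * u) ^+ m)).
  rewrite lerD2l lerN2; apply: le_trans (pow_1B_le m y01).
  by rewrite lerXn2r ?nnegrE//; lra.
have um : u ^+ m <= 1 by apply: exprn_ile1; lra.
have := @bernoulli_ineq (- u ^+ m) (2 ^ m); rewrite /step_poly natrX exprMn => h.
by apply: le_trans (h _); lra.
Qed.

Lemma step_poly_le m u y : 0 <= u <= 1 -> 0 <= y -> 1 + y <= 2 * u ->
  step_poly m u <= (1 + m%:R * y)^-1.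
Proof.
move=> /andP[u0 u1] y0 uy.
have um : 0 <= u ^+ m <= 1 by rewrite exprn_ge0//= exprn_ile1.
apply: (le_trans (pow_1B_le _ um)).
have my : 0 <= m%:R * y by rewrite mulr_ge0.
have : 1 + m%:R * y <= (1 + y) ^+ m by apply: bernoulli_ineq; lra.
have : (1 + y) ^+ m <= (2 * u) ^+ m by rewrite lerXn2r ?nnegrE//; lra.
rewrite natrX -exprMn => h1 h2.
by rewrite lef_pV2 ?posrE; lra.
Qed.

Lemma sin_norm_le (x : R) : `|sin x| <= `|x|.
Proof.
wlog x0 : x / 0 < x.
  move=> W; have [x0|x0|<-] := ltgtP 0 x; first exact: W.
    by rewrite -normrN -sinN -[leRHS]normrN; apply: W; rewrite oppr_gt0.
  by rewrite sin0.
have cs : {within `[0, x], continuous (@sin R)}.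
  by apply: continuous_subspaceT; exact: continuous_sin.
have [c _] := @MVT R sin cos 0 x x0 (fun y _ => is_derive_sin y) cs.
rewrite sin0 !subr0 => ->; rewrite normrM ler_piMl//; exact: cos_max.
Qed.

Lemma sin_ge_half (x : R) : 0 <= x <= 1 -> x / 2 <= sin x.
Proof.
move=> /andP[x0 x1]; move: x0; rewrite le_eqVlt => /predU1P[<-|x0].
  by rewrite mul0r sin0.
have cs : {within `[0, x], continuous (@sin R)}.
  by apply: continuous_subspaceT; exact: continuous_sin.
have [c /[!in_itv]/= /andP[c0 cx]] := @MVT R sin cos 0 x x0 (fun y _ => is_derive_sin y) cs.
rewrite sin0 !subr0 => ->; rewrite mulrC ler_wpM2r ?(ltW x0)//.
have -> : c = (c / 2) *+ 2 by rewrite -mulr_natr divfK.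
rewrite cos_mulr2n cos2sin2.
have := sin_norm_le (c / 2); rewrite ler_norml ger0_norm; last by lra.
by move=> /andP[]; set t := sin _; nra.
Qed.

(** With w = 1/(k+1), the argument of [step_poly] is (1 - sin (w (x + w))) / 2, which lies below 1/2
    exactly when the sine is positive. The period 2 pi / w grows, so every x is eventually on the
    correct branch. The shift by w puts x = 0 on the positive side, so that the limit is the
    indicator of the closed half-line. The gap from 1/2 can be as small as order w^2, which the
    power (k+1)^3 overcomes. *)
Definition smooth_step (k : nat) (x : R) : R :=
  step_poly (k.+1 ^ 3) ((1 + cos (k.+1%:R^-1 * (x + k.+1%:R^-1) + pi / 2)) / 2).

Lemma smooth_step_itv k x : 0 <= smooth_step k x <= 1.
Proof.
apply: step_poly_itv.
by have := cos_le1 (k.+1%:R^-1 * (x + k.+1%:R^-1) + pi / 2);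
 have := cos_geN1 (k.+1%:R^-1 * (x + k.+1%:R^-1) + pi / 2); lra.
Qed.

Lemma smooth_step_shift_trigpoly k c : trigpoly (fun x => smooth_step k (x + c)).
Proof.
apply: trigpolyX.
set w := k.+1%:R^-1 : R.
rewrite (_ : (fun _ => _) = (fun x => 1 + (-1) * (2^-1 + 2^-1 *
    cos (w * x + (w * (c + w) + pi / 2))) ^+ (k.+1 ^ 3))); last first.
  apply/funext => x; rewrite mulN1r; congr (1 - _ ^+ _).
  rewrite (_ : w * (x + c + w) + pi / 2 = w * x + (w * (c + w) + pi / 2)); last by ring.
  by field.
apply: trigpolyD; first exact: trigpoly_cst.
apply: trigpolyM; first exact: trigpoly_cst.
apply: trigpolyX; apply: trigpolyD; first exact: trigpoly_cst.
exact: trigpoly_cos.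
Qed.

Lemma smooth_step_dist k (x : R) : `|x| + 1 <= k.+1%:R -> (x < 0 -> 2 <= k.+1%:R * `|x|) ->
  `|smooth_step k x - (0 <= x)%R%:R| <= 2 / k.+1%:R.
Proof.
set K : R := k.+1%:R => xK Kx.
have K1 : 1 <= K by rewrite ler1n.
have K0 : 0 < K by lra.
have /andP[KV0 KV1] : 0 < K^-1 <= 1 by rewrite invr_gt0 K0/= invf_le1.
have [/andP[s0 s1]] : 0 <= smooth_step k x <= 1 /\ true by split => //; exact: smooth_step_itv.
have m3 : (k.+1 ^ 3)%:R = K ^+ 3 :> R by rewrite natrX.
have sE : smooth_step k x = step_poly (k.+1 ^ 3) ((1 + cos (K^-1 * (x + K^-1) + pi / 2)) / 2) by [].
clearbody K.
have [x0|x0] := leP 0 x.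
- rewrite ger0_norm in xK => //.
  rewrite -[true%:R]/(1 : R) => _; rewrite ler0_norm ?opprB; last by lra.
  pose y := K^-1 * (x + K^-1).
  have y01 : 0 <= y <= 1.
    rewrite /y mulr_ge0 ?addr_ge0 ?(ltW KV0)//=.
    rewrite (mulrC K^-1) ler_pdivrMr// mul1r; apply: le_trans xK.
    by rewrite lerD2l.
  have y201 : 0 <= y / 2 <= 1 by lra.
  have := @step_poly_ge (k.+1 ^ 3) ((1 + cos (y + pi / 2)) / 2) (y / 2) _ y201 _.
  rewrite -sE cosDpihalf m3 => h.
  have sy := sin_ge_half y01; have sy1 := sin_le1 y.
  have {}h : 1 - (1 + K ^+ 3 * (y / 2))^-1 <= smooth_step k x by apply: h; lra.
  have : (1 + K ^+ 3 * (y / 2))^-1 <= (K / 2)^-1.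
    rewrite lef_pV2 ?posrE//; last 2 first.
    - by rewrite ltr_pwDl// mulr_ge0 ?exprn_ge0; lra.
    - by lra.
    have -> : K ^+ 3 * (y / 2) = K * (x * K + 1) / 2 by rewrite /y; field; lra.
    have : 0 <= x * K by rewrite mulr_ge0//; lra.
    by nra.
  rewrite invf_div => h2; rewrite lerBlDr -lerBlDl.
  by apply: le_trans h; rewrite lerD2l lerN2.
- rewrite ltr0_norm// in xK Kx; have {}Kx := Kx x0.
  rewrite -[false%:R]/(0 : R) subr0 => _; rewrite ger0_norm//.
  pose y := - (K^-1 * (x + K^-1)).
  have xy : - x / 2 <= - x - K^-1.
    have : K^-1 <= - x / 2; last by lra.
    by rewrite ler_pdivlMr// mulrC ler_pdivrMr//; lra.
  have y01 : 0 <= y <= 1.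
    rewrite /y -mulrN mulr_ge0//=; try lra.
    by rewrite mulrC ler_pdivrMr// mul1r; lra.
  have c1 := cos_le1 (- y + pi / 2); have c2 := cos_geN1 (- y + pi / 2).
  have := @step_poly_le (k.+1 ^ 3) ((1 + cos (- y + pi / 2)) / 2) (y / 2) _ _ _.
  have yE : K^-1 * (x + K^-1) = - y by rewrite /y opprK.
  rewrite -yE -sE yE m3 cosDpihalf sinN opprK => h; rewrite cosDpihalf sinN opprK in c1 c2.
  have sy := sin_ge_half y01.
  have {}h : smooth_step k x <= (1 + K ^+ 3 * (y / 2))^-1.
    by have /andP[y0 y1] := y01; clearbody y; apply: h; lra.
  apply: (le_trans h); rewrite -[2 / K]invf_div.
  rewrite lef_pV2 ?posrE//; last 2 first.
  - by rewrite ltr_pwDl// mulr_ge0 ?exprn_ge0; lra.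
  - by lra.
  have -> : K ^+ 3 * (y / 2) = K * (K * (- x - K^-1)) / 2 by rewrite /y; field; lra.
  have : 1 <= K * (- x - K^-1).
    apply: (@le_trans _ _ (K * (- x / 2))); last by rewrite ler_wpM2l//; lra.
    by lra.
  by nra.
Qed.

Lemma smooth_step_cvg (x : R) : smooth_step ^~ x @ \oo --> ((0 <= x)%R%:R : R).
Proof.
have H (c : R) : \forall k \near \oo, c <= k.+1%:R.
  near=> k; apply: (@le_trans _ _ k%:R); last by rewrite ler_nat.
  by near: k; exact: nbhs_infty_ger.
apply/cvgrPdist_le => e e0.
near=> k; rewrite distrC (le_trans (smooth_step_dist _ _))//.
- by near: k; exact: H.
- move=> x0; have nx0 : 0 < `|x| by rewrite normr_gt0 lt_eqF.
  rewrite -ler_pdivrMr//.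
  by near: k; exact: H.
- rewrite ler_pdivrMr// mulrC -ler_pdivrMr//.
  by near: k; exact: H.
Unshelve. all: by end_near. Qed.

(** Encodes both conditions of the event in one factor: a negative value gives 0, and a value beyond
    the threshold [c] is penalised by [q]. *)
Definition two_level (q c x : R) : R := (0 <= x)%R%:R - (1 - q) * (c <= x)%R%:R.

Lemma two_level_trig_limit q c : 0 <= q <= 1 -> trig_limit 1 (two_level q c).
Proof.
move=> /andP[q0 q1].
exists (fun k x => smooth_step k x - (1 - q) * smooth_step k (x - c)); split.
- move=> k; rewrite (_ : (fun _ => _) =
    (fun x => smooth_step k (x + 0) + - (1 - q) * smooth_step k (x - c))); last first.
    by apply/funext => x; rewrite addr0 mulNr.
  apply: trigpolyD; first exact: smooth_step_shift_trigpoly.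
  by apply: trigpolyM; [exact: trigpoly_cst|exact: smooth_step_shift_trigpoly].
- move=> k x; have := smooth_step_itv k x; have := smooth_step_itv k (x - c).
  by rewrite ler_norml; nra.
- move=> x; rewrite /two_level -(subr_ge0 c x).
  apply: cvgB; first exact: smooth_step_cvg.
  by apply: cvgMr; exact: smooth_step_cvg.
Qed.

End StepLimit.

(** * Small balls and positive orthants *)

Section NormalBall.
Variable R : realType.
Local Notation gamma := (normal_prob (0 : R) 1).
Local Notation peak := (normal_peak (1 : R)).

Definition normal_ball (u : R) : R := fine (gamma [set z | `|z| < u]).

Lemma normal_ball_setE (u : R) : [set z : R | `|z| < u] = `](- u), u[%classic.
Proof. by apply/seteqP; split=> z /=; rewrite in_itv/= ltr_norml. Qed.

Lemma fine_gamma_le (A B : set (measurableTypeR R)) : measurable A -> measurable B ->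
  A `<=` B -> fine (gamma A) <= fine (gamma B).
Proof.
move=> mA mB AB; rewrite fine_le ?fin_num_measure//.
by apply: le_measure; rewrite ?inE.
Qed.

Lemma fine_gamma_le1 (A : set (measurableTypeR R)) : measurable A -> fine (gamma A) <= 1.
Proof. by move=> mA; rewrite -lee_fin fineK ?fin_num_measure// probability_le1. Qed.

Lemma normal_ball_le1 u : normal_ball u <= 1.
Proof. by apply: fine_gamma_le1; rewrite normal_ball_setE; exact: measurable_itv. Qed.

Lemma normal_ball_ge0 u : 0 <= normal_ball u.
Proof. by rewrite /normal_ball fine_ge0. Qed.

Lemma normal_ball_mono u v : u <= v -> normal_ball u <= normal_ball v.
Proof.
move=> uv; apply: fine_gamma_le; rewrite ?normal_ball_setE; try exact: measurable_itv.
by move=> z; rewrite /= !in_itv/= => /andP[h1 h2]; apply/andP; split; lra.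
Qed.

Lemma normal_prob_itv_le (a b : R) : a <= b -> fine (gamma `[a, b[%classic) <= peak * (b - a).
Proof.
move=> ab; rewrite -lee_fin fineK ?fin_num_measure//.
rewrite /normal_prob.
apply: (@le_trans _ _ (\int[@lebesgue_measure R]_(x in `[a, b[%classic) (cst peak%:E x))%E).
  apply: ge0_le_integral => //=.
  - by move=> x _; rewrite lee_fin normal_pdf_ge0.
  - by apply: measurable_funTS; apply/measurable_EFinP; exact: measurable_normal_pdf.
  - by move=> x _; rewrite lee_fin normal_pdf_ub// oner_neq0.
rewrite integral_cst//= lebesgue_measure_itv/= lte_fin.
move: ab; rewrite le_eqVlt => /predU1P[->|ab].
  by rewrite ltxx mule0 subrr mulr0.
by rewrite ab -EFinD -EFinM.
Qed.

(** On [-1, 1] the density is at least half its peak, because exp(-1/2) >= 1/2, and the ball has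
    length 2u. Hence a ball is at least as likely as the bound of [normal_prob_itv_le] for an
    arbitrary interval of half its length: anti-concentration at no loss of constants. *)
Lemma normal_ball_ge (u : R) : 0 < u <= 1 -> peak * u <= normal_ball u.
Proof.
move=> /andP[u0 u1]; rewrite -lee_fin fineK ?fin_num_measure//; last first.
  by rewrite normal_ball_setE; exact: measurable_itv.
rewrite /normal_prob normal_ball_setE.
pose h : R := peak / 2; pose A : set (measurableTypeR R) := `](- u), u[%classic.
rewrite -/A; have mA : measurable A by exact: measurable_itv.
apply: (@le_trans _ _ (\int[@lebesgue_measure R]_(x in A) (cst h%:E x))%E).
  rewrite /A /h integral_cst//= lebesgue_measure_itv/= lte_fin ifT; last by lra.
  by rewrite -EFinD -EFinM lee_fin; have := normal_peak_ge0 (1 : R); nra.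
apply: ge0_le_integral => //=.
- by move=> x _; rewrite lee_fin divr_ge0// normal_peak_ge0.
- by apply: measurable_funTS; apply/measurable_EFinP; exact: measurable_normal_pdf.
- move=> x; rewrite /A /= in_itv/= => /andP[x0 x1]; rewrite lee_fin std_normal_pdfE.
  rewrite ler_wpM2l ?normal_peak_ge0//.
  apply: (@le_trans _ _ (expR (- (1 / 2)))).
    by apply: le_trans (expR_ge1Dx _); lra.
  by rewrite ler_expR; nra.
Qed.

Lemma normal_peak_gt : 16^-1 < peak.
Proof.
have p0 := @pi_gt0 R; have [/andP[_ p2] _] := @pihalf_02_cos_pihalf R.
rewrite /normal_peak ltf_pV2 ?posrE ?sqrtr_gt0//; last by rewrite expr1n mul1r mulrn_wgt0.
rewrite -[ltRHS]ger0_norm// -sqrtr_sqr ltr_sqrt//.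
by rewrite expr1n mul1r -mulr_natl; nra.
Qed.

Lemma normal_ball_gt0 u : 0 < u -> 0 < normal_ball u.
Proof.
move=> u0; have [u1|u1] := leP u 1.
  by apply: lt_le_trans (@normal_ball_ge u _); rewrite ?mulr_gt0 ?normal_peak_gt0 ?oner_neq0//; lra.
apply: lt_le_trans (normal_ball_mono (ltW u1)).
by apply: lt_le_trans (@normal_ball_ge 1 _); rewrite ?mulr_gt0 ?normal_peak_gt0 ?oner_neq0//; lra.
Qed.

(** The unit ball already has mass at least the peak of the density, which exceeds 1/16. This brings
    small [p] into the range of [normal_ball_ge]. *)
Lemma normal_ball_small u : normal_ball u <= 16^-1 -> u <= 1.
Proof.
move=> p; rewrite leNgt; apply/negP => u1.
have := normal_ball_mono (ltW u1); have := @normal_ball_ge 1; have := normal_peak_gt.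
move=> h1 h2 h3; have : 0 < (1 : R) <= 1 by lra.
by move=> /h2; lra.
Qed.

Lemma normal_prob_sym (A : set (measurableTypeR R)) : measurable A ->
  gamma A = gamma [set z | A (- z)].
Proof.
move=> mA; have := @normal_prob_scale R (-1) A; rewrite oppr_eq0 oner_neq0 => /(_ isT mA).
rewrite (_ : [set z | A (-1 * z)] = [set z | A (- z)]); last first.
  by apply/seteqP; split=> z /=; rewrite mulN1r.
move=> <-; rewrite /normal_prob; apply: eq_integral => x _; congr EFin.
by rewrite !normal_pdfE ?oppr_eq0 ?oner_neq0// /normal_peak /normal_fun sqrrN.
Qed.

Lemma normal_prob_neg : fine (gamma `]-oo, (0 : R)[%classic) <= 2^-1.
Proof.
have m1 : measurable (`]-oo, (0 : R)[%classic : set (measurableTypeR R)) by exact: measurable_itv.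
have m2 : measurable (`](0 : R), +oo[%classic : set (measurableTypeR R)) by exact: measurable_itv.
have e : gamma `]-oo, (0 : R)[%classic = gamma `](0 : R), +oo[%classic.
  rewrite normal_prob_sym//; congr (gamma _).
  by apply/seteqP; split=> z /=; rewrite !in_itv/= andbT oppr_lt0.
pose A1 : set (measurableTypeR R) := `]-oo, (0 : R)[%classic.
pose A2 : set (measurableTypeR R) := `](0 : R), +oo[%classic.
have h : gamma (A1 `|` A2) = (gamma A1 + gamma A2)%E.
  apply: measureU => //; apply/seteqP; split=> z //=; rewrite /A1 /A2 /= => -[]; rewrite !in_itv/= andbT.
  by move=> h1 h2; have := lt_trans h1 h2; rewrite ltxx.
rewrite /A1 /A2 -e in h.
have := fine_gamma_le1 (measurableU _ _ m1 m2).
by rewrite h fineD ?fin_num_measure//; lra.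
Qed.

(** By symmetry the mass outside the ball is shared equally by the two tails. *)
Lemma normal_prob_gtN (u : R) : 0 < u ->
  fine (gamma `](- u), +oo[%classic) <= (1 + normal_ball u) / 2.
Proof.
move=> u0.
pose A1 : set (measurableTypeR R) := `](- u), +oo[%classic.
pose A2 : set (measurableTypeR R) := `[u, +oo[%classic.
pose A3 : set (measurableTypeR R) := `](- u), u[%classic.
pose A4 : set (measurableTypeR R) := `]-oo, (- u)]%classic.
have m1 : measurable A1 by exact: measurable_itv.
have m2 : measurable A2 by exact: measurable_itv.
have m3 : measurable A3 by exact: measurable_itv.
have m4 : measurable A4 by exact: measurable_itv.
have e : gamma A4 = gamma A2.
  rewrite normal_prob_sym//; congr (gamma _).
  by apply/seteqP; split=> z /=; rewrite /A4 /A2 /= !in_itv/= andbT lerN2.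
have h1 : gamma A1 = (gamma A3 + gamma A2)%E.
  rewrite -measureU//.
    congr (gamma _); apply/seteqP; split=> z; rewrite /A1 /A2 /A3 /= !in_itv/= ?andbT.
      by move=> hz; have [zu|zu] := ltP z u; [left|right]; rewrite ?hz.
    by case=> [/andP[]//|]; lra.
  apply/seteqP; split=> z //; rewrite /A2 /A3 /= => -[]; rewrite !in_itv/= andbT.
  by move=> /andP[_ a] b; have := lt_le_trans a b; rewrite ltxx.
have h2 : gamma setT = (gamma A1 + gamma A4)%E.
  rewrite -measureU//.
    congr (gamma _); apply/seteqP; split=> z //= _; rewrite /A1 /A4 /= !in_itv/= andbT.
    by have [zu|zu] := ltP (- u) z; [left|right].
  apply/seteqP; split=> z //; rewrite /A1 /A4 /= => -[]; rewrite !in_itv/= andbT.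
  by move=> a b; have := lt_le_trans a b; rewrite ltxx.
have h3 : fine (gamma setT) = 1 by rewrite probability_setT.
rewrite h2 fineD ?fin_num_measure// e in h3.
have h4 : fine (gamma A1) = fine (gamma A3) + fine (gamma A2).
  by rewrite [in LHS]h1 fineD ?fin_num_measure.
rewrite /normal_ball normal_ball_setE -/A3 -/A1; move: h3 h4; lra.
Qed.

Lemma Rintegral_le_indic (f : R -> R) (al be M : R) (A : set (measurableTypeR R)) :
  measurable_fun setT f -> (forall z, `|f z| <= M) -> measurable A ->
  (forall z, f z <= al + be * \1_A z) ->
  \int[gamma]_z f z <= al + be * fine (gamma A).
Proof.
move=> mf bf mA h.
have fi : gamma.-integrable setT (EFin \o f) by exact: (@bounded_integrable _ _ _ _ _ M).
have i1 : gamma.-integrable setT (EFin \o (fun z => be * \1_A z)).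
  apply: (@bounded_integrable _ _ _ _ _ `|be|).
    by apply: measurable_funM => //; exact: measurable_indic.
  by move=> z; rewrite normrM indicE ler_piMr//; case: (_ \in _); rewrite ?normr1 ?normr0.
have i2 : gamma.-integrable setT (EFin \o (fun=> al)) by exact: finite_measure_integrable_cst.
apply: (@le_trans _ _ (\int[gamma]_z (al + be * \1_A z))).
  apply: le_Rintegral => //.
  rewrite (_ : _ \o _ = ((EFin \o (fun=> al)) \+ (EFin \o (fun z => (be * \1_A z)%R)))%E)//.
  exact: integrableD.
rewrite RintegralD// RintegralZl//; last first.
  apply: (@bounded_integrable _ _ _ _ _ 1); first exact: measurable_indic.
  by move=> z; rewrite indicE; case: (_ \in _); rewrite ?normr1 ?normr0.
rewrite Rintegral_cst// (_ : fine (gamma setT) = 1) ?mulr1 ?lerD2l; last by rewrite probability_setT.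
by rewrite /Rintegral integral_indic// setIT.
Qed.

(* The two bounds serve small and large [normal_ball u] respectively. *)
Lemma two_level_average_le (q c rho sigma y : R) :
  0 <= q <= 1 -> 0 < c -> 0 < sigma -> sigma <= rho ->
  let p := normal_ball (c / sigma) in
  \int[gamma]_z two_level q c (y + rho * z) <= Num.max ((1 + p) / 2) ((1 + q) / 2) /\
  (p <= 16^-1 -> \int[gamma]_z two_level q c (y + rho * z) <= q + p).
Proof.
move=> /andP[q0 q1] c0 s0 sr p; have r0 : 0 < rho by lra.
have lF : trig_limit 1 (two_level q c) by apply: two_level_trig_limit; rewrite q0.
pose f (z : R) := two_level q c (y + rho * z).
have mf : measurable_fun setT f.
  apply: (measurableT_comp (trig_limit_measurable lF)).
  by apply: measurable_funD => //; exact: mulrl_measurable.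
have bf z : `|f z| <= 1 by exact: trig_limit_le lF.
have cr : c / rho <= c / sigma by rewrite ler_wpM2l ?(ltW c0)// lef_pV2.
split.
(* If the mean [y] is below [c], positivity alone is costly: it forces z > - c / sigma. Otherwise z
   >= 0 already puts the value beyond [c], so at least half of the mass carries the factor [q]. *)
- have [yc|yc] := ltP y c.
    apply: (@le_trans _ _ ((1 + p) / 2)); last by rewrite le_max lexx.
    apply: le_trans (normal_prob_gtN _); last by rewrite divr_gt0.
    rewrite -[leRHS]mul1r -[leRHS]add0r.
    apply: (Rintegral_le_indic mf bf); first exact: measurable_itv.
    move=> z; rewrite add0r mul1r indicE /f /two_level.
    case: (boolP (0 <= y + rho * z)) => h.
      rewrite mem_set.
        by case: (c <= _); rewrite /= ?mulr1 ?mulr0; lra.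
      have h1 : - y / rho <= z by rewrite ler_pdivrMr// (mulrC z); lra.
      have h2 : y / rho < c / rho by rewrite ltr_pM2r ?invr_gt0.
      by rewrite /= in_itv/= andbT; rewrite mulNr in h1; lra.
    rewrite lerBlDr; apply: addr_ge0; first by case: (_ \in _).
    by rewrite mulr_ge0 ?subr_ge0//; case: (c <= _).
  apply: (@le_trans _ _ ((1 + q) / 2)); last by rewrite le_max lexx orbT.
  apply: (@le_trans _ _ (q + (1 - q) * fine (gamma `]-oo, (0 : R)[%classic))); last first.
    by have := normal_prob_neg; nra.
  apply: (Rintegral_le_indic mf bf); first exact: measurable_itv.
  move=> z; rewrite indicE /f /two_level.
  have [z0|z0] := ltP z 0.
    rewrite mem_set ?mulr1; last by rewrite /= in_itv.
    have : 0 <= (1 - q) * (c <= y + rho * z)%R%:R.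
      by rewrite mulr_ge0 ?subr_ge0//; case: (c <= _).
    by case: (0 <= y + rho * z) => /=; rewrite ?mulr1n ?mulr0n; lra.
  rewrite (_ : c <= y + rho * z = true); last by have := mulr_ge0 (ltW r0) z0; lra.
  rewrite memNset ?mulr0; last by rewrite /= in_itv/=; lra.
  by case: (0 <= _); rewrite /= ?mulr1n ?mulr0n; lra.
- move=> /normal_ball_small u1.
  have u0 : 0 < c / sigma by rewrite divr_gt0.
  have ps : peak * (c / sigma) <= p by apply: normal_ball_ge; rewrite u0.
  (* Outside the window [0, c) the function is at most [q]; in terms of z this window has length c /
     rho. *)
  pose A : set (measurableTypeR R) := `[(- y / rho), ((c - y) / rho)[%classic.
  have yc : - y / rho <= (c - y) / rho by rewrite ler_wpM2r ?invr_ge0 ?(ltW r0)//; lra.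
  apply: (@le_trans _ _ (q + 1 * fine (gamma A))); last first.
    rewrite mul1r lerD2l; apply: le_trans ps; apply: (le_trans (normal_prob_itv_le yc)).
    rewrite ler_wpM2l ?normal_peak_ge0//; apply: le_trans cr.
    by rewrite -mulrBl opprK subrK.
  apply: (Rintegral_le_indic mf bf); first exact: measurable_itv.
  move=> z; rewrite mul1r indicE /f /two_level.
  have Az : (z \in A) = (0 <= y + rho * z) && (y + rho * z < c).
    apply/idP/idP.
      rewrite inE /A /= in_itv/= ler_pdivrMr// ltr_pdivlMr// (mulrC z) => /andP[a b].
      by apply/andP; split; lra.
    move=> /andP[a b]; rewrite inE /A /= in_itv/= ler_pdivrMr// ltr_pdivlMr// (mulrC z).
    by apply/andP; split; lra.
  rewrite Az ltNge.
  by case: (0 <= y + rho * z); case: (c <= y + rho * z) => /=; rewrite ?mulr1n ?mulr0n; lra.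
Qed.

(** Equivalently Phi <= p^(1/32), one half of which pays for Markov's inequality. For p <= 1/16, 2 p
    <= p^(3/4) because p <= 2^(-4). For p > 1/16, (1 + p) / 2 <= exp(-(1 - p) / 2), while - ln p <=
    1/p - 1 <= 16 (1 - p). The exponent 1/32 comes from 2 * 16. *)
Lemma powR_two_level_le (p : R) (Phi : R) : 0 < p <= 1 -> 0 <= Phi ->
  Phi <= (1 + p) / 2 -> (p <= 16^-1 -> Phi <= 2 * p) ->
  Phi * expR (- ln p / 64) <= expR (ln p / 64).
Proof.
move=> /andP[p0 p1] Phi0 h1 h2.
have lnp : ln p <= 0 by rewrite -ln1 ler_ln ?posrE.
have [ps|pl] := leP p 16^-1.
- have {h1} := h2 ps => h.
  apply: (@le_trans _ _ (2 * p * expR (- ln p / 64))).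
    by rewrite ler_wpM2r// expR_ge0.
  rewrite -{1}[p]lnK ?posrE// -{1}[2]lnK ?posrE// -!expRD ler_expR.
  have : ln p <= - (4 * ln 2).
    rewrite mulr_natl -lnXn// -lnV ?posrE ?exprn_gt0// ler_ln ?posrE ?invr_gt0 ?exprn_gt0//.
    by rewrite (_ : 2 ^+ 4 = 16 :> R)//; ring.
  have : 0 < ln (2 : R) by rewrite ln_gt0// ltr1n.
  by lra.
- apply: (@le_trans _ _ (expR ((p - 1) / 2) * expR (- ln p / 64))).
    rewrite ler_wpM2r ?expR_ge0//; apply: (le_trans h1).
    by apply: le_trans (expR_ge1Dx _); lra.
  rewrite -expRD ler_expR.
  have : 1 - p^-1 <= ln p.
    have : ln (1 + (p^-1 - 1)) <= p^-1 - 1.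
      have pv : 0 < p^-1 by rewrite invr_gt0.
      by apply: le_ln1Dx; lra.
    by rewrite addrC subrK lnV ?posrE//; lra.
  have : p^-1 - 1 <= 16 * (1 - p).
    have : p^-1 <= 16 by rewrite -[leRHS]invrK lef_pV2 ?posrE//; lra.
    rewrite (_ : p^-1 - 1 = p^-1 * (1 - p)); last by field; lra.
    by move=> h; rewrite ler_wpM2r//; lra.
  by lra.
Qed.

End NormalBall.

Section PositiveOrthant.
Variables (R : realType) (d : measure_display) (Om : measurableType d) (P : probability Om R).
Variables (n : nat) (X : nat -> Om -> R) (S : 'M[R]_n).
Local Notation gamma := (normal_prob (0 : R) 1).

Hypothesis mX : forall j, measurable_fun setT (X j).
Hypothesis S_sym : S^T = S.
Hypothesis cov_ge0 : forall a, 0 <= cov S a a.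
Hypothesis law_comb : forall a (A : set (measurableTypeR R)), measurable A ->
  P (comb X a @^-1` A) = gamma [set z | A (Num.sqrt (cov S a a) * z)].

Lemma two_level_ge0 (q c x : R) : 0 <= q <= 1 -> 0 < c -> 0 <= two_level q c x.
Proof.
move=> /andP[q0 q1] c0; rewrite /two_level.
case: (lerP c x) => [cx|_]; last by rewrite mulr0 subr0; case: (0 <= x).
by rewrite (_ : 0 <= x); [rewrite /= mulr1; lra|lra].
Qed.

(* Markov's inequality in exponential form: a coordinate pays the factor [q]
   only when it exceeds [c]. *)
Lemma two_level_ge_exp (b c x : R) : 0 <= b -> 0 < c -> 0 < x ->
  expR (- b * (x / c)) <= two_level (expR (- b)) c x.
Proof.
move=> b0 c0 x0; rewrite /two_level (ltW x0) /=.
case: (lerP c x) => [cx|xc] /=.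
  rewrite mulr1 subKr ler_expR mulNr lerN2 ler_peMr//.
  by rewrite ler_pdivlMr// mul1r.
rewrite mulr0 subr0 -expR0 ler_expR mulNr oppr_le0 mulr_ge0//.
by rewrite divr_ge0// ltW.
Qed.

Lemma measurable_event (L : R) : measurable
  [set w | (forall i : 'I_n, 0 < X i w) /\ \sum_(i < n) X i w <= n%:R * L].
Proof.
rewrite (_ : [set w | _] = \bigcap_(i in [set: 'I_n]) [set w | 0 < X i w] `&`
   [set w | \sum_(i < n) X i w <= n%:R * L]); last first.
  by apply/seteqP; split=> w /= [h1 h2]; split => // i; [move=> _|]; exact: h1.
apply: measurableI.
  apply: fin_bigcap_measurable => // i _.
  rewrite -[X in measurable X]setTI.
  have := @measurable_fun_ltr _ _ _ setT (cst 0) (X i) (measurable_cst _) (mX i).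
  by move=> /(_ measurableT [set true]) h; apply: h.
rewrite -[X in measurable X]setTI.
have ms : measurable_fun setT (fun w => \sum_(i < n) X i w) by exact: measurable_sum.
have := @measurable_fun_ler _ _ _ setT _ (cst (n%:R * L)) ms (measurable_cst _).
by move=> /(_ measurableT [set true]) h; apply: h.
Qed.

(** The penalty is taken equal to [p], so that both branches of [two_level_average_le] become (1 +
    p) / 2. The threshold c = 64 L makes the sum of the X i / c at most n / 64, which limits the
    cost of Markov's inequality to p^(-n/64). *)
Lemma positive_orthant_bound (L sigma : R) : 0 < L -> 0 < sigma ->
  (forall i : 'I_n, exists r : 'rV[R]_n,
    [/\ below i (delta_mx 0 i - r), orth S i r & sigma ^+ 2 <= cov S r r]) ->
  fine (P [set w | (forall i : 'I_n, 0 < X i w) /\ \sum_(i < n) X i w <= n%:R * L])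
   <= normal_ball (64 * L / sigma) `^ (n%:R / 64).
Proof.
move=> L0 s0 hR.
set c := 64 * L; have c0 : 0 < c by rewrite mulr_gt0.
set p := normal_ball _.
have p0 : 0 < p by apply: normal_ball_gt0; rewrite divr_gt0.
have p1 : p <= 1 by exact: normal_ball_le1.
have p01 : 0 <= p <= 1 by rewrite (ltW p0).
set b := - ln p; have b0 : 0 <= b by rewrite oppr_ge0 ln_le0.
have pb : expR (- b) = p by rewrite opprK lnK.
pose F := two_level p c.
have lF : trig_limit 1 F := two_level_trig_limit c p01.
have F0 x : 0 <= F x by exact: two_level_ge0.
pose Phi := if p <= 16^-1 then Num.min ((1 + p) / 2) (2 * p) else (1 + p) / 2.
have hPhi : \int[P]_w (\prod_(l < n) F (X l w)) <= Phi ^+ n.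
  apply: (expectation_prod_le mX S_sym cov_ge0 law_comb lF F0) => i.
  have [r [br ro sr]] := hR i; exists r; split => // y.
  have sr' : sigma <= Num.sqrt (cov S r r).
    by rewrite -[sigma]ger0_norm ?(ltW s0)// -sqrtr_sqr ler_wsqrtr.
  have [h1 h2] := two_level_average_le y p01 c0 s0 sr'.
  rewrite maxxx in h1.
  rewrite /Phi; case: ifPn => // ps; rewrite le_min h1/=.
  by have := h2 ps; rewrite -/p; lra.
set E := [set w | _].
have mE : measurable E by exact: measurable_event.
have key : expR (- b * (n%:R / 64)) * fine (P E) <= Phi ^+ n.
  apply: le_trans hPhi.
  have mprod : measurable_fun setT (fun w => \prod_(l < n) F (X l w)).
    apply: measurable_prod => l _.
    by apply: (measurableT_comp (trig_limit_measurable lF)).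
  have bprod w : `|\prod_(l < n) F (X l w)| <= 1.
    rewrite normr_prod; apply: prodr_ile1 => l _.
    by rewrite normr_ge0/=; exact: trig_limit_le lF.
  have i1 : P.-integrable setT (EFin \o (fun w => \1_E w)).
    apply: (@bounded_integrable _ _ _ _ _ 1); first exact: measurable_indic.
    by move=> z; rewrite indicE; case: (_ \in _); rewrite ?normr1 ?normr0.
  rewrite (_ : expR _ * _ = \int[P]_w (expR (- b * (n%:R / 64)) * \1_E w)); last first.
    by rewrite RintegralZl// /Rintegral integral_indic// setIT.
  apply: le_Rintegral => //.
  - rewrite (_ : _ \o _ = (fun w => (expR (- b * (n%:R / 64)))%:E * (\1_E w)%:E)%E)//.
    exact: integrableZl.
  - exact: (@bounded_integrable _ _ _ _ _ 1).
  - move=> w _; rewrite indicE; case: (boolP (w \in E)); last first.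
      by rewrite mulr0 => _; apply: prodr_ge0.
    rewrite inE /E /= mulr1 => -[Xp Xs].
    apply: (@le_trans _ _ (\prod_(l < n) expR (- b * (X l w / c)))).
      rewrite -expR_sum ler_expR -mulr_sumr -mulr_suml.
      apply: ler_wnM2l; first by rewrite oppr_le0.
      rewrite ler_pdivrMr//.
      by apply: (le_trans Xs); rewrite /c; lra.
    apply: ler_prod => l _; rewrite expR_ge0/= /F -pb.
    exact: two_level_ge_exp.
have Phi0 : 0 <= Phi.
  by rewrite /Phi; case: ifP => _; rewrite ?le_min; lra.
have hP : Phi * expR (- ln p / 64) <= expR (ln p / 64).
  apply: powR_two_level_le; rewrite ?p0//.
    by rewrite /Phi; case: ifP => // _; rewrite ge_min lexx.
  by move=> ps; rewrite /Phi ps ge_min lexx orbT.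
rewrite /powR gt_eqF//.
have -> : fine (P E) = expR (b * (n%:R / 64)) * (expR (- b * (n%:R / 64)) * fine (P E)).
  by rewrite mulrA -expRD -mulrDl addrN mul0r expR0 mul1r.
apply: (@le_trans _ _ (expR (b * (n%:R / 64)) * Phi ^+ n)).
  by rewrite ler_wpM2l// expR_ge0.
have -> : b * (n%:R / 64) = n%:R * (- ln p / 64) by rewrite /b; ring.
have -> : n%:R / 64 * ln p = n%:R * (ln p / 64) by ring.
rewrite !expRM_natl -exprMn lerXn2r ?nnegrE ?expR_ge0 ?mulr_ge0 ?expR_ge0//.
by rewrite mulrC.
Qed.

End PositiveOrthant.

(** * Greedy selection of nearly orthogonal vectors *)

Section Residual.
Variables (R : realType) (n : nat) (S : 'M[R]_n) (sigma2 : R).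
Hypothesis S_sym : S^T = S.
Hypothesis sigma2_gt0 : 0 < sigma2.
Hypothesis dist_ge : forall (i : 'I_n) a, below i a ->
  sigma2 <= cov S (delta_mx 0 i - a) (delta_mx 0 i - a).

(** Gram-Schmidt: the projection onto m + 1 coordinates corrects the one onto m along the residual
    of the new coordinate. The division is legitimate because [dist_ge] makes that residual
    nonzero. *)
Lemma orthogonal_residual_aux m : (m <= n)%N -> forall v : 'rV[R]_n,
  exists2 a, below m a & orth S m (v - a).
Proof.
elim: m => [_ v|m IH mn v]; first by exists 0 => // j; rewrite ?mxE.
pose em : 'rV[R]_n := delta_mx 0 (Ordinal mn).
have [a ba oa] := IH (ltnW mn) v; have [a' ba' oa'] := IH (ltnW mn) em.
set u := v - a in oa; set r := em - a' in oa'.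
have r0 : 0 < cov S r r.
  by apply: lt_le_trans sigma2_gt0 _; exact: (@dist_ge (Ordinal mn) a').
set c := cov S u r / cov S r r.
exists (a + c *: r).
  have bm b : below m b -> below m.+1 b by move=> hb j mj; apply: hb; exact: ltnW.
  apply: belowD; first exact: bm.
  apply: belowZ; apply: belowD; last by apply: belowN; exact: bm.
  exact: below_delta.
have -> : v - (a + c *: r) = u + (- c) *: r by rewrite opprD addrA scaleNr.
have om : orth S m (u + (- c) *: r).
  by move=> j jm; rewrite covDl covZl oa// oa'// mulr0 addr0.
move=> j; rewrite ltnS leq_eqVlt => /predU1P[jm|]; last exact: om.
have -> : delta_mx 0 j = r + a'.
  by rewrite subrK; congr delta_mx; exact: val_inj.
rewrite (covDr S_sym) (orth_cov S_sym om ba') addr0 covDl covZl /c.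
by rewrite mulNr divfK ?gt_eqF// subrr.
Qed.

Lemma orthogonal_residual (i : 'I_n) : exists r : 'rV[R]_n,
  [/\ below i (delta_mx 0 i - r), orth S i r & sigma2 <= cov S r r].
Proof.
have [a ba oa] := orthogonal_residual_aux (ltnW (ltn_ord i)) (delta_mx 0 i).
by exists (delta_mx 0 i - a); split; [rewrite subKr| |exact: dist_ge].
Qed.

End Residual.

Section GreedySelection.
Variables (R : realType) (M : nat) (G : 'M[R]_M) (e B : R).
Hypothesis G_sym : G^T = G.
Hypothesis G_ge0 : forall a, 0 <= cov G a a.
Hypothesis e_gt0 : 0 < e.
Hypothesis B_ge0 : 0 <= B.
Hypothesis G_diag : forall j : 'I_M, cov G (delta_mx 0 j) (delta_mx 0 j) = e.
Hypothesis G_le : forall a, cov G a a <= B * \sum_j a 0 j ^+ 2.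

Let D (j : 'I_M) : 'rV[R]_M := delta_mx 0 j.
Let supported (s : seq 'I_M) (a : 'rV[R]_M) := forall l, l \notin s -> a 0 l = 0.

(** A lower bound on distances to all combinations, rather than on the norm of a particular
    residual: in this form it survives the passage from one quadratic form to a larger one, whose
    projections are different. *)
Definition well_separated (s : seq 'I_M) := forall i (l : 'I_M) a, (i < size s)%N ->
  supported (take i s) a -> e / 2 <= cov G (D (nth l s i) - a) (D (nth l s i) - a).

(* Bessel's inequality for the dual system. *)
Lemma sum_cov_sqr_le r : 0 < cov G r r -> \sum_j cov G (D j) r ^+ 2 <= B * cov G r r.
Proof.
move=> r0; set N2 := \sum_j _.
pose c : 'rV[R]_M := \row_j cov G (D j) r.
have cr : cov G c r = N2.
  rewrite [c]row_sum_delta.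
  have H (s : seq 'I_M) : cov G (\sum_(j <- s) c 0 j *: delta_mx 0 j) r =
      \sum_(j <- s) cov G (D j) r ^+ 2.
    elim: s => [|j s IH]; first by rewrite !big_nil /cov !mul0mx mxE.
    by rewrite !big_cons covDl covZl IH mxE expr2.
  exact: H.
have c2 : cov G c c <= B * N2.
  by apply: (le_trans (G_le c)); rewrite ler_wpM2l// ler_sum// => j _; rewrite mxE.
have N20 : 0 <= N2 by apply: sumr_ge0 => j _; exact: sqr_ge0.
have := G_ge0 (c - (N2 / cov G r r) *: r).
rewrite -scaleNr covDl !(covDr G_sym) !covZl !(covZr G_sym) (covC G_sym r c) cr => h.
move: N20; rewrite le_eqVlt => /predU1P[<-|N20]; first by rewrite mulr_ge0// ltW.
have {}h : N2 ^+ 2 / cov G r r <= cov G c c.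
  have e1 : N2 / cov G r r * cov G r r = N2 by rewrite divfK// gt_eqF.
  rewrite -subr_ge0; apply: le_trans h _; rewrite le_eqVlt; apply/orP; left; apply/eqP.
  by field; rewrite gt_eqF.
have : N2 ^+ 2 <= B * N2 * cov G r r by rewrite -ler_pdivrMr//; apply: le_trans h c2.
by rewrite expr2 mulrAC ler_pM2r.
Qed.

(* After n steps the residuals of the M vectors have total squared norm at least
   M e - n B, so one of them has squared norm at least e / 2. *)
Lemma greedy_selection (n : nat) : (forall m, (m < n)%N -> m%:R * B <= M%:R * (e / 2)) ->
  (0 < M)%N -> exists2 s : seq 'I_M, size s = n & well_separated s.
Proof.
move=> hn M0.
(* The induction carries along an orthogonal system [r] inside the span of the selected vectors. The
   last clause says that orthogonality to all [r i] implies orthogonality to every selected vector,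
   so projecting onto the [r i] is projecting onto that span. *)
suff [s [r [sn ws _]]] : exists s : seq 'I_M, exists r : nat -> 'rV[R]_M,
   [/\ size s = n, well_separated s &
   [/\ forall i, (i < n)%N -> supported s (r i),
       forall i j, (i < n)%N -> (j < n)%N -> i != j -> cov G (r i) (r j) = 0,
       forall i, (i < n)%N -> e / 2 <= cov G (r i) (r i) &
       forall l u, l \in s -> (forall i, (i < n)%N -> cov G u (r i) = 0) -> cov G u (D l) = 0]].
  by exists s.
elim: n hn => [_|n IH hn].
  by exists [::], (fun=> 0); split.
have [|s [r [sn ws [rs ro rg rspan]]]] := IH; first by move=> m mn; apply: hn; exact: ltnW.
have e2 : 0 < e / 2 by rewrite divr_gt0.
have r0 i : (i < n)%N -> 0 < cov G (r i) (r i) by move=> ni; apply: lt_le_trans (rg i ni).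
pose pr j := \sum_(i < n) (cov G (D j) (r i) / cov G (r i) (r i)) *: r i.
pose u j := D j - pr j.
have cov_suml (c : 'I_n -> R) w : cov G (\sum_(i < n) c i *: r i) w = \sum_(i < n) c i * cov G (r i) w.
  have H (t : seq 'I_n) : cov G (\sum_(i <- t) c i *: r i) w = \sum_(i <- t) c i * cov G (r i) w.
    elim: t => [|i t IHt]; first by rewrite !big_nil /cov !mul0mx mxE.
    by rewrite !big_cons covDl covZl IHt.
  exact: H.
have ur j i : (i < n)%N -> cov G (u j) (r i) = 0.
  move=> ni; rewrite /u -scaleN1r covDl covZl cov_suml mulN1r.
  rewrite (bigD1 (Ordinal ni))//= big1 ?addr0; last first.
    by move=> k ki; rewrite (ro k i) ?mulr0//; move: ki; rewrite -(inj_eq val_inj).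
  by rewrite divfK ?subrr// gt_eqF// r0.
have prs j : supported s (pr j).
  move=> l ls; rewrite /pr summxE big1// => i _.
  by rewrite mxE rs// mulr0.
have us j a : supported s a -> cov G (u j) a = 0.
  move=> sa; rewrite [a]row_sum_delta (covC G_sym).
  have H (t : seq 'I_M) : cov G (\sum_(k <- t) a 0 k *: delta_mx 0 k) (u j) = 0.
    elim: t => [|k t IHt]; first by rewrite !big_nil /cov !mul0mx mxE.
    rewrite !big_cons covDl covZl IHt addr0 (covC G_sym).
    case: (boolP (k \in s)) => ks; last by rewrite sa// mul0r.
    by rewrite rspan ?mulr0// => i; exact: ur.
  exact: H.
have uu j : cov G (u j) (u j) = e - \sum_(i < n) cov G (D j) (r i) ^+ 2 / cov G (r i) (r i).
  have -> : cov G (u j) (u j) = cov G (u j) (D j).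
    rewrite {2}/u -scaleN1r (covDr G_sym) (covZr G_sym) (us _ _ (prs j)).
    by rewrite mulr0 addr0.
  rewrite /u -scaleN1r covDl covZl G_diag cov_suml mulN1r; congr (_ - _).
  by apply: eq_bigr => i _; rewrite (covC G_sym (r i)); ring.
have [j hj] : exists j, \sum_(i < n) cov G (D j) (r i) ^+ 2 / cov G (r i) (r i) <= e / 2.
  apply: contrapT => /forallNP H.
  have : \sum_(j < M) (e / 2) < \sum_(j < M) \sum_(i < n) cov G (D j) (r i) ^+ 2 / cov G (r i) (r i).
    apply: ltr_sum => [|j _]; last by rewrite ltNge; apply/negP; exact: H.
    by apply/hasP; exists (Ordinal M0) => //; rewrite mem_index_enum.
  apply/negP; rewrite -leNgt exchange_big /=.
  have -> : \sum_(j < M) (e / 2) = M%:R * (e / 2).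
    by rewrite sumr_const card_ord [RHS]mulr_natl.
  apply: le_trans (hn n (ltnSn n)).
  have -> : n%:R * B = \sum_(i < n) B by rewrite sumr_const card_ord mulr_natl.
  apply: ler_sum => i _; rewrite -mulr_suml ler_pdivrMr ?r0//.
  by apply: sum_cov_sqr_le; exact: r0.
have uj : e / 2 <= cov G (u j) (u j) by rewrite uu; lra.
have sub_rcons a : supported s a -> supported (rcons s j) a.
  by move=> sa l; rewrite mem_rcons inE negb_or => /andP[_]; exact: sa.
exists (rcons s j), (fun i => if (i < n)%N then r i else u j); split.
- by rewrite size_rcons sn.
- move=> i l a; rewrite size_rcons sn ltnS => ni.
  rewrite -cats1 takel_cat ?sn// => sa.
  rewrite nth_cat sn; case: ltnP => ni'; first by apply: ws => //; rewrite sn.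
  have -> : i = n by apply/eqP; rewrite eqn_leq ni.
  rewrite subnn /=.
  have {}sa : supported s a.
    by move=> k ks; apply: sa; apply: contra ks; exact: mem_take.
  have -> : D j - a = u j + (pr j - a) by rewrite /u addrA subrK.
  have sp : supported s (pr j - a).
    by move=> k ks; rewrite !mxE prs// sa// subr0.
  have sq x y : cov G (x + y) (x + y) = cov G x x + 2 * cov G x y + cov G y y.
    by rewrite covDl !(covDr G_sym) (covC G_sym y x); ring.
  rewrite sq (us _ _ sp) mulr0 addr0.
  by have := G_ge0 (pr j - a); lra.
- split.
  + move=> i _; case: ifP => ni; first by apply: sub_rcons; exact: rs.
    move=> l; rewrite mem_rcons inE negb_or => /andP[lj ls].
    by rewrite /u !mxE prs// subr0 (negbTE lj) andbF.
  + move=> i k; rewrite !ltnS => ni nk ik.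
    case: ltnP => ni'; case: ltnP => nk'.
    * exact: ro.
    * by rewrite (covC G_sym) ur.
    * exact: ur.
    * have ein : i = n by apply/eqP; rewrite eqn_leq ni.
      have ekn : k = n by apply/eqP; rewrite eqn_leq nk.
      by move: ik; rewrite ein ekn eqxx.
  + by move=> i _; case: ifP => ni //; exact: rg.
  + move=> l v; rewrite mem_rcons inE => lj hv.
    have hv' i : (i < n)%N -> cov G v (r i) = 0.
      by move=> ni; have := hv i (ltnW ni); rewrite ni.
    case/predU1P: lj => [->|ls]; last exact: rspan.
    have := hv n (ltnSn n); rewrite ltnn /u -scaleN1r (covDr G_sym) (covZr G_sym).
    rewrite (covC G_sym v (pr j)) cov_suml big1 ?mulr0 ?addr0// => i _.
    by rewrite (covC G_sym _ v) hv' ?mulr0.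
Qed.

End GreedySelection.

(** * Spectral densities and Gram matrices *)

Section BorelCore.
Variable R : realType.
Local Notation leb_mu := (@lebesgue_measure R).

(** A measurable set of the completion is a Borel set plus part of a null set. The density bound is
    given for Borel subsets of [E], so [E] is traded for its Borel part at no loss of measure. *)
Lemma lebesgue_measurable_core (E : set R) : lebesgue_measurable E ->
  exists2 A : set (measurableTypeR R), measurable A &
    A `<=` E /\ leb_mu A = completed_lebesgue_measure E.
Proof.
move=> mE.
have : (completed_algebra_gen leb_mu) E.
  by rewrite -g_sigma_completed_algebra_genE completed_caratheodory_measurable.
move=> [A mA [N [F [mF F0 NF]]]] EAN.
exists A => //; split; first by rewrite -EAN; exact: subsetUl.
apply/eqP; rewrite eq_le; apply/andP; split.
  by apply: le_outer_measure; rewrite -EAN; exact: subsetUl.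
rewrite -EAN; apply: (le_trans (outer_measureU2 _ _ _)).
rewrite -[leRHS]adde0; apply: leeD => //.
by rewrite -F0; apply: le_outer_measure.
Qed.

Lemma le_integral_density (rho : {finite_measure set (measurableTypeR R) -> \bar R})
    (nu : R) (A D : set (measurableTypeR R)) (g : measurableTypeR R -> \bar R) :
  0 <= nu -> measurable A -> measurable D -> A `<=` D ->
  (forall B, measurable B -> B `<=` A -> (nu%:E * leb_mu B <= rho B)%E) ->
  measurable_fun setT g -> (forall x, (0 <= g x)%E) ->
  (nu%:E * \int[leb_mu]_(x in A) g x <= \int[rho]_(x in D) g x)%E.
Proof.
move=> nu0 mA mD AD h mg g0.
pose m1 : {measure set (measurableTypeR R) -> \bar R} := mscale (NngNum nu0) leb_mu.
(* The restriction to [A] extends the comparison with [rho] from subsets of [A] to all measurable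
   sets, as the comparison of integrals requires. *)
pose m2 : {measure set (measurableTypeR R) -> \bar R} := mscale (NngNum nu0) (mrestr leb_mu mA).
have -> : (nu%:E * \int[leb_mu]_(x in A) g x)%E = (\int[m1]_(x in A) g x)%E.
  by rewrite ge0_integral_mscale//; exact: measurable_funTS.
have -> : (\int[m1]_(x in A) g x)%E = (\int[m2]_(x in A) g x)%E.
  apply: eq_measure_integral => B mB BA.
  by change ((nu%:E * leb_mu B)%E = (nu%:E * leb_mu (B `&` A))%E); rewrite setIidl.
apply: (@le_trans _ _ (\int[rho]_(x in A) g x)%E).
  apply: ge0_le_measure_integral => // B mB.
  rewrite /m2 /mscale/= /mrestr.
  apply: le_trans (h _ (measurableI _ _ mB mA) (@subIsetr _ _ _)) _.
  by apply: le_measure; rewrite ?inE//; exact: measurableI.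
by apply: ge0_subset_integral => //; exact: measurable_funTS.
Qed.

End BorelCore.

Lemma Rintegral_linear (R : realType) d (Om : measurableType d)
    (mu : {measure set Om -> \bar R}) (D : set Om) (I : Type) (s : seq I) (c : I -> R)
    (f : I -> Om -> R) : measurable D -> (forall i, mu.-integrable D (EFin \o f i)) ->
  \int[mu]_(x in D) (\sum_(i <- s) c i * f i x) = \sum_(i <- s) c i * \int[mu]_(x in D) f i x.
Proof.
move=> mD fi.
have cfi i : mu.-integrable D (EFin \o (fun x => c i * f i x)).
  rewrite (_ : _ \o _ = (fun x => (c i)%:E * (f i x)%:E)%E)//.
  by apply: integrableZl => //; exact: fi.
elim: s => [|i s IH].
  by under eq_Rintegral do rewrite big_nil; rewrite big_nil Rintegral_cst// mul0r.
under eq_Rintegral do rewrite big_cons.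
rewrite RintegralD//=; last first.
  rewrite (_ : _ \o _ = (fun x => \sum_(j <- s) (c j * f j x)%:E)%E).
    by apply: integrable_sum => // j _; exact: cfi.
  by apply/funext => x /=; rewrite sumEFin.
by rewrite big_cons RintegralZl// IH.
Qed.

Section TrigGram.
Variable R : realType.

Lemma covE n (S : 'M[R]_n) a b : cov S a b = \sum_j \sum_k a 0 j * b 0 k * S j k.
Proof.
rewrite /cov mxE exchange_big /=; apply: eq_bigr => k _.
rewrite mxE mulr_suml; apply: eq_bigr => j _.
by rewrite mxE; ring.
Qed.

Variables (mu : {measure set (measurableTypeR R) -> \bar R}) (D : set (measurableTypeR R)).
Hypothesis mD : measurable D.
Hypothesis finD : (mu D < +oo)%E.

Lemma bounded_integrable_on (f : measurableTypeR R -> R) (M : R) :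
  measurable_fun setT f -> (forall x, `|f x| <= M) -> mu.-integrable D (EFin \o f).
Proof.
move=> mf bf; apply: measurable_bounded_integrable => //; first exact: measurable_funTS.
exists M; split; first exact: num_real.
by move=> y My x _ /=; apply: le_trans (bf x) (ltW My).
Qed.

Lemma measurable_cosM (t : R) : measurable_fun setT (fun x : measurableTypeR R => cos (x * t)).
Proof.
rewrite (_ : (fun _ => _) = (fun x : measurableTypeR R => cos (x * t + 0))).
  by apply: measurable_cos_lin; apply: measurable_funM.
by apply/funext => x; rewrite addr0.
Qed.

Lemma integrable_cosM t : mu.-integrable D (EFin \o (fun x => cos (x * t))).
Proof.
by apply: (@bounded_integrable_on _ 1) => [|x]; [exact: measurable_cosM|exact: cos_normr_le1].
Qed.

(** The squared modulus of the sum of the a_j e^(i x tau_j), written without complex numbers. *)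
Definition trig_sqr n (tau : 'I_n -> R) (a : 'rV[R]_n) (x : R) : R :=
  (\sum_j a 0 j * cos (x * tau j)) ^+ 2 + (\sum_j a 0 j * sin (x * tau j)) ^+ 2.

Lemma trig_sqr_ge0 n (tau : 'I_n -> R) a x : 0 <= trig_sqr tau a x.
Proof. by rewrite addr_ge0 ?sqr_ge0. Qed.

Lemma trig_sqrE n (tau : 'I_n -> R) a x :
  trig_sqr tau a x = \sum_j \sum_k a 0 j * a 0 k * cos (x * (tau j - tau k)).
Proof.
rewrite /trig_sqr !expr2 !mulr_suml -big_split; apply: eq_bigr => j _.
rewrite !mulr_sumr -big_split; apply: eq_bigr => k _ /=.
by rewrite mulrBr cosB; ring.
Qed.

Lemma measurable_trig_sqr n (tau : 'I_n -> R) a :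
  measurable_fun setT (fun x : measurableTypeR R => trig_sqr tau a x).
Proof.
rewrite (_ : (fun _ => _) = (fun x : measurableTypeR R =>
    \sum_j \sum_k a 0 j * a 0 k * cos (x * (tau j - tau k)))); last first.
  by apply/funext => x; rewrite trig_sqrE.
apply: measurable_sum => j; apply: measurable_sum => k; apply: measurable_funM => //.
exact: measurable_cosM.
Qed.

(** The real part of the Gram matrix of the exponentials e^(i x tau_j) in L^2(D, mu). For mu the
    spectral measure it is the covariance matrix of the process at the times tau_j. *)
Definition gram n (tau : 'I_n -> R) : 'M[R]_n :=
  \matrix_(j, k) \int[mu]_(x in D) cos (x * (tau j - tau k)).

Lemma gram_sym n (tau : 'I_n -> R) : (gram tau)^T = gram tau.
Proof.
apply/matrixP => j k; rewrite !mxE; apply: eq_Rintegral => x _.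
by rewrite -cosN -mulrN opprB.
Qed.

Lemma cov_gram n (tau : 'I_n -> R) a :
  cov (gram tau) a a = \int[mu]_(x in D) trig_sqr tau a x.
Proof.
under [RHS]eq_Rintegral do rewrite trig_sqrE pair_bigA /=.
rewrite Rintegral_linear//; last by move=> p; exact: integrable_cosM.
rewrite covE pair_bigA /=; apply: eq_bigr => p _.
by rewrite mxE.
Qed.

Lemma integrable_trig_sqr n (tau : 'I_n -> R) a :
  mu.-integrable D (EFin \o (fun x => trig_sqr tau a x)).
Proof.
apply: (@bounded_integrable_on _ (\sum_j \sum_k `|a 0 j * a 0 k|)).
  exact: measurable_trig_sqr.
move=> x; rewrite trig_sqrE (le_trans (ler_norm_sum _ _ _))//.
apply: ler_sum => j _; rewrite (le_trans (ler_norm_sum _ _ _))//.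
apply: ler_sum => k _; rewrite normrM ler_piMr//; exact: cos_normr_le1.
Qed.

Lemma cov_gram_ge0 n (tau : 'I_n -> R) a : 0 <= cov (gram tau) a a.
Proof. by rewrite cov_gram; apply: Rintegral_ge0 => x _; exact: trig_sqr_ge0. Qed.

Lemma trig_sqr_delta n (tau : 'I_n -> R) j x : trig_sqr tau (delta_mx 0 j) x = 1.
Proof.
rewrite /trig_sqr.
have H (f : 'I_n -> R) : \sum_k delta_mx 0 j 0 k * f k = f j.
  rewrite (bigD1 j)//= mxE !eqxx mul1r big1 ?addr0// => k kj.
  by rewrite mxE (negbTE kj) andbF mul0r.
by rewrite !H cos2Dsin2.
Qed.

Lemma cov_gram_delta n (tau : 'I_n -> R) j :
  cov (gram tau) (delta_mx 0 j) (delta_mx 0 j) = fine (mu D).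
Proof.
rewrite cov_gram; under eq_Rintegral do rewrite trig_sqr_delta.
by rewrite Rintegral_cst// mul1r.
Qed.

End TrigGram.

(** * Orthogonality of lattice exponentials on a full period *)

Section Orthogonality.
Variable R : realType.
Local Notation leb_mu := (@lebesgue_measure R).
Implicit Types q : R.

Lemma Rintegral_cos_period q (m : int) : 0 < q -> m != 0 ->
  \int[leb_mu]_(x in `[- (pi * q), pi * q]) cos (x * (m%:~R / q)) = 0.
Proof.
move=> q0 m0; have p0 := @pi_gt0 R.
have qn0 : q != 0 by rewrite gt_eqF.
have mn0 : m%:~R != 0 :> R by rewrite intr_eq0.
have mq0 : m%:~R / q != 0 :> R by apply: mulf_neq0 => //; rewrite invr_neq0.
have wq : q * (m%:~R / q) = m%:~R :> R by rewrite mulrC divfK.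
move: (m%:~R / q) mq0 wq => w mq0 wq.
pose F x : R := sin (x * w) / w.
have dF (x : R) : is_derive x 1 F (cos (x * w)).
  rewrite /F; apply: is_derive_eq; rewrite /GRing.scale /=; field; exact: mq0.
have cF : continuous F.
  move=> x; apply/differentiable_continuous/derivable1_diffP.
  exact: (@ex_derive _ _ _ _ _ _ _ (dF x)).
rewrite /Rintegral (@continuous_FTC2 _ _ F).
- rewrite -EFinB /= /F.
  have -> : pi * q * w = pi * m%:~R by rewrite -mulrA wq.
  have -> : - (pi * q) * w = - (pi * m%:~R) by rewrite mulNr -mulrA wq.
  have sm (k : nat) : sin (pi * k%:R) = 0 :> R.
    elim: k => [|k IH]; first by rewrite mulr0 sin0.
    by rewrite -natr1 mulrDr mulr1 sinDpi IH oppr0.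
  have sm' : sin (pi * m%:~R) = 0 :> R.
    case: (intP m) => [|k|k]; first by rewrite mulr0 sin0.
      exact: (sm k.+1).
    by rewrite mulrNz mulrN sinN (sm k.+1) oppr0.
  by rewrite sinN sm' oppr0 mul0r subrr.
- have : 0 < pi * q by rewrite mulr_gt0.
  by move=> h; rewrite (lt_trans _ h)// oppr_lt0.
- apply: continuous_subspaceT => x; apply: continuous_comp; last exact: continuous_cos.
  by apply: cvgM; [exact: cvg_id|exact: cvg_cst].
- split.
  + by move=> x _; exact: (@ex_derive _ _ _ _ _ _ _ (dF x)).
  + by apply: cvg_at_right_filter; exact: cF.
  + by apply: cvg_at_left_filter; exact: cF.
- by move=> x _; rewrite derive1E; exact: (@derive_val _ _ _ _ _ _ _ (dF x)).
Qed.

Lemma gram_itv_lattice q n (tau : 'I_n -> R) (m : 'I_n -> nat) : 0 < q -> injective m ->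
  (forall j, tau j = (m j)%:R / q) ->
  gram leb_mu `[- (pi * q), pi * q]%classic tau = (2 * pi * q)%:M.
Proof.
move=> q0 minj tm; have p0 := @pi_gt0 R.
have pq0 : 0 < pi * q by rewrite mulr_gt0.
apply/matrixP => j k; rewrite !mxE.
have [->|jk] := eqVneq j k.
  under eq_Rintegral do rewrite subrr mulr0 cos0.
  rewrite Rintegral_cst//= lebesgue_measure_itv/= lte_fin ifT; last by lra.
  by rewrite -EFinD /= mulr1n; ring.
rewrite mulr0n.
have -> : tau j - tau k = ((m j)%:Z - (m k)%:Z)%:~R / q.
  by rewrite !tm -mulrBl intrB.
apply: Rintegral_cos_period => //.
by rewrite subr_eq0 eqz_nat (inj_eq minj).
Qed.

(** Enlarging [A] to the full period only adds nonnegative mass, and there the exponentials are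
    orthogonal with squared norm 2 pi q. *)
Lemma cov_gram_lattice_le q n (tau : 'I_n -> R) (m : 'I_n -> nat) (A : set (measurableTypeR R)) a :
  0 < q -> injective m -> (forall j, tau j = (m j)%:R / q) ->
  measurable A -> A `<=` `[- (pi * q), pi * q]%classic ->
  cov (gram leb_mu A tau) a a <= 2 * pi * q * \sum_j a 0 j ^+ 2.
Proof.
move=> q0 minj tm mA AI; have p0 := @pi_gt0 R.
pose I : set (measurableTypeR R) := `[- (pi * q), pi * q]%classic.
have mI : measurable I by exact: measurable_itv.
have fI : (leb_mu I < +oo)%E.
  by rewrite /I lebesgue_measure_itv/=; case: ifP => _; rewrite ?ltry// -EFinD ltry.
have fA : (leb_mu A < +oo)%E.
  by apply: le_lt_trans fI; apply: le_measure; rewrite ?inE.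
have -> : 2 * pi * q * \sum_j a 0 j ^+ 2 = cov (gram leb_mu I tau) a a.
  rewrite (gram_itv_lattice q0 minj tm) covE mulr_sumr; apply: eq_bigr => j _.
  rewrite (bigD1 j)//= big1 ?addr0; last by move=> k kj; rewrite mxE eq_sym (negbTE kj) mulr0n mulr0.
  by rewrite mxE eqxx mulr1n; ring.
rewrite !cov_gram//.
rewrite /Rintegral fine_le//.
- exact: integrable_fin_num (integrable_trig_sqr _ _ _ _).
- exact: integrable_fin_num (integrable_trig_sqr _ _ _ _).
apply: ge0_subset_integral => //.
- by apply: measurable_funTS; apply/measurable_EFinP; exact: measurable_trig_sqr.
- by move=> x _; rewrite lee_fin trig_sqr_ge0.
Qed.

End Orthogonality.

(** * Laws of linear combinations of the process from its spectral measure *)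

Section GSPCovariance.
Variables (R : realType) (T : time) (d : measure_display) (Om : measurableType d).
Variables (P : probability Om R) (f : time_domain R T -> {RV P >-> R}).
Variable rho : {finite_measure set (measurableTypeR R) -> \bar R}.
Hypothesis f_GSP : is_GSP f.
Hypothesis rho_spec : is_spectral_measure f rho.
Local Notation gamma := (normal_prob (0 : R) 1).
Local Notation D := (freq_domain R T : set (measurableTypeR R)).

Lemma to_realB (u v : time_domain R T) : to_real (u - v) = to_real u - to_real v.
Proof. by clear; case: T u v => u v //=; rewrite intrB. Qed.

Lemma measurable_freq_domain : measurable (freq_domain R T : set (measurableTypeR R)).
Proof. by clear; case: T => /=. Qed.

Lemma finite_freq_domain : (rho (freq_domain R T) < +oo)%E.
Proof. by rewrite -ge0_fin_numE// fin_num_measure//; exact: measurable_freq_domain. Qed.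

Lemma gsp_gaussian n (t : nat -> time_domain R T) (a : 'rV[R]_n) :
  exists2 sigma : R, 0 <= sigma & forall A : set (measurableTypeR R), measurable A ->
    P (comb (fun j => f (t j)) a @^-1` A) = gamma [set z | A (sigma * z)].
Proof.
have [h _ _ _] := f_GSP.
have [s s0 hs] := h n (fun i => t i) (fun i => a 0 i).
by exists s => // A mA; rewrite -centered_gaussian_lawE// -hs.
Qed.

Lemma gsp_square_integral n (t : nat -> time_domain R T) (a : 'rV[R]_n) (sigma : R) :
  (forall A : set (measurableTypeR R), measurable A ->
    P (comb (fun j => f (t j)) a @^-1` A) = gamma [set z | A (sigma * z)]) ->
  (\int[P]_w ((comb (fun j => f (t j)) a w) ^+ 2)%:E = (sigma ^+ 2)%:E)%E.
Proof. by apply: gaussian_second_moment; apply: measurable_comb. Qed.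

Lemma gsp_square_integrable (t : time_domain R T) :
  P.-integrable setT (fun w => (f t w ^+ 2)%:E).
Proof.
have [s s0 /gsp_square_integral] := gsp_gaussian (fun=> t) (delta_mx 0 (ord0 : 'I_1)).
under eq_integral do rewrite comb_delta.
move=> h.
apply/integrableP; split.
  by apply/measurable_EFinP; exact: measurable_funX.
by under eq_integral do rewrite gee0_abs ?lee_fin ?sqr_ge0//; rewrite h ltry.
Qed.

Lemma gsp_product_integrable (s t : time_domain R T) :
  P.-integrable setT (EFin \o (fun w => f s w * f t w)).
Proof.
apply: (le_integrable _ _ _ (integrableD _ (gsp_square_integrable s) (gsp_square_integrable t))) => //.
  by apply/measurable_EFinP; exact: measurable_funM.
move=> w _ /=; rewrite lee_fin normrM.
rewrite [leRHS]ger0_norm ?addr_ge0 ?sqr_ge0//.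
rewrite -(real_normK (num_real (f s w))) -(real_normK (num_real (f t w))).
have := sqr_ge0 (`|f s w| - `|f t w|).
have := normr_ge0 (f s w); have := normr_ge0 (f t w).
by nra.
Qed.

(** Stationarity is formulated on the cylinder sigma-algebra; this brings the law of a product of
    two values within its reach. *)
Lemma cylinder_product (u v : time_domain R T) (A : set (measurableTypeR R)) : measurable A ->
  cylinder_sigma_algebra [set g : time_domain R T -> R | A (g u * g v)].
Proof.
move=> mA; rewrite /cylinder_sigma_algebra; set G := (X in <<s X >>).
have mcoord (t : time_domain R T) :
    measurable_fun setT (fun g : g_sigma_algebraType G => g t : measurableTypeR R).
  move=> _ B mB; rewrite setTI; apply: sub_sigma_algebra.
  by exists t; exists B.
have := measurable_funM (mcoord u) (mcoord v).
by move=> /(_ measurableT A mA); rewrite setTI.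
Qed.

Lemma gsp_covariance (s t : time_domain R T) :
  \int[P]_w (f s w * f t w) = \int[rho]_(x in D) cos (x * (to_real s - to_real t)).
Proof.
have [_ st _ _] := f_GSP; have [_ _ spec _] := rho_spec.
have -> : to_real s - to_real t = - to_real (t - s) by rewrite to_realB opprB.
under [RHS]eq_Rintegral do rewrite mulrN cosN.
rewrite [RHS]/Rintegral -spec /covariance_kernel unlock /Rintegral; congr fine.
pose Y1 : Om -> measurableTypeR R := fun w => f s w * f t w.
pose Y2 : Om -> measurableTypeR R := fun w => f 0 w * f (t - s) w.
have mY1 : measurable_fun setT Y1 by exact: measurable_funM.
have mY2 : measurable_fun setT Y2 by exact: measurable_funM.
have i1 : P.-integrable setT (EFin \o Y1) by exact: gsp_product_integrable.
have i2 : P.-integrable setT (EFin \o Y2) by exact: gsp_product_integrable.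
pose m1 : {measure set _ -> \bar R} := pushforward P Y1.
pose m2 : {measure set _ -> \bar R} := pushforward P Y2.
transitivity (\int[m1 mY1]_y (y%:E))%E.
  by rewrite integral_pushforward//; exact: measurable_id.
transitivity (\int[m2 mY2]_y (y%:E))%E; last first.
  by rewrite integral_pushforward//; exact: measurable_id.
apply: eq_measure_integral => A mA _.
have := st s _ (cylinder_product 0 (t - s) mA).
by rewrite /= add0r subrK.
Qed.

(** Gaussianity provides some standard deviation; comparing second moments with the spectral formula
    identifies it. *)
Lemma gsp_law n (t : nat -> time_domain R T) (a : 'rV[R]_n) (A : set (measurableTypeR R)) :
  measurable A ->
  P (comb (fun j => f (t j)) a @^-1` A) =
  gamma [set z | A (Num.sqrt (cov (gram rho D (fun j : 'I_n => to_real (t j))) a a) * z)].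
Proof.
move=> mA; have [s s0 hs] := gsp_gaussian t a.
suff -> : cov (gram rho D (fun j : 'I_n => to_real (t j))) a a = s ^+ 2.
  by rewrite sqrtr_sqr ger0_norm// hs.
have h := congr1 fine (gsp_square_integral hs); rewrite /= in h.
rewrite -[s ^+ 2]h -[RHS]/(\int[P]_w ((comb (fun j => f (t j)) a w) ^+ 2)).
have E w : comb (fun j => f (t j)) a w ^+ 2 =
    \sum_(p : 'I_n * 'I_n) (a 0 p.1 * a 0 p.2) * (f (t p.1) w * f (t p.2) w).
  rewrite -(pair_bigA _ (fun j k : 'I_n => (a 0 j * a 0 k) * (f (t j) w * f (t k) w)))/=.
  rewrite expr2 {1}/comb mulr_suml; apply: eq_bigr => j _.
  by rewrite mulr_sumr; apply: eq_bigr => k _; ring.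
under eq_Rintegral do rewrite E.
rewrite (@Rintegral_linear _ _ _ P setT _ _ (fun p : 'I_n * 'I_n => a 0 p.1 * a 0 p.2)
  (fun p w => f (t p.1) w * f (t p.2) w))//; last by move=> p; exact: gsp_product_integrable.
rewrite covE pair_bigA /=; apply: eq_bigr => p _.
by rewrite mxE gsp_covariance.
Qed.

End GSPCovariance.

(** * Averages of small variance *)

Section Wave.
Variables (R : realType) (T : time).
Local Notation V := (time_domain R T).
Implicit Types (s : seq V) (x : R).

Lemma to_real0 : to_real (0 : V) = 0.
Proof. by rewrite -(subrr (0 : V)) to_realB subrr. Qed.

Lemma to_realD (u v : V) : to_real (u + v) = to_real u + to_real v.
Proof. by rewrite -{1}(opprK v) to_realB -(sub0r v) to_realB to_real0 sub0r opprK. Qed.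

Lemma to_realMn (u : V) i : to_real (u *+ i) = to_real u *+ i.
Proof. by elim: i => [|i IH]; rewrite ?mulr0n ?to_real0// !mulrS to_realD IH. Qed.

(* The squared modulus of [\sum_(v <- s) e^(i x v)]. *)
Definition wave s x :=
  (\sum_(v <- s) cos (x * to_real v)) ^+ 2 + (\sum_(v <- s) sin (x * to_real v)) ^+ 2.

Lemma wave_ge0 s x : 0 <= wave s x.
Proof. by rewrite addr_ge0 ?sqr_ge0. Qed.

Lemma wave_add s1 s2 x : wave [seq u + v | u <- s1, v <- s2] x = wave s1 x * wave s2 x.
Proof.
have E (F : V -> R) : \sum_(w <- [seq u + v | u <- s1, v <- s2]) F w =
    \sum_(u <- s1) \sum_(v <- s2) F (u + v).
  by rewrite big_flatten big_map; apply: eq_bigr => u _; rewrite big_map.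
rewrite /wave !E.
have -> : \sum_(i <- s1) \sum_(j <- s2) cos (x * to_real (i + j)) =
    (\sum_(v <- s1) cos (x * to_real v)) * (\sum_(v <- s2) cos (x * to_real v)) -
    (\sum_(v <- s1) sin (x * to_real v)) * (\sum_(v <- s2) sin (x * to_real v)).
  rewrite !mulr_suml -sumrB; apply: eq_bigr => i _.
  rewrite !mulr_sumr -sumrB; apply: eq_bigr => j _.
  by rewrite to_realD mulrDr cosD.
have -> : \sum_(i <- s1) \sum_(j <- s2) sin (x * to_real (i + j)) =
    (\sum_(v <- s1) sin (x * to_real v)) * (\sum_(v <- s2) cos (x * to_real v)) +
    (\sum_(v <- s1) cos (x * to_real v)) * (\sum_(v <- s2) sin (x * to_real v)).
  rewrite !mulr_suml -big_split; apply: eq_bigr => i _.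
  rewrite !mulr_sumr -big_split; apply: eq_bigr => j _ /=.
  by rewrite to_realD mulrDr sinD.
by ring.
Qed.

Lemma wave_le s x : wave s x <= (size s)%:R ^+ 2.
Proof.
have -> : wave s x = \sum_(u <- s) \sum_(v <- s) cos (x * to_real u - x * to_real v).
  rewrite /wave !expr2 !mulr_suml -big_split; apply: eq_bigr => u _.
  by rewrite !mulr_sumr -big_split; apply: eq_bigr => v _; rewrite /= cosB.
have -> : (size s)%:R ^+ 2 = \sum_(u <- s) \sum_(v <- s) (1 : R).
  have E (c : R) : \sum_(u <- s) c = (size s)%:R * c.
    elim: s => [|u s IH]; first by rewrite big_nil mul0r.
    by rewrite big_cons IH /= -[(size s).+1%:R]natr1; ring.
  by rewrite !E mulr1 expr2.
by apply: ler_sum => u _; apply: ler_sum => v _; exact: cos_le1.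
Qed.

(** Sums are kept with multiplicity: averaging over the list is then a k-fold convolution of uniform
    averages, and its transform is an exact k-th power. *)
Fixpoint sumset s k := if k is k'.+1 then [seq u + v | u <- s, v <- sumset s k'] else [:: 0].

Lemma wave_sumset s k x : wave (sumset s k) x = wave s x ^+ k.
Proof.
elim: k => [|k IH]; last by rewrite /= wave_add IH exprS.
by rewrite /wave /= !big_seq1 to_real0 mulr0 cos0 sin0 !expr2 mulr0 mulr1 addr0.
Qed.

Lemma size_sumset s k : size (sumset s k) = (size s ^ k)%N.
Proof. by elim: k => //= k IH; rewrite size_allpairs IH expnS. Qed.

Lemma sumset_bounds s k b : {in s, forall u, 0 <= to_real u <= b} ->
  {in sumset s k, forall u, 0 <= to_real u <= k%:R * b}.
Proof.
move=> hs; elim: k => [|k IH] u.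
  by rewrite inE => /eqP->; rewrite to_real0 mul0r lexx.
move=> /allpairsP[[v w] [/hs /= vb /IH wb ->]].
by rewrite to_realD -natr1 mulrDl mul1r; move/andP: vb => [? ?]; move/andP: wb => [? ?]; lra.
Qed.

Definition grid (e : V) m := [seq e *+ i | i <- iota 0 m].

Lemma size_grid e m : size (grid e m) = m.
Proof. by rewrite size_map size_iota. Qed.

Lemma grid_bounds (e : V) m : 0 <= to_real e -> {in grid e m, forall u, 0 <= to_real u <= m%:R * to_real e}.
Proof.
move=> e0 u /mapP[i]; rewrite mem_iota add0n => /andP[_ im] ->.
by rewrite to_realMn -[to_real e *+ i]mulr_natl mulr_ge0//= ler_wpM2r// ler_nat ltnW.
Qed.

(** The geometric sum behind the Fejer kernel: 2 - 2 cos th is |1 - e^(i th)|^2. The real and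
    imaginary parts of (1 - e^(-i th)) times the sum are telescoped separately, and stating the
    result as a product avoids division by 0. *)
Lemma wave_grid e m x :
  wave (grid e m) x * (2 - 2 * cos (x * to_real e)) = 2 - 2 * cos (m%:R * (x * to_real e)).
Proof.
set th := x * to_real e.
have E (F : R -> R) : \sum_(v <- grid e m) F (x * to_real v) = \sum_(i < m) F (i%:R * th).
  rewrite big_map -[m in iota 0 m]subn0 big_mkord; apply: eq_bigr => i _.
  by rewrite to_realMn -[to_real e *+ i]mulr_natl /th; congr F; ring.
rewrite /wave !E.
set C := \sum_(i < m) _; set S := \sum_(i < m) _.
have [e1 e2] : (1 - cos th) * C + sin th * S = 1 - cos (m%:R * th) /\
    (1 - cos th) * S - sin th * C = - sin (m%:R * th).
  rewrite /C /S; elim: m {E C S} => [|m [h1 h2]].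
    by rewrite !big_ord0 mul0r cos0 sin0 !mulr0; split; ring.
  rewrite !big_ord_recr /= (_ : m.+1%:R * th = m%:R * th + th) ?cosD ?sinD; last first.
    by rewrite -[m.+1%:R]natr1; ring.
  set C := \sum_(i < m) _ in h1 h2 *; set S := \sum_(i < m) _ in h1 h2 *.
  split.
    transitivity (((1 - cos th) * C + sin th * S) + (1 - cos th) * cos (m%:R * th) + sin th * sin (m%:R * th)); first by ring.
    by rewrite h1; ring.
  transitivity (((1 - cos th) * S - sin th * C) + (1 - cos th) * sin (m%:R * th) - sin th * cos (m%:R * th)); first by ring.
  by rewrite h2; ring.
have p1 := cos2Dsin2 th; have p2 := cos2Dsin2 (m%:R * th).
have -> : 2 - 2 * cos th = (1 - cos th) ^+ 2 + sin th ^+ 2.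
  by rewrite -[X in X - 2 * _](_ : 1 + (cos th ^+ 2 + sin th ^+ 2) = 2); [ring|rewrite p1; ring].
have -> : 2 - 2 * cos (m%:R * th) = (1 - cos (m%:R * th)) ^+ 2 + (- sin (m%:R * th)) ^+ 2.
  by rewrite -[X in X - 2 * _](_ : 1 + (cos (m%:R * th) ^+ 2 + sin (m%:R * th) ^+ 2) = 2); [ring|rewrite p2; ring].
by rewrite -e1 -e2; ring.
Qed.

Lemma measurable_wave (s : seq V) : measurable_fun setT (wave s : measurableTypeR R -> R).
Proof.
apply: measurable_funD; apply: measurable_funX; apply: measurable_sum => v.
  exact: measurable_cosM.
apply: measurableT_comp; first by apply: continuous_measurable_fun; exact: continuous_sin.
exact: measurable_funM.
Qed.

End Wave.

Section Average.
Variables (R : realType) (T : time) (d : measure_display) (Om : measurableType d).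
Variables (P : probability Om R) (f : time_domain R T -> {RV P >-> R}).
Variable rho : {finite_measure set (measurableTypeR R) -> \bar R}.
Hypothesis f_GSP : is_GSP f.
Hypothesis rho_spec : is_spectral_measure f rho.
Local Notation gamma := (normal_prob (0 : R) 1).
Local Notation D := (freq_domain R T : set (measurableTypeR R)).

Lemma average_law (s : seq (time_domain R T)) : exists2 v : R,
  v = \int[rho]_(x in D) (wave s x / (size s)%:R ^+ 2) &
  forall A : set (measurableTypeR R), measurable A ->
  P [set w | A ((\sum_(t <- s) f t w) / (size s)%:R)] = gamma [set z | A (Num.sqrt v * z)].
Proof.
pose n := size s; pose a : 'rV[R]_n := const_mx n%:R^-1.
have S (F : time_domain R T -> R) : \sum_(t <- s) F t = \sum_(j < n) F (nth 0 s j).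
  by rewrite (big_nth 0) big_mkord.
exists (\int[rho]_(x in D) (wave s x / n%:R ^+ 2)) => // A mA.
have -> : \int[rho]_(x in D) (wave s x / n%:R ^+ 2) =
    cov (gram rho D (fun j : 'I_n => to_real (nth 0 s j))) a a.
  rewrite cov_gram; [|exact: measurable_freq_domain|exact: finite_freq_domain].
  apply: eq_Rintegral => x _; rewrite /trig_sqr /wave !S.
  have E (F : 'I_n -> R) : \sum_j a 0 j * F j = n%:R^-1 * \sum_j F j.
    by rewrite mulr_sumr; apply: eq_bigr => j _; rewrite mxE.
  by rewrite !E -exprVn; ring.
rewrite -(gsp_law f_GSP rho_spec (nth 0 s) a mA); congr (P _).
have E w : (\sum_(t <- s) f t w) / (size s)%:R = comb (fun j => f (nth 0 s j)) a w.
  by rewrite S mulr_suml; apply: eq_bigr => j _; rewrite mxE mulrC.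
by apply/seteqP; split=> w; rewrite /= E.
Qed.

End Average.

Section Kernel.
Variables (R : realType) (T : time).
Local Notation V := (time_domain R T).

(** A quarter of the angle is at most pi / 4 < 1, where [sin_ge_half] applies; two duplications of
    the angle recover the cosine. *)
Lemma one_sub_cos_ge (th : R) : `|th| <= pi -> th ^+ 2 / 16 <= 2 - 2 * cos th.
Proof.
move=> thpi; pose y := `|th| / 4.
have p2 := pihalf_lt2 R; have y0 : 0 <= `|th| by exact: normr_ge0.
have s1 : y / 2 <= sin y by apply: sin_ge_half; rewrite /y; lra.
have e1 : cos th = cos (y *+ 2 *+ 2).
  have -> : y *+ 2 *+ 2 = `|th| by rewrite /y; field.
  by case: (ler0P th) => _ //; rewrite cosN.
have c2 : 0 <= cos (y *+ 2) by apply: cos_ge0_pihalf; rewrite /y; lra.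
have e2 : cos (y *+ 2) = 1 - 2 * sin y ^+ 2 by rewrite cos_mulr2n cos2sin2; ring.
have e3 : 2 - 2 * cos th = 16 * sin y ^+ 2 * (1 - sin y ^+ 2).
  by rewrite e1 cos_mulr2n e2; ring.
have -> : th ^+ 2 / 16 = y ^+ 2 by rewrite /y -(real_normK (num_real th)); field.
rewrite e3; set S := sin y in s1 e2 *.
have y0' : 0 <= y by rewrite /y; lra.
have h : (y / 2) ^+ 2 <= S ^+ 2 by rewrite ler_pXn2r// nnegrE; lra.
nra.
Qed.

Lemma wave_grid_le (e : V) m x : `|x * to_real e| <= pi ->
  wave (grid e m) x * (x * to_real e) ^+ 2 <= 64.
Proof.
move=> /one_sub_cos_ge h; have w0 := wave_ge0 (grid e m) x; have E := wave_grid e m x.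
have c1 := cos_geN1 (m%:R * (x * to_real e)).
have : wave (grid e m) x * ((x * to_real e) ^+ 2 / 16) <= 4.
  by apply: (le_trans (ler_wpM2l w0 h)); rewrite E; lra.
by rewrite mulrA ler_pdivrMr//; lra.
Qed.

(** From w <= min(1, y^2) every power of y up to 2k is available. A single kernel thus serves
    fractional moments as well as even ones. *)
Lemma expr_le_powR (w y p : R) k : 0 <= w <= 1 -> 0 < y -> w <= y ^+ 2 ->
  0 <= p <= 2 * k%:R -> w ^+ k <= y `^ p.
Proof.
move=> /andP[w0 w1] y0 wy /andP[p0 pk]; have [y1|y1] := lerP y 1.
  apply: (@le_trans _ _ (y `^ (2 * k%:R))).
    rewrite powRrM powR_mulrn ?powR_ge0// powR_mulrn; last exact: ltW.
    by rewrite lerXn2r// nnegrE// sqr_ge0.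
  by apply: ger_powR => //; rewrite y0.
apply: (@le_trans _ _ 1); first by rewrite exprn_ile1.
by rewrite -(powRr0 y); apply: ler_powR => //; exact: ltW.
Qed.

Lemma sumset_grid_le (e : V) m k (p x : R) : (0 < m)%N -> 0 < to_real e ->
  0 <= p <= 2 * k%:R -> `|x * to_real e| <= pi ->
  ((wave (sumset (grid e m) k) x / (size (sumset (grid e m) k))%:R ^+ 2)%:E <=
   ((8 / (m%:R * to_real e)) `^ p)%:E * abs_pow (- p) x)%E.
Proof.
move=> m0 e0 pk xe; have m0' : 0 < m%:R :> R by rewrite ltr0n.
have b0 : 0 < 8 / (m%:R * to_real e) by rewrite divr_gt0// mulr_gt0.
set b := 8 / _ in b0 *.
rewrite size_sumset size_grid wave_sumset natrX exprAC -expr_div_n.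
set w := _ / _.
have w0 : 0 <= w by rewrite divr_ge0 ?wave_ge0// sqr_ge0.
have w1 : w <= 1.
  by rewrite ler_pdivrMr ?exprn_gt0// mul1r; have := wave_le (grid e m) x; rewrite size_grid.
have [p0 _] := andP pk.
rewrite /abs_pow oppr_lt0; case: (eqVneq x 0) => [x0|x0] /=; last first.
  have x0' : 0 < `|x| by rewrite normr_gt0.
  rewrite -EFinM lee_fin powRN mulrC.
  have -> : (`|x| `^ p)^-1 * b `^ p = (b / `|x|) `^ p.
    rewrite [LHS]mulrC [RHS]powRM ?invr_ge0 ?(ltW b0)//; congr (_ * _).
    by rewrite -[`|x|^-1]powR_inv1// -powRrM mulN1r powRN.
  apply: expr_le_powR; rewrite ?w0//; first exact: divr_gt0.
  have := wave_grid_le m xe; rewrite exprMn => h.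
  rewrite expr_div_n (real_normK (num_real x)) /w ler_pdivrMr ?exprn_gt0//.
  have -> : b ^+ 2 / x ^+ 2 * m%:R ^+ 2 = 64 / (x ^+ 2 * to_real e ^+ 2).
    by rewrite /b; field; rewrite x0 !gt_eqF.
  have x20 : 0 < x ^+ 2 by rewrite exprn_even_gt0.
  by rewrite ler_pdivlMr//; apply: mulr_gt0 => //; exact: exprn_gt0.
(* At x = 0 the right-hand side is infinite when p > 0, and for p = 0 it equals 1, which bounds any
   normalised wave. *)
have [p00|p00] := ltrP 0 p; first by rewrite gt0_muley ?leey// lte_fin powR_gt0.
have -> : p = 0 by apply/eqP; rewrite eq_le p00.
by rewrite oppr0 !powRr0 mule1 lee_fin exprn_ile1.
Qed.

End Kernel.

Section Moment.
Variables (R : realType) (T : time) (rho : {finite_measure set (measurableTypeR R) -> \bar R}).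
Local Notation V := (time_domain R T).
Local Notation D := (freq_domain R T : set (measurableTypeR R)).

Lemma measurable_abs_pow (p : R) : measurable_fun setT (abs_pow p : measurableTypeR R -> \bar R).
Proof.
apply: measurable_fun_ifT => //.
  apply: measurable_and => //; apply: measurable_fun_eqr => //.
apply/measurable_EFinP; apply: (measurableT_comp (measurable_powR p)).
exact: normr_measurable.
Qed.

Lemma abs_pow_ge0 (p x : R) : (0 <= abs_pow p x)%E.
Proof. by rewrite /abs_pow; case: ifP => _; rewrite ?leey// lee_fin powR_ge0. Qed.

Lemma abs_pow_neq0 (p x : R) : p <= 0 -> abs_pow p x != 0%E.
Proof.
move=> p0; rewrite /abs_pow; have [->|x0] /= := eqVneq x 0; last first.
  by rewrite eqe gt_eqF// powR_gt0// normr_gt0.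
case: ltrP => // p0'; have -> : p = 0 by apply/eqP; rewrite eq_le p0.
by rewrite powRr0 eqe oner_eq0.
Qed.

Lemma moment_gt0 (p : R) : rho D = 1%E -> p <= 0 -> (0 < moment T rho p)%E.
Proof.
move=> rD p0; have mD := @measurable_freq_domain R T.
rewrite lt0e; apply/andP; split; last by apply: integral_ge0 => x _; exact: abs_pow_ge0.
apply/eqP => h.
have mp : measurable_fun D (abs_pow p : measurableTypeR R -> \bar R).
  by apply: measurable_funTS; exact: measurable_abs_pow.
have : (\int[rho]_(x in D) `|abs_pow p x| = 0)%E.
  by rewrite -h; apply: eq_integral => x _; rewrite gee0_abs// abs_pow_ge0.
move=> /(ae_eq_integral_abs rho mD mp) [N [mN N0 DN]].
have : (rho D <= rho N)%E.
  apply: le_measure; rewrite ?inE// => x Dx; apply: DN => /= /(_ Dx) /eqP.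
  by rewrite (negbTE (abs_pow_neq0 x p0)).
by rewrite rD N0 lee_fin ler10.
Qed.

(** Frequencies with |x e| > pi are aliased by a grid of step e, and the Fejer bound fails for them.
    For T = Z step 1 creates none; for T = R a small step leaves arbitrarily little mass there. The
    step may depend on [rho], since later bounds involve the grid only through its total length. *)
Lemma exists_step (dl : R) : 0 < dl -> exists2 e : V, 0 < to_real e <= 1 &
  (rho (D `&` [set x | (pi < `|x * to_real e|)%R]) <= dl%:E)%E.
Proof.
move=> dl0; case: T => /=.
  exists (1 : int); first by rewrite /= ltr01 lexx.
  rewrite (_ : _ `&` _ = set0) ?measure0 ?lee_fin ?ltW//.
  apply/seteqP; split=> x //=; rewrite in_itv/= mulr1 => -[/andP[h1 h2]].
  by rewrite ltNge ler_norml h1 h2.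
pose F n : set (measurableTypeR R) := [set x | pi < `|x * n.+1%:R^-1|].
have mF n : measurable (F n).
  rewrite -[F n]setTI.
  have mf : measurable_fun setT (fun x : measurableTypeR R => `|x * n.+1%:R^-1|).
    by apply: measurableT_comp => //; exact: measurable_funM.
  have := @measurable_fun_ltr _ _ _ setT (cst pi) _ (measurable_cst _) mf.
  by move=> /(_ measurableT [set true]) h; apply: h.
have F0 : \bigcap_n F n = set0.
  apply/seteqP; split=> x //= /(_ (Num.truncn `|x|) I); rewrite /F/=.
  rewrite normrM normfV normr_nat ltr_pdivlMr// => h.
  have := truncnS_gt `|x|; have := pi_ge2 R.
  have : 0 <= (Num.truncn `|x|).+1%:R :> R by [].
  by move: h; set m := _.+1%:R; nra.
have cv : rho \o F @ \oo --> rho (\bigcap_n F n).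
  apply: nonincreasing_cvg_mu => //.
  - by rewrite -ge0_fin_numE// fin_num_measure.
  - by rewrite F0.
  - move=> n m nm; apply/subsetPset => x; rewrite /F/= => /lt_le_trans; apply.
    rewrite !normrM ler_wpM2l// !normfV !normr_nat lef_pV2 ?posrE//.
    by rewrite ler_nat.
rewrite F0 measure0 in cv.
have [n _ /(_ n (leqnn n))/= hn] := cv _ (@nbhs_open_ereal_lt _ 0 (fun=> dl) dl0).
exists (n.+1%:R^-1); last by rewrite setTI; exact: ltW.
by rewrite invr_gt0 ltr0n/= invf_le1// ler1n.
Qed.

Lemma integral_sumset_grid_le (e : V) m k (p : R) : (0 < m)%N -> 0 < to_real e ->
  0 <= p <= 2 * k%:R ->
  (\int[rho]_(x in D) (wave (sumset (grid e m) k) x / (size (sumset (grid e m) k))%:R ^+ 2)%:E <=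
   ((8 / (m%:R * to_real e)) `^ p)%:E * moment T rho (- p) +
   rho (D `&` [set x | (pi < `|x * to_real e|)%R]))%E.
Proof.
move=> m0 e0 pk; have mD := @measurable_freq_domain R T.
set s := sumset _ _.
pose A : set (measurableTypeR R) := [set x | (pi < `|x * to_real e|)%R].
have mA : measurable A.
  rewrite -[A]setTI.
  have mf : measurable_fun setT (fun x : measurableTypeR R => `|x * to_real e|).
    by apply: measurableT_comp => //; exact: measurable_funM.
  have := @measurable_fun_ltr _ _ _ setT (cst pi) _ (measurable_cst _) mf.
  by move=> /(_ measurableT [set true]) h; apply: h.
have mpow : measurable_fun D (fun x : measurableTypeR R =>
    (((8 / (m%:R * to_real e)) `^ p)%:E * abs_pow (- p) x)%E).
  by apply: measurable_funTS; apply: emeasurable_funM => //; exact: measurable_abs_pow.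
have mind : measurable_fun D (fun x : measurableTypeR R => (\1_A x)%:E : \bar R).
  by apply: measurable_funTS; apply/measurable_EFinP; exact: measurable_indic.
have pw0 x : (0 <= ((8 / (m%:R * to_real e)) `^ p)%:E * abs_pow (- p) x)%E.
  by rewrite mule_ge0 ?abs_pow_ge0// lee_fin powR_ge0.
have -> : rho (D `&` [set x | (pi < `|x * to_real e|)%R]) = (\int[rho]_(x in D) (\1_A x)%:E)%E.
  by rewrite integral_indic// setIC.
rewrite /moment -ge0_integralZl//; last 3 first.
- by apply: measurable_funTS; exact: measurable_abs_pow.
- by move=> x _; exact: abs_pow_ge0.
- by rewrite lee_fin powR_ge0.
rewrite -ge0_integralD//.
apply: ge0_le_integral => //.
- by move=> x _; rewrite lee_fin divr_ge0 ?wave_ge0// sqr_ge0.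
- apply: measurable_funTS; apply/measurable_EFinP.
  by apply: measurable_funM => //; exact: measurable_wave.
- exact: emeasurable_funD.
move=> x _; have [xA|xA] := pselect (A x).
  apply: (@le_trans _ _ 1%E); last by rewrite indicE mem_set// leeDr.
  have [s0|s0] := posnP (size s); first by rewrite s0 expr0n invr0 mulr0 lee_fin.
  by rewrite lee_fin ler_pdivrMr ?exprn_gt0 ?ltr0n// mul1r wave_le.
rewrite indicE memNset// adde0; apply: sumset_grid_le => //.
by rewrite leNgt; apply/negP.
Qed.

Lemma small_average (N p : R) k : (0 < k)%N -> 2 * k%:R <= N -> 0 <= p <= 2 * k%:R ->
  rho D = 1%E -> (moment T rho (- p) < +oo)%E ->
  exists s : seq V, [/\ (0 < size s)%N,
    {in s, forall u, 0 <= to_real u <= N / 2} &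
    \int[rho]_(x in D) (wave s x / (size s)%:R ^+ 2) <=
      2 * ((32 * k%:R) `^ p * N `^ (- p) * fine (moment T rho (- p)))].
Proof.
move=> k0 kN pk rD Mfin; have [p0 _] := andP pk.
have M0 : (0 < moment T rho (- p))%E by apply: moment_gt0; rewrite ?oppr_le0.
have k0' : 0 < k%:R :> R by rewrite ltr0n.
have N0 : 0 < N by apply: lt_le_trans kN; rewrite mulr_gt0.
have Mf : moment T rho (- p) = (fine (moment T rho (- p)))%:E.
  by rewrite fineK// ge0_fin_numE// ltW.
set M := fine _ in Mf *.
have M0' : 0 < M by rewrite -lte_fin -Mf.
pose B := (32 * k%:R) `^ p * N `^ (- p) * M.
have B0 : 0 < B by rewrite !mulr_gt0// powR_gt0// mulr_gt0.
(* The aliased frequencies are granted as much mass as the main term, whence the factor 2 in the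
   conclusion. *)
have [e /andP[e0 e1] etail] := exists_step B0.
(* With x0 steps the k-fold sumset would span N / 2. Since x0 >= 1, truncation at most halves it, so
   the grid length is at least N / (4 k), and 8 / (m e) <= 32 k / N. *)
pose x0 := N / (2 * k%:R * to_real e).
have ke0 : 0 < 2 * k%:R * to_real e by rewrite !mulr_gt0.
have x01 : 1 <= x0.
  by rewrite ler_pdivlMr// mul1r; apply: le_trans kN; rewrite ler_piMr// mulr_ge0// ltW.
have [mx xm] : (Num.truncn x0)%:R <= x0 /\ x0 < (Num.truncn x0).+1%:R.
  by have /andP[] := truncn_itv (le_trans ler01 x01).
have m0 : (0 < Num.truncn x0)%N by rewrite truncn_gt0.
move: (Num.truncn x0) mx xm m0 => m mx xm m0.
have m1 : 1 <= m%:R :> R by rewrite ler1n.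
have xm2 : x0 <= 2 * m%:R by move: xm; rewrite -natr1; lra.
have me : N / (4 * k%:R) <= m%:R * to_real e.
  have -> : N / (4 * k%:R) = x0 / 2 * to_real e by rewrite /x0; field; rewrite !gt_eqF.
  by rewrite ler_wpM2r// ?ltW//; lra.
exists (sumset (grid e m) k); split.
- by rewrite size_sumset size_grid expn_gt0 m0.
- move=> u /(sumset_bounds (grid_bounds (ltW e0))) /andP[-> h]; apply: le_trans h _.
  have -> : N / 2 = k%:R * (x0 * to_real e) by rewrite /x0; field; rewrite !gt_eqF.
  by rewrite (ler_pM2l k0') (ler_pM2r e0).
rewrite -lee_fin.
have h := integral_sumset_grid_le m0 e0 pk.
set s := sumset _ _ in h *.
have hb : (8 / (m%:R * to_real e)) `^ p * M <= B.
  rewrite /B (ler_pM2r M0').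
  have -> : (32 * k%:R) `^ p * N `^ (- p) = (32 * k%:R / N) `^ p.
    rewrite [RHS]powRM ?invr_ge0 ?(ltW N0)//; congr (_ * _).
    by rewrite -[N^-1]powR_inv1 ?(ltW N0)// -powRrM mulN1r.
  have me0 : 0 < m%:R * to_real e by rewrite mulr_gt0// ltr0n.
  apply: ge0_ler_powR => //; rewrite ?nnegrE ?divr_ge0 ?(ltW me0) ?(ltW N0) ?mulr_ge0//.
  rewrite ler_pdivrMr// mulrAC ler_pdivlMr//.
  by move: me; rewrite ler_pdivrMr ?mulr_gt0//; lra.
have hB : (\int[rho]_(x in D) (wave s x / (size s)%:R ^+ 2)%:E <= (2 * B)%:E)%E.
  apply: (le_trans h); rewrite Mf.
  have -> : 2 * B = B + B by ring.
  by rewrite EFinD; apply: leeD => //; rewrite -EFinM lee_fin.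
rewrite /Rintegral fineK//; rewrite ge0_fin_numE.
  by apply: le_lt_trans hB _; rewrite ltry.
by apply: integral_ge0 => x _; rewrite lee_fin divr_ge0 ?wave_ge0// sqr_ge0.
Qed.

End Moment.

(** * Persistence *)

Section Selection.
Variables (R : realType) (T : time) (d : measure_display) (Om : measurableType d).
Variables (P : probability Om R) (f : time_domain R T -> {RV P >-> R}).
Variable rho : {finite_measure set (measurableTypeR R) -> \bar R}.
Hypothesis f_GSP : is_GSP f.
Hypothesis rho_spec : is_spectral_measure f rho.
Local Notation V := (time_domain R T).
Local Notation D := (freq_domain R T : set (measurableTypeR R)).
Local Notation leb_mu := (@lebesgue_measure R).

Variables (A : set (measurableTypeR R)) (nu e q : R) (u : nat -> V).
Hypotheses (nu_gt0 : 0 < nu) (e_gt0 : 0 < e) (q_gt0 : 0 < q).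
Hypotheses (mA : measurable A) (AD : A `<=` D) (A_itv : A `<=` `[- (pi * q), pi * q]%classic).
Hypothesis leb_A : leb_mu A = e%:E.
Hypothesis density_ge : forall B, measurable B -> B `<=` A -> (nu%:E * leb_mu B <= rho B)%E.
Hypothesis u_lattice : forall l, to_real (u l) = l.+1%:R / q.

Let finA : (leb_mu A < +oo)%E. Proof. by rewrite leb_A ltry. Qed.
Let mD : measurable D. Proof. exact: measurable_freq_domain. Qed.
Let finD : (rho D < +oo)%E. Proof. exact: finite_freq_domain. Qed.

Lemma gram_density n (tau : 'I_n -> R) a :
  nu * cov (gram leb_mu A tau) a a <= cov (gram rho D tau) a a.
Proof.
rewrite !cov_gram//.
have iA := integrable_trig_sqr mA finA tau a; have iD := integrable_trig_sqr mD finD tau a.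
have -> : nu * \int[leb_mu]_(x in A) trig_sqr tau a x =
    fine (nu%:E * \int[leb_mu]_(x in A) (trig_sqr tau a x)%:E)%E.
  by rewrite fineM//; exact: integrable_fin_num.
rewrite /Rintegral; apply: fine_le.
- by rewrite fin_numM//; exact: integrable_fin_num.
- exact: integrable_fin_num.
apply: (@le_integral_density _ rho nu A D) => //; first exact: ltW.
  by apply/measurable_EFinP; exact: measurable_trig_sqr.
by move=> x; rewrite lee_fin trig_sqr_ge0.
Qed.

Lemma gram_select n M (tau : 'I_M -> R) (g : 'I_n -> 'I_M) (a : 'rV[R]_n) :
  cov (gram leb_mu A (tau \o g)) a a =
  cov (gram leb_mu A tau) (a *m \matrix_(j, l) (g j == l)%:R) (a *m \matrix_(j, l) (g j == l)%:R).
Proof.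
rewrite !cov_gram//; apply: eq_Rintegral => x _.
have E (F : 'I_M -> R) : \sum_l (a *m \matrix_(j, l) (g j == l)%:R) 0 l * F l =
    \sum_j a 0 j * F (g j).
  under eq_bigr do rewrite mxE mulr_suml.
  rewrite exchange_big; apply: eq_bigr => j _ /=.
  rewrite (bigD1 (g j))//= mxE eqxx mulr1 big1 ?addr0// => l lj.
  by rewrite mxE eq_sym (negbTE lj) mulr0 mul0r.
by rewrite /trig_sqr !E.
Qed.

(** The greedy choice is made for the Lebesgue Gram matrix on [A]; the separation e / 2 then becomes
    nu e / 2 for [rho] by [gram_density]. Covariances depend on differences of times only, so one
    [J] serves every translate [t]. *)
Lemma lattice_selection n M : (0 < M)%N ->
  (forall m, (m < n)%N -> m%:R * (2 * pi * q) <= M%:R * (e / 2)) ->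
  exists2 J : nat -> V, (forall j, exists2 l, (l < M)%N & J j = u l) &
  forall (t : V) (L : R), 0 < L ->
  fine (P [set w | (forall i : 'I_n, 0 < f (t + J i) w) /\
                   \sum_(i < n) f (t + J i) w <= n%:R * L]) <=
  normal_ball (64 * L / Num.sqrt (nu * e / 2)) `^ (n%:R / 64).
Proof.
move=> M0 hn; have p0 := pi_gt0 R.
pose tau (l : 'I_M) := to_real (u l).
pose G := gram leb_mu A tau.
have [| | |s sn ws] := @greedy_selection R M G e (2 * pi * q) (gram_sym _ _ _)
    (cov_gram_ge0 mA finA _) e_gt0 _ _ _ n hn M0.
- by rewrite !mulr_ge0// ltW.
- by move=> j; exact: (etrans (cov_gram_delta mA finA tau j) (congr1 fine leb_A)).
- move=> a; apply: (@cov_gram_lattice_le _ q _ _ (fun l : 'I_M => l.+1)) => //.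
  + by move=> l l' [] /val_inj.
  + by move=> l; exact: u_lattice.
pose g j := nth (Ordinal M0) s j.
exists (fun j => u (g j)) => [j|t L L0]; first by exists (g j).
pose S := gram rho D (fun j : 'I_n => to_real (u (g j))).
have sigma0 : 0 < nu * e / 2 by rewrite divr_gt0// mulr_gt0.
have law a B : measurable B -> P (comb (fun j => f (t + u (g j))) a @^-1` B) =
    normal_prob 0 1 [set z | B (Num.sqrt (cov S a a) * z)].
  move=> mB; rewrite (gsp_law f_GSP rho_spec (fun j => t + u (g j)) a mB).
  suff -> : gram rho D (fun j : 'I_n => to_real (t + u (g j))) = S by [].
  apply/matrixP => j k; rewrite !mxE; apply: eq_Rintegral => x _.
  by rewrite !to_realD; congr (cos (x * _)); ring.
apply: (positive_orthant_bound _ (gram_sym _ _ _) (cov_gram_ge0 mD finD _) law) => //.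
- by rewrite sqrtr_gt0.
rewrite sqr_sqrtr ?ltW//.
apply: orthogonal_residual => //; first exact: gram_sym.
move=> i a ba; apply: le_trans (gram_density _ _).
have -> : (fun j : 'I_n => to_real (u (g j))) = tau \o (fun j : 'I_n => g j) by [].
rewrite gram_select -mulrA ler_pM2l// mulmxBl.
have -> : delta_mx 0 i *m \matrix_(j < n, l < M) (g j == l)%:R = delta_mx 0 (g i) :> 'rV[R]_M.
  by rewrite -rowE; apply/rowP => l; rewrite !mxE eq_sym.
apply: ws; first by rewrite sn.
move=> l ls; rewrite mxE big1// => j _; rewrite mxE.
case: eqP => [gl|_]; last by rewrite mulr0.
rewrite ba ?mul0r// leqNgt; apply: contra ls => ji.
(* An index outside the first i selected ones cannot be [g j] with j < i, so only the coordinates of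
   [a] that vanish could contribute to it. *)
rewrite -gl /g -(nth_take (Ordinal M0) ji) mem_nth// size_take sn ltn_ord//.
Qed.

End Selection.

Section Markov.
Variables (R : realType) (d : measure_display) (Om : measurableType d) (P : probability Om R).

Lemma Rintegral_indic_prob (A : set Om) : measurable A -> \int[P]_w \1_A w = fine (P A).
Proof. by move=> mA; rewrite /Rintegral integral_indic// setIT. Qed.

(* Averaged over [s], the probability of an event of which every point lies in
   at least half of the [B i] is at most twice the largest probability. *)
Lemma markov_average (I : eqType) (s : seq I) (B : I -> set Om) (F : set Om) (b : R) :
  (0 < size s)%N -> (forall i, measurable (B i)) -> measurable F ->
  (forall i, fine (P (B i)) <= b) ->
  (forall w, F w -> (size s)%:R <= 2 * \sum_(i <- s) \1_(B i) w :> R) ->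
  fine (P F) <= 2 * b.
Proof.
move=> s0 mB mF Bb hF; have g0 : 0 < (size s)%:R :> R by rewrite ltr0n.
have ii (A : set Om) : measurable A -> P.-integrable setT (EFin \o (\1_A : Om -> R)).
  move=> mA; apply: (@bounded_integrable _ _ _ P _ 1); first exact: measurable_indic.
  by move=> x; rewrite indicE; case: (x \in A) => /=; rewrite ?normr1 ?normr0 ?lexx ?ler01.
have isum : P.-integrable setT (EFin \o (fun w => \sum_(i <- s) (2 / (size s)%:R) * \1_(B i) w)).
  rewrite (_ : _ \o _ = (fun w => \sum_(i <- s) ((2 / (size s)%:R)%:E * (\1_(B i) w)%:E)%E)%E).
    apply: integrable_sum => // i _; apply: integrableZl => //; exact: ii.
  by apply/funext => w /=; rewrite -sumEFin.
rewrite -Rintegral_indic_prob//.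
apply: (@le_trans _ _ (\int[P]_w (\sum_(i <- s) (2 / (size s)%:R) * \1_(B i) w))).
  apply: le_Rintegral => //; first exact: ii.
  move=> w _; have S0 : 0 <= \sum_(i <- s) \1_(B i) w :> R.
    by apply: sumr_ge0 => i _; rewrite indicE.
  rewrite -mulr_sumr mulrAC ler_pdivlMr//; have [wF|wF] := pselect (F w).
    by rewrite indicE mem_set// mul1r hF.
  by rewrite indicE memNset// mul0r mulr_ge0.
rewrite Rintegral_linear//; last by move=> i; exact: ii.
rewrite -mulr_sumr mulrAC ler_pdivrMr// -mulrA ler_pM2l//.
apply: (@le_trans _ _ (\sum_(i <- s) b)).
  by apply: ler_sum => i _; rewrite Rintegral_indic_prob.
clear; rewrite le_eqVlt; apply/orP; left; apply/eqP.
elim: s => [|i s IH]; first by rewrite big_nil mulr0.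
by rewrite big_cons IH /= -[(size s).+1%:R]natr1; ring.
Qed.

End Markov.

Section OrthantAverage.
Variables (R : realType) (T : time) (d : measure_display) (Om : measurableType d).
Variables (P : probability Om R) (f : time_domain R T -> {RV P >-> R}).
Variable rho : {finite_measure set (measurableTypeR R) -> \bar R}.
Hypothesis f_GSP : is_GSP f.
Hypothesis rho_spec : is_spectral_measure f rho.
Local Notation V := (time_domain R T).
Local Notation D := (freq_domain R T : set (measurableTypeR R)).
Local Notation gamma := (normal_prob (0 : R) 1).

Lemma wave_mean_itv (s : seq V) x : 0 <= wave s x / (size s)%:R ^+ 2 <= 1.
Proof.
rewrite divr_ge0 ?wave_ge0 ?sqr_ge0//=.
have [s0|s0] := posnP (size s); first by rewrite s0 expr0n invr0 mulr0.
by rewrite ler_pdivrMr ?exprn_gt0 ?ltr0n// mul1r wave_le.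
Qed.

Lemma integrable_wave_mean (s : seq V) :
  rho.-integrable D (EFin \o (fun x => wave s x / (size s)%:R ^+ 2)).
Proof.
apply: (@bounded_integrable_on _ rho D (@measurable_freq_domain R T) (finite_freq_domain _ _) _ 1).
  by apply: measurable_funM => //; exact: measurable_wave.
by move=> x; have /andP[h0 h1] := wave_mean_itv s x; rewrite ger0_norm.
Qed.

(** Further averaging multiplies the spectral weight by a factor at most 1, so spreading the average
    over [J] does not increase its variance. *)
Lemma wave_mean_add_le (s1 s2 : seq V) :
  \int[rho]_(x in D) (wave [seq u + v | u <- s1, v <- s2] x /
    (size [seq u + v | u <- s1, v <- s2])%:R ^+ 2) <=
  \int[rho]_(x in D) (wave s1 x / (size s1)%:R ^+ 2).
Proof.
apply: le_Rintegral; [exact: measurable_freq_domain|exact: integrable_wave_mean|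
  exact: integrable_wave_mean|].
move=> x _; rewrite wave_add size_allpairs natrM exprMn.
have /andP[h0 h1] := wave_mean_itv s1 x; have /andP[g0 g1] := wave_mean_itv s2 x.
have -> : wave s1 x * wave s2 x / ((size s1)%:R ^+ 2 * (size s2)%:R ^+ 2) =
    wave s1 x / (size s1)%:R ^+ 2 * (wave s2 x / (size s2)%:R ^+ 2).
  by rewrite invfM; ring.
by rewrite ler_piMr.
Qed.

Lemma measurable_orthant (s : seq V) n (J : nat -> V) :
  measurable [set w | forall t, t \in s -> forall i : 'I_n, 0 < f (t + J i) w].
Proof.
set F := [set w | _].
rewrite (_ : F = \bigcap_(t in [set` s]) \bigcap_(i in [set: 'I_n]) [set w | 0 < f (t + J i) w]).
  apply: fin_bigcap_measurable => // t _.
  apply: fin_bigcap_measurable => // i _.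
  rewrite -[X in measurable X]setTI.
  have := @measurable_fun_ltr _ _ _ setT (cst 0) (f (t + J i)) (measurable_cst _) (measurable_funPT _).
  by move=> /(_ measurableT [set true]) h; apply: h.
apply/seteqP; split=> w h; first by move=> t ts i _; exact: h.
by move=> t ts i; exact: (h t ts i I).
Qed.

Lemma orthant_average_bound (s : seq V) n (J : nat -> V) (L tau0 b : R) :
  (0 < size s)%N -> (0 < n)%N -> 0 < L -> 0 <= tau0 ->
  \int[rho]_(x in D) (wave s x / (size s)%:R ^+ 2) <= tau0 ^+ 2 ->
  (forall t, fine (P [set w | (forall i : 'I_n, 0 < f (t + J i) w) /\
     \sum_(i < n) f (t + J i) w <= n%:R * (2 * L)]) <= b) ->
  fine (P [set w | forall t, t \in s -> forall i : 'I_n, 0 < f (t + J i) w]) <=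
  fine (gamma [set z | L < tau0 * z]) + 2 * b.
Proof.
move=> s0 n0 L0 tau00 hv hb.
have g0 : 0 < (size s)%:R :> R by rewrite ltr0n.
have n0' : 0 < n%:R :> R by rewrite ltr0n.
set F := [set w | _].
pose js := [seq J i | i <- iota 0 n].
pose sJ := [seq u + v | u <- s, v <- js].
pose Y w := (\sum_(t <- sJ) f t w) / (size sJ)%:R.
have mY : measurable_fun setT (Y : Om -> measurableTypeR R).
  by apply: measurable_funM => //; apply: measurable_sum => t.
have sumE w : \sum_(t <- sJ) f t w = \sum_(t <- s) \sum_(i < n) f (t + J i) w.
  rewrite /sJ big_flatten big_map; apply: eq_bigr => t _.
  by rewrite /js -map_comp big_map -[n in iota 0 n]subn0 big_mkord.
have szE : (size sJ)%:R = (size s)%:R * n%:R :> R.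
  by rewrite /sJ size_allpairs /js size_map size_iota natrM.
have [v vE lawY] := average_law f_GSP rho_spec sJ.
have vle : Num.sqrt v <= tau0.
  rewrite -[leRHS](ger0_norm tau00) -sqrtr_sqr ler_sqrt ?sqr_ge0// vE.
  by apply: le_trans hv; exact: wave_mean_add_le.
pose H : set Om := [set w | L < Y w].
have mitv : measurable ([set x : R | L < x] : set (measurableTypeR R)).
  have -> : [set x : R | L < x] = `]L, +oo[%classic; last exact: measurable_itv.
  by apply/seteqP; split=> x /=; rewrite in_itv/= andbT.
have mH : measurable H by have := mY measurableT _ mitv; rewrite setTI.
have mscaled c : measurable ([set z : R | L < c * z] : set (measurableTypeR R)).
  have mm : measurable_fun setT (fun z : measurableTypeR R => c * z : measurableTypeR R).
    exact: mulrl_measurable.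
  by have := mm measurableT _ mitv; rewrite setTI.
have PH : fine (P H) <= fine (gamma [set z | L < tau0 * z]).
  rewrite (lawY _ mitv); apply: fine_gamma_le => [||z /= h]; [exact: mscaled|exact: mscaled|].
  apply: (lt_le_trans h).
  have [z0|z0] := lerP 0 z; first exact: ler_wpM2r.
  have : Num.sqrt v * z <= 0 by rewrite mulr_ge0_le0 ?sqrtr_ge0// ltW.
  by move: h; lra.
pose B t : set Om := [set w | (forall i : 'I_n, 0 < f (t + J i) w) /\
  \sum_(i < n) f (t + J i) w <= n%:R * (2 * L)].
have mB t : measurable (B t).
  by apply: (@measurable_event R d Om n (fun i => f (t + J i))).
have mF : measurable F by exact: measurable_orthant.
have FH : fine (P (F `&` ~` H)) <= 2 * b.
  apply: (@markov_average _ _ _ P _ s B) => //.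
    by apply: measurableI => //; exact: measurableC.
  move=> w [Fw /negP]; rewrite -leNgt /Y sumE szE ler_pdivrMr ?mulr_gt0// => h.
  pose a t : R := \sum_(i < n) f (t + J i) w.
  (* On [F] all translates have nonnegative sums, and those outside [B t] exceed 2 L n. An overall
     mean at most L leaves room for at most half of the latter. *)
  have h2 : \sum_(t <- s) (2 * L * n%:R) * (1 - \1_(B t) w) <= \sum_(t <- s) a t.
    rewrite big_seq [leRHS]big_seq; apply: ler_sum => t ts.
    have a0 : 0 <= a t by apply: sumr_ge0 => i _; exact: ltW (Fw t ts i).
    have [wB|wB] := pselect (B t w); first by rewrite indicE mem_set// subrr mulr0.
    rewrite indicE memNset// subr0 mulr1 leNgt; apply/negP => alt; apply: wB.
    by split; [exact: Fw|rewrite -/(a t); move: alt; lra].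
  move: h2; rewrite -mulr_sumr sumrB.
  have -> : \sum_(t <- s) (1 : R) = (size s)%:R.
    by rewrite big_const_seq count_predT iter_addr_0.
  move=> /le_trans /(_ h).
  have -> : L * ((size s)%:R * n%:R) = 2 * L * n%:R * ((size s)%:R / 2) by field.
  rewrite ler_pM2l ?mulr_gt0//; set Z := \sum_(_ <- _) _; lra.
have PfE (X : set Om) : measurable X -> P X = (fine (P X))%:E.
  by move=> mX; rewrite fineK// fin_num_measure.
apply: (@le_trans _ _ (fine (P H) + fine (P (F `&` ~` H)))); last exact: lerD.
have mFH : measurable (F `&` ~` H) by apply: measurableI => //; exact: measurableC.
rewrite -lee_fin EFinD -!PfE//.
apply: (@le_trans _ _ (P (H `|` (F `&` ~` H)))); last exact: measureU2.
apply: le_measure; rewrite ?inE//; first exact: measurableU.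
by move=> w Fw; have [Hw|Hw] := pselect (H w); [left|right].
Qed.

End OrthantAverage.

Section Discretization.
Variables (R : realType) (T : time).
Local Notation V := (time_domain R T).

(** Any q with [E] inside [- pi q, pi q] allows Bessel's inequality, but the lattice must consist of
    times: for T = Z this is q = 1. The index starts at 1 because persistence concerns positive
    times. *)
Lemma time_lattice (E : set R) : E `<=` freq_domain R T -> bounded_set E ->
  exists q : R, exists u : nat -> V,
  [/\ 1 <= q, forall l, to_real (u l) = l.+1%:R / q & E `<=` `[- (pi * q), pi * q]%classic].
Proof.
case: T => /= ED bE.
  exists 1, (fun l => l.+1%:Z); split => //= [l|]; first by rewrite divr1.
  by rewrite mulr1.
have [K [Kr hK]] := bE; have p2 := pi_ge2 R.
pose q := Num.max 1 (K + 1).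
have q1 : 1 <= q by rewrite le_max lexx.
have qK : K + 1 <= q by rewrite le_max lexx orbT.
exists q, (fun l => l.+1%:R / q); split => // x Ex.
have K1 : K < K + 1 by rewrite ltrDl.
have /= xK := hK _ K1 x Ex.
rewrite /= in_itv/= -ler_norml; apply: (le_trans xK); apply: (le_trans qK).
by rewrite ler_peMl//; lra.
Qed.

Variable rho : {finite_measure set (measurableTypeR R) -> \bar R}.

(** Pointwise |x|^(-p) <= 1 + |x|^(-g). For k > 0 the bound uses the moment of order -2k, whereas
    finiteness is given at order -(2k + s). *)
Lemma moment_lt_pinfty (p g : R) : 0 <= p <= g -> rho (freq_domain R T) = 1%E ->
  (moment T rho (- g) < +oo)%E -> (moment T rho (- p) < +oo)%E.
Proof.
move=> /andP[p0 pg] rD fin; have mD := @measurable_freq_domain R T.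
have mp (a : R) : measurable_fun (freq_domain R T : set (measurableTypeR R))
    (abs_pow a : measurableTypeR R -> \bar R).
  by apply: measurable_funTS; exact: measurable_abs_pow.
apply: (@le_lt_trans _ _ (\int[rho]_(x in freq_domain R T) (cst 1 x + abs_pow (- g) x))%E).
  apply: ge0_le_integral => //.
  - by move=> x _; exact: abs_pow_ge0.
  - by apply: emeasurable_funD.
  move=> x _ /=; rewrite /abs_pow !oppr_lt0; have [->|x0] /= := eqVneq x 0.
    have [p00|p00] := ltrP 0 p; first by rewrite (lt_le_trans p00 pg) addey.
    have -> : p = 0 by apply/eqP; rewrite eq_le p00.
    rewrite oppr0 powRr0; case: ifP => _; first by rewrite addey// leey.
    by rewrite leeDl// lee_fin powR_ge0.
  have x0' : 0 < `|x| by rewrite normr_gt0.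
  rewrite -EFinD lee_fin; have [x1|x1] := lerP 1 `|x|.
    have : `|x| `^ (- p) <= `|x| `^ 0 by apply: ler_powR => //; rewrite oppr_le0.
    by rewrite powRr0; have := powR_ge0 `|x| (- g); lra.
  have : `|x| `^ (- p) <= `|x| `^ (- g).
    by apply: ger_powR; [rewrite x0' ltW|rewrite lerN2].
  by lra.
rewrite ge0_integralD//; last by move=> x _; exact: abs_pow_ge0.
rewrite integral_cst// mul1e; apply: lte_add_pinfty => //.
exact: finite_freq_domain.
Qed.

End Discretization.

Section Core.
Variables (R : realType) (T : time) (d : measure_display) (Om : measurableType d).
Variables (P : probability Om R) (f : time_domain R T -> {RV P >-> R}).
Variable rho : {finite_measure set (measurableTypeR R) -> \bar R}.
Hypothesis f_GSP : is_GSP f.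
Hypothesis rho_spec : is_spectral_measure f rho.
Local Notation V := (time_domain R T).
Local Notation D := (freq_domain R T : set (measurableTypeR R)).
Local Notation leb_mu := (@lebesgue_measure R).
Local Notation gamma := (normal_prob (0 : R) 1).

Lemma persistence_bound (A : set (measurableTypeR R)) (nu e q N p l beta : R) (u : nat -> V) k :
  rho D = 1%E -> 0 < nu -> 0 < e -> measurable A -> A `<=` D -> leb_mu A = e%:E ->
  (forall B, measurable B -> B `<=` A -> (nu%:E * leb_mu B <= rho B)%E) ->
  1 <= q -> A `<=` `[- (pi * q), pi * q]%classic ->
  (forall j, to_real (u j) = j.+1%:R / q) ->
  (0 < k)%N -> 2 * k%:R <= N -> 4 <= N -> 0 <= p <= 2 * k%:R ->
  (moment T rho (- p) < +oo)%E -> 0 < l -> 0 < beta ->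
  beta * (128 * Num.sqrt (2 * ((32 * k%:R) `^ p * fine (moment T rho (- p))))) <=
    Num.sqrt (nu * e / 2) ->
  (persistence f N <= (fine (gamma [set z | l < N `^ (- (p / 2)) * z]) +
    2 * normal_ball (l / beta) `^ (e / (1024 * pi) * N))%:E)%E.
Proof.
move=> rD nu0 e0 mA AD lebA dens q1 Aitv ul k0 kN N4 pk Mfin l0 beta0.
have p0 := pi_gt0 R; have q0 : 0 < q by apply: lt_le_trans q1.
have N0 : 0 < N by lra.
have k0' : 0 < k%:R :> R by rewrite ltr0n.
have [s [s0 sb hs]] := small_average k0 kN pk rD Mfin.
have M0 : (0 < moment T rho (- p))%E.
  by apply: moment_gt0 => //; rewrite oppr_le0; case/andP: pk.
have M0' : 0 < fine (moment T rho (- p)) by rewrite fine_gt0// M0 Mfin.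
set K2 := 2 * _; have K20 : 0 < K2 by rewrite !mulr_gt0// powR_gt0// mulr_gt0.
set kap := Num.sqrt K2 => hbeta.
have kap0 : 0 < kap by rewrite sqrtr_gt0.
set sg := Num.sqrt (nu * e / 2) in hbeta.
have sg0 : 0 < sg by rewrite sqrtr_gt0 divr_gt0// mulr_gt0.
have qN : 4 <= q * N by nra.
(* The candidates are the lattice points in (0, N/2]. As q N >= 4, truncation keeps at least half of
   q N / 2. *)
have [M M1 M2] : exists2 M, M%:R <= q * N / 2 & q * N / 2 < M.+1%:R.
  have /andP[h1 h2] : (Num.truncn (q * N / 2))%:R <= q * N / 2 < (Num.truncn (q * N / 2)).+1%:R.
    by apply: truncn_itv; lra.
  by exists (Num.truncn (q * N / 2)).
have M3 : q * N / 4 <= M%:R by move: M2; rewrite -[M.+1%:R]natr1; lra.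
have M_gt0 : (0 < M)%N by rewrite -(ltr_nat R); apply: lt_le_trans M3; lra.
(* [X] is the value of m at which the greedy condition m * 2 pi q <= M e / 2 becomes an equality.
   Taking one more than its integer part is allowed, as the condition concerns m < n. With M >= q N
   / 4 and the exponent n / 64, q cancels and e N / (1024 pi) results. *)
pose X := M%:R * e / (4 * pi * q).
have X0 : 0 <= X by rewrite divr_ge0 ?mulr_ge0// ltW.
have [n [n0 nX hn]] : exists n, [/\ (0 < n)%N, X <= n%:R &
    forall m, (m < n)%N -> m%:R * (2 * pi * q) <= M%:R * (e / 2)].
  exists (Num.truncn X).+1; split=> // [|m]; first exact/ltW/truncnS_gt.
  by rewrite ltnS truncn_ge_nat// /X ler_pdivlMr ?mulr_gt0//; lra.
have [J Ju hJ] := lattice_selection f_GSP rho_spec nu0 e0 q0 mA AD Aitv lebA dens ul M_gt0 hn.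
pose F := [set w | forall t, t \in s -> forall i : 'I_n, 0 < f (t + J i) w].
have mF : measurable F by exact: (@measurable_orthant _ _ _ _ _ f s n J).
apply: (@le_trans _ _ (P F)).
  (* The persistence event is covered by a measurable event on finitely many times: a point of
     [0, N/2] plus a lattice point of (0, N/2] lies in (0, N]. *)
  rewrite -(measurable_mu_extE P mF); apply: le_mu_ext => w /= hw t ts i.
  apply: hw; rewrite to_realD; have [j jM ->] := Ju i; rewrite ul.
  have /andP[t0 tN] := sb _ ts.
  have j1 : 0 < j.+1%:R / q by rewrite divr_gt0.
  have j2 : j.+1%:R / q <= N / 2.
    rewrite ler_pdivrMr//; apply: (@le_trans _ _ M%:R); first by rewrite ler_nat.
    by move: M1; lra.
  by apply/andP; split; lra.
rewrite -[P F]fineK ?fin_num_measure// lee_fin.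
pose tau0 := kap * N `^ (- (p / 2)).
have Np0 : 0 < N `^ (- (p / 2)) by exact: powR_gt0.
have hs' : \int[rho]_(x in D) (wave s x / (size s)%:R ^+ 2) <= tau0 ^+ 2.
  apply: (le_trans hs); rewrite /tau0 exprMn sqr_sqrtr ?(ltW K20)//.
  rewrite -(powR_mulrn 2 (ltW Np0)) -powRrM.
  have -> : - (p / 2) * 2%:R = - p by field.
  by rewrite /K2; lra.
(* The level kap * l cancels the constant [kap] of the standard deviation, so the first term is
   exactly the tail in the claim. The second sees 64 * 2 * kap * l, whence the factor 128 in the
   condition on [beta]. *)
have kl0 : 0 < kap * l by rewrite mulr_gt0.
have kl20 : 0 < 2 * (kap * l) by rewrite mulr_gt0.
have tau00 : 0 <= tau0 by rewrite mulr_ge0// ltW.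
have := orthant_average_bound f_GSP rho_spec s0 n0 kl0 tau00 hs'
  (fun t => hJ t _ kl20).
move=> /le_trans; apply; apply: lerD.
  rewrite le_eqVlt; apply/orP; left; apply/eqP; congr (fine (gamma _)).
  by apply/seteqP; split=> z /=; rewrite /tau0 -mulrA ltr_pM2l.
apply: ler_wpM2l; first by [].
have lb0 : 0 < l / beta by rewrite divr_gt0.
have nb0 := normal_ball_gt0 lb0; have nb1 := normal_ball_le1 (l / beta).
apply: (@le_trans _ _ (normal_ball (l / beta) `^ (n%:R / 64))).
  apply: ge0_ler_powR; rewrite ?nnegrE ?normal_ball_ge0 ?divr_ge0//.
  apply: normal_ball_mono.
  rewrite ler_pdivrMr// mulrAC ler_pdivlMr//.
  have -> : 64 * (2 * (kap * l)) * beta = beta * (128 * kap) * l by ring.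
  by rewrite [leRHS]mulrC ler_pM2r.
apply: ger_powR; first by rewrite nb0.
rewrite ler_pdivlMr//; apply: le_trans nX.
rewrite /X ler_pdivlMr ?mulr_gt0//.
have E (c : R) : c != 0 -> e / (1024 * c) * N * 64 * (4 * c * q) = q * N / 4 * e.
  by move=> c0; field.
by rewrite E ?gt_eqF// ler_pM2r.
Qed.

End Core.

(** * Calibration of the constants *)

Lemma sqrt_ratio_le (R : realType) (a M X c K : R) : 0 < a -> 0 < M -> 0 < X -> 0 < c ->
  0 < K -> 2 * K * c * X <= 1 ->
  c * Num.sqrt (a / M) * (K * Num.sqrt (2 * (X ^+ 2 * M))) <= Num.sqrt (a / 2).
Proof.
move=> a0 M0 X0 c0 K0 h; set lhs := (X in X <= _).
have lhs0 : 0 <= lhs.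
  by apply: mulr_ge0; apply: mulr_ge0; rewrite ?sqrtr_ge0 ?(ltW c0) ?(ltW K0).
have a2 : 0 <= a / 2 by rewrite divr_ge0 ?(ltW a0).
rewrite -[lhs](ger0_norm lhs0) -sqrtr_sqr ler_sqrt//.
have -> : lhs ^+ 2 = (2 * K * c * X) ^+ 2 * (a / 2).
  rewrite /lhs !exprMn !sqr_sqrtr ?mulr_ge0 ?sqr_ge0 ?invr_ge0 ?(ltW a0) ?(ltW M0) ?(ltW X0)//.
  by field; rewrite gt_eqF.
have y0 : 0 <= 2 * K * c * X.
  by apply: mulr_ge0 (ltW X0); apply: mulr_ge0 (ltW c0); apply: mulr_ge0 (ltW K0).
by apply: ler_piMl a2 _; exact: exprn_ile1.
Qed.

Lemma r_paramE (R : realType) k (s : R) : 0 <= s < 2 ->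
  r_param k s = if (0 < k)%N then k%:R else s / 2.
Proof.
move=> /andP[s0 s2]; rewrite /r_param; case: posnP => [->|k0].
  by rewrite max_r// divr_ge0.
rewrite max_l//; have : 1 <= k%:R :> R by rewrite ler1n.
by lra.
Qed.

(** Puts both cases of [beta_param] into the form required by [sqrt_ratio_le]. For k > 0 the product
    2 K c X is (2K)^(1 - k) <= 1; for k = 0 it equals 1. The maximum with 1 reflects that k = 0 uses
    a one-fold sumset, which suffices for moments of order s < 2. *)
Lemma beta_param_factor (R : realType) (T : time)
    (rho : {finite_measure set (measurableTypeR R) -> \bar R}) (nu s B K : R) (E : set R) k :
  let p := 2 * r_param k s in 0 <= s < 2 -> 0 < B -> 1 <= K ->
  exists c X : R, [/\ 0 < c, 0 < X,
    beta_param (2 * K * B) (fun s => (2 * K * B `^ (s / 2))^-1) T rho nu E k s =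
      c * Num.sqrt (nu * leb E / fine (moment T rho (- p))),
    (B * (maxn k 1)%:R) `^ p = X ^+ 2 & 2 * K * c * X <= 1].
Proof.
move=> p s02 B0 K1; have K0 : 0 < K by lra.
have K2 : 0 < 2 * K by rewrite mulr_gt0.
rewrite /p r_paramE// /beta_param; case: (posnP k) => [k0|k0].
  exists (2 * K * B `^ (s / 2))^-1, (B `^ (s / 2)).
  have X0 : 0 < B `^ (s / 2) by rewrite powR_gt0.
  have -> : 2 * (s / 2) = s by field.
  split; [by rewrite invr_gt0 mulr_gt0|exact: X0|by []| |].
    rewrite k0 max0n mulr1 -powR_mulrn ?powR_ge0// -powRrM; congr (_ `^ _).
    by rewrite divfK.
  by rewrite invfM mulrA divff ?gt_eqF// mul1r mulVf ?gt_eqF.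
have k0' : 0 < k%:R :> R by rewrite ltr0n.
have Bk : 0 < (B * k%:R) ^+ k by rewrite exprn_gt0// mulr_gt0.
exists ((2 * K * B * k%:R) ^- k), ((B * k%:R) ^+ k); split.
- by rewrite invr_gt0 exprn_gt0// mulr_gt0// mulr_gt0.
- exact: Bk.
- by [].
- rewrite (maxn_idPl k0) -exprM mulnC -powR_mulrn ?mulr_ge0 ?(ltW B0)//.
  by congr (_ `^ _); rewrite natrM.
rewrite -[2 * K * B * _]mulrA [(2 * K * _) ^+ k]exprMn invfM.
rewrite mulrA divfK ?gt_eqF// ler_pdivrMr ?exprn_gt0// mul1r.
rewrite -[leLHS]expr1; apply: ler_weXn2l => //.
by lra.
Qed.

Theorem theorem5p1 (R : realType) :
  exists (c0 c1 : R) (c : R -> R),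
  [/\ 0 < c0, 0 < c1, forall s : R, 0 <= s < 2 -> 0 < c s &
  exists N0 : set R -> R, (forall E : set R, 0 < N0 E) /\
  forall (T : time) (d : measure_display) (Om : measurableType d)
    (P : probability Om R) (f : time_domain R T -> {RV P >-> R})
    (rho rho_ac rho_s : {finite_measure set (measurableTypeR R) -> \bar R})
    (nu : R) (E : set R) (q gamma : R) (k : nat) (s : R),
  is_GSP f ->
  is_spectral_measure f rho ->
  rho (freq_domain R T) = 1%E ->
  (exists2 delta : R, 0 < delta & (moment T rho delta < +oo)%E) ->
  lebesgue_decomposition rho rho_ac rho_s ->
  rho_ac setT <> 0%E ->
  0 < nu ->
  E `<=` freq_domain R T ->
  bounded_set E ->
  lebesgue_measurable E ->
  (0 < completed_lebesgue_measure E)%E ->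
  (forall A : set R, measurable A -> A `<=` E ->
    (nu%:E * lebesgue_measure A <= rho_ac A)%E) ->
  0 < q ->
  [set q^-1 * x | x in E] `<=` `[- pi, pi] ->
  0 <= gamma ->
  (moment T rho (- gamma) < +oo)%E ->
  0 <= s < 2 ->
  gamma = 2 * k%:R + s ->
  let r := r_param k s in
  let alpha := c0 * leb E in
  let beta := beta_param c1 c T rho nu E k s in
  let theta := theta_param T rho k in
  forall N : R, Num.max (N0 E) (2 * k%:R) < N ->
  forall l : R, ell0 r theta N < l ->
  (persistence f N <=
    2%:E * normal_prob 0 1 [set z : R | (l < N `^ (- r) * z)%R] +
    (2 * q * N)%:E *
      (normal_prob 0 1 [set z : R | (beta * `|z| < l)%R]) `^ (alpha * N))%E].
Proof.
have p0 := pi_gt0 R.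
(* Here 32 comes from the kernel bound 32 k / N, 128 from 64 times the Markov factor 2, and 2 from
   the two square roots of 2 in the variance bound and in the residual variance nu |E| / 2. *)
exists (1 / (1024 * pi)), (2 * 128 * 32), (fun s => (2 * 128 * 32 `^ (s / 2))^-1); split.
- by apply: divr_gt0 ltr01 _; apply: mulr_gt0 p0; rewrite ltr0n.
- by rewrite !mulr_gt0 ?ltr0n.
- by move=> s _; rewrite invr_gt0 !mulr_gt0 ?powR_gt0 ?ltr0n.
(* The bound 4 controls truncation of the lattice and the one-fold sumset; the other term yields q N
   > 1. *)
exists (fun E => Num.max 4 (2 * pi / leb E)); split; first by move=> E; rewrite lt_max ltr0n.
move=> T d Om P f rho rho_ac rho_s nu E q gamma k s f_GSP rho_spec rD _ dec _ nu0 ED bE mE E0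
  dens q0 qE g0 Mfin /andP[s0 s2] gE.
move=> r alpha beta theta N; rewrite !gt_max => /andP[/andP[N4 Ne] kN] l hl.
have N0 : 0 < N by lra.
have l0 : 0 < l.
  apply: lt_trans hl; apply: mulr_gt0; last by rewrite lt_max ltr01 orbT.
  by apply: mulr_gt0 => //; exact: powR_gt0.
have [A mA [AE lebA]] := lebesgue_measurable_core mE.
have AI : A `<=` `[- (pi * q), pi * q]%classic.
  move=> x Ax; have /= := qE (q^-1 * x) (ex_intro2 _ _ x (AE _ Ax) erefl).
  rewrite !in_itv/= => /andP[h1 h2].
  by move: h1 h2; rewrite mulrC ler_pdivlMr// ler_pdivrMr// mulNr => -> ->.
pose I : set (measurableTypeR R) := `[- (pi * q), pi * q]%classic.
have lebI : lebesgue_measure I = (2 * pi * q)%:E.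
  have pq : 0 < pi * q by rewrite mulr_gt0.
  rewrite /I lebesgue_measure_itv/= lte_fin ifT; last by lra.
  by rewrite -EFinD; congr EFin; lra.
have lebAq : (lebesgue_measure A <= (2 * pi * q)%:E)%E.
  by rewrite -lebI; apply: le_measure; rewrite ?inE//; exact: measurable_itv.
pose e := leb E.
have lebAe : lebesgue_measure A = e%:E.
  by rewrite /e /leb -lebA fineK// ge0_fin_numE// (le_lt_trans lebAq)// ltry.
have e0 : 0 < e by rewrite -lte_fin -lebAe lebA.
have eq : e <= 2 * pi * q by rewrite -lee_fin -lebAe.
have dens' B : measurable B -> B `<=` A -> (nu%:E * lebesgue_measure B <= rho B)%E.
  move=> mB BA; apply: (le_trans (dens B mB (subset_trans BA AE))).
  by have [-> // _ _] := dec; rewrite leeDl.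
(* The scale [q'] is unrelated to the given [q], whose inverse need not be a time in [T]. *)
have [q' [u [q'1 ul EI]]] := time_lattice ED bE.
pose p := 2 * r.
have s02 : 0 <= s < 2 by rewrite s0.
have rE := r_paramE k s02.
have kk : k%:R <= (maxn k 1)%:R :> R by rewrite ler_nat leq_maxl.
have pk : 0 <= p <= 2 * (maxn k 1)%:R.
  rewrite /p /r rE; case: (posnP k) => [->|k0].
    by rewrite max0n mulr1 mulrC divfK// s0 ltW.
  by rewrite mulr_ge0//= ler_wpM2l.
have kN' : 2 * (maxn k 1)%:R <= N.
  by rewrite /maxn; case: ifP => _; rewrite ?mulr1; lra.
have Mp : (moment T rho (- p) < +oo)%E.
  apply: moment_lt_pinfty Mfin => //; rewrite gE /p /r rE.
  case: (posnP k) => [->|k0]; first by rewrite mulr0 add0r mulrC divfK// s0 lexx.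
  by rewrite mulr_ge0//= lerDl.
have Mp0 : 0 < fine (moment T rho (- p)).
  rewrite fine_gt0// Mp andbT; apply: moment_gt0 => //.
  by rewrite oppr_le0; case/andP: pk.
have ne0 : 0 < nu * e by rewrite mulr_gt0.
have [c [X [cp Xp betaE XE cX]]] :
    exists c X, [/\ 0 < c, 0 < X, beta = c * Num.sqrt (nu * e / fine (moment T rho (- p))),
    (32 * (maxn k 1)%:R) `^ p = X ^+ 2 & 2 * 128 * c * X <= 1].
  by apply: beta_param_factor; rewrite ?ltr0n// ler1n.
have beta0 : 0 < beta by rewrite betaE mulr_gt0// sqrtr_gt0 divr_gt0.
have hb : beta * (128 * Num.sqrt (2 * ((32 * (maxn k 1)%:R) `^ p * fine (moment T rho (- p))))) <=
    Num.sqrt (nu * e / 2).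
  by rewrite betaE XE; apply: sqrt_ratio_le => //; rewrite ltr0n.
have k1 : (0 < maxn k 1)%N by rewrite leq_max orbT.
have main := persistence_bound f_GSP rho_spec rD nu0 e0 mA (subset_trans AE ED) lebAe dens' q'1
  (subset_trans AE EI) ul k1 kN' (ltW N4) pk Mp l0 beta0 hb.
apply: (le_trans main).
rewrite (_ : p / 2 = r); last by rewrite /p; field.
have -> : [set z : R | beta * `|z| < l] = [set z : R | `|z| < l / beta].
  by apply/seteqP; split=> z /=; rewrite ltr_pdivlMr// mulrC.
have -> : normal_prob 0 1 [set z : R | `|z| < l / beta] = (normal_ball (l / beta))%:E.
  rewrite /normal_ball fineK// fin_num_measure//.
  by rewrite normal_ball_setE; exact: measurable_itv.
rewrite poweR_EFin (_ : alpha * N = e / (1024 * pi) * N); last by rewrite /alpha /e; ring.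
pose S : set (measurableTypeR R) := [set z : R | l < N `^ (- r) * z].
have mS : measurable S.
  have -> : S = `]l / N `^ (- r), +oo[%classic; last exact: measurable_itv.
  apply/seteqP; split=> z /=; rewrite in_itv/= andbT ltr_pdivrMr ?powR_gt0// mulrC//.
rewrite -[X in (_ <= 2%:E * X + _)%E]fineK; last by rewrite fin_num_measure.
rewrite -!EFinM -EFinD lee_fin.
apply: lerD; first by rewrite ler_peMl ?fine_ge0// ler1n.
rewrite ler_wpM2r ?powR_ge0//.
(* Together with e <= 2 pi q this gives 1 < q N, so the coefficient 2 obtained so far is at most 2 q
   N. *)
have : 2 * pi < N * e by move: Ne; rewrite ltr_pdivrMr.
move=> h; have h2 : N * e <= N * (2 * pi * q) by rewrite ler_pM2l.
have : 2 * pi * 1 < 2 * pi * (q * N) by rewrite mulr1; move: (lt_le_trans h h2); rewrite mulrCA [N * q]mulrC.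
rewrite ltr_pM2l ?mulr_gt0//; lra.
Qed.
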